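(* Under the standing assumptions in the context (on $c$, $h$, the cut-off symbol $\eta$ and the cone condition), each of the two families of back-propagated Gaussian beam parameters $$\Upsilon^{h,\pm}=\{(\omega^{\pm,h}_\gamma,a^{\pm,h}_\gamma,\xi^{\pm,h}_\gamma,\mathcal{A}^{\pm,h}_\gamma,\mathcal{M}^{\pm,h}_\gamma):\gamma\in\Gamma_h^\pm\},$$ constructed in the context, is a well-spread set of Gaussian beam parameters.
   Context: **Notation.** $d\ge2$; $x=(x_1,x_* )\in\mathbb{R}\times\mathbb{R}^{d-1}$; $T>0$ fixed. A symbol $\sigma$ on $\mathbb{R}^d\times\mathbb{R}^d$ is in $S^0_{1,0}$ if $|\partial_x^\beta\partial_\xi^\alpha\sigma|\le C_{\alpha,\beta}(1+|\xi|)^{-|\alpha|}$. $H^\pm(x,p)=\pm c(x)|p|$. Phase-space metric: $d((x,\xi),(x',\xi'))=|\xi||\xi'||x-x'|^2+|\xi-\xi'|^2$. **Velocity.** $c\in C^\infty(\mathbb{R}^d,\mathbb{R})$, $\partial^\alpha c\in L^\infty$ for every $\alpha$, $\inf c>0$. **Frame.** For each $j\ge1$ let $\{\xi_{j,k}:k=1,\dots,n_j\}\subset\mathbb{R}^d$ be points such that the balls $B_{2^j}(\xi_{j,k})$ are disjoint and contained in $B_{4^{j+1}}(0)\setminus B_{4^j}(0)$, and this corona is contained in $\bigcup_kB_{2^{j+1}}(\xi_{j,k})$. Put $\tilde\xi_{j,k}=2\pi\xi_{j,k}/4^j$, $\varphi(x)=2^{d/4}e^{-\pi|x|^2}$. For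 a full-rank lattice $\Lambda$ let $\Gamma=\{(j,k,\lambda):j\ge1,1\le k\le n_j,\lambda\in\Lambda\}$, $\bar\Gamma=\Gamma\cup\{(0,0,\lambda):\lambda\in\Lambda\}$, $\varphi_{(j,k,\lambda)}(x)=2^{jd/2}e^{2\pi i\xi_{j,k}\cdot(x-2^{-j}\lambda)}\varphi(2^jx-\lambda)$ for $j\ge1$, $\varphi_{(0,0,\lambda)}(x)=\varphi(x-\lambda)$. $\Lambda$ is fixed so that $Sf=\sum_{\gamma\in\bar\Gamma}\langle f,\varphi_\gamma\rangle\varphi_\gamma$ is invertible on $H^s(\mathbb{R}^d)$ and $\|f\|_{H^s}^2\asymp\sum_{\gamma\in\bar\Gamma}4^{2js}|\langle f,\varphi_\gamma\rangle|^2$ for all $s\in[-1,1]$. For $\gamma=(j,k,\lambda)\in\Gamma$: $a^{st}_\gamma=2^{-j}\lambda$, $\xi^{st}_\gamma=\xi_{j,k}$. **Boundary value and cut-off.** $h\in H^1(\mathbb{R}^d)$ is a function of $(t,x_* )$ with $h(0,\cdot)\equiv0$. $\eta(t,x_*,\tau,\xi_* )=a(t,x_* )b(t,x_*,\tau,\xi_* )$, where $a$ is smooth with compact support in $[L,U]\times\mathbb{R}^{d-1}$ for some $L,U\in(0,T)$; $b\in S^0_{1,0}$, and for some $\kappa>0$, $b$ vanishes at all points with $|(\tau,\xi_* )|\ge1$ and $\frac{|\tau|}{c(0,x_* )}-|\xi_*|\le\kappa|(\tau,\xi_* )|$. Put $h_\gamma=\langle h,S^{-1}\varphi_\gamma\rangle$,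 $\tilde h_\gamma=\eta(2^{-j}\lambda,\xi_{j,k})h_\gamma$ for $\gamma\in\Gamma$, $\Gamma_h=\{\gamma\in\Gamma:\tilde h_\gamma\ne0\}$, $\Gamma_h^+=\{\gamma\in\Gamma_h:(\tilde\xi_{j,k})_1<0\}$, $\Gamma_h^-=\{\gamma\in\Gamma_h:(\tilde\xi_{j,k})_1>0\}$ (these partition $\Gamma_h$). **Cone condition.** For every $\delta\in(0,1]$ there is $\mu>0$ such that for every solution $(x(t),p(t))$ of the Hamiltonian flow of $H^+$ or $H^-$ and every $t_0\in[L,U]$ with $x_1(t_0)=0$ and $|p_1(t_0)|\ge\delta|p(t_0)|$, one has $|x_1(t)|\ge\mu|t-t_0|$ for all $t\in[-T,T]$. **Back-propagated parameters.** For $\gamma=(j,k,\lambda)\in\Gamma_h^\pm$ let $(x_\gamma,p_\gamma,M_\gamma,A_\gamma)(t)$ be the global solution, with $H=H^\pm$ and its derivatives evaluated at $(x_\gamma(t),p_\gamma(t))$, of $\dot x=\partial_pH$, $\dot p=-\partial_xH$; $\dot M+D+BM+MB^t+MXM=0$ ($D_{il}=\partial_{x_i}\partial_{x_l}H$, $B_{il}=\partial_{x_i}\partial_{p_l}H$, $X_{il}=\partial_{p_i}\partial_{p_l}H$); $\dot A+\frac{A}{2H}(c^2\operatorname{Tr}M-\partial_pH\cdot\partial_xH-(\partial_pH)^TM\partial_pH)=0$, with data at time $t_\gamma=2^{-j}\lambda_1$: $x_\gamma(t_\gamma)=(0,2^{-j}\lambda_* )$; $p_{\gamma,*}(t_\gamma)=(\tilde\xi_{j,k})_*$;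 $p_{\gamma,1}(t_\gamma)=-\varsigma\sqrt{(\tilde\xi_{j,k})_1^2/c(0,2^{-j}\lambda_* )^2-|(\tilde\xi_{j,k})_*|^2}$ with $\varsigma=\operatorname{sign}((\tilde\xi_{j,k})_1)$; $A_\gamma(t_\gamma)=2^{(j+1/2)d/2}$; and $M_\gamma(t_\gamma)=M$ the unique symmetric matrix with $M_{kl}=2\pi i\delta_{kl}$ for $k,l\ge2$, $\dot p_{\gamma,k}(t_\gamma)-\sum_{n=1}^dM_{kn}\dot x_{\gamma,n}(t_\gamma)=0$ for $k=2,\dots,d$, and $\dot x_\gamma(t_\gamma)\cdot M\dot x_\gamma(t_\gamma)-\dot p_\gamma(t_\gamma)\cdot\dot x_\gamma(t_\gamma)=2\pi i$. Then $\omega^{\pm,h}_\gamma=4^j$, $a^{\pm,h}_\gamma=x_\gamma(0)$, $\xi^{\pm,h}_\gamma=\frac1{2\pi}4^jp_\gamma(0)$, $\mathcal{A}^{\pm,h}_\gamma=4^{-jd/4}A_\gamma(0)$, $\mathcal{M}^{\pm,h}_\gamma=\frac1{2\pi}M_\gamma(0)$. **Well-spread.** Parameters $\{(\omega_\gamma,a_\gamma,\xi_\gamma,\mathcal{A}_\gamma,\mathcal{M}_\gamma):\gamma\in\Gamma_0\}\subset\mathbb{R}_+\times\mathbb{R}^d\times(\mathbb{R}^d\setminus\{0\})\times(\mathbb{R}\setminus\{0\})\times\mathbb{C}^{d\times d}$, $\Gamma_0\subseteq\Gamma$, are well-spread if, with constants uniform in $\gamma=(j,k,\lambda),\gamma'\in\Gamma_0$: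 (i) $|a^{st}_\gamma-a^{st}_{\gamma'}|\lesssim|a_\gamma-a_{\gamma'}|+1$; (ii) $d((a_\gamma,\xi_\gamma),(a_{\gamma'},\xi_{\gamma'}))\gtrsim d((a^{st}_\gamma,\xi^{st}_\gamma),(a^{st}_{\gamma'},\xi^{st}_{\gamma'}))$; (iii) $\mathcal{M}_\gamma$ is symmetric, $\|\mathcal{M}_\gamma\|\lesssim1$, $\operatorname{Im}\mathcal{M}_\gamma\gtrsim I_d$; (iv) $\omega_\gamma\asymp4^j$, $|\xi_\gamma|\asymp\omega_\gamma$; (v) $|\mathcal{A}_\gamma|\asymp1$.
   Formalization: In the definition of well-spread parameters the amplitudes are taken in ℂ∖{0} instead of ℝ∖{0}, because the amplitude equation has complex coefficients and its solutions at time 0 are in general not real (for example c = 1, d = 2). *)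

(* Defs.v *)
From HB Require Import structures.
From mathcomp Require Import all_boot all_order all_algebra.
From mathcomp Require Import all_classical all_reals all_analysis.
From mathcomp.real_closed Require Import complex.
Set Implicit Arguments.
Unset Strict Implicit.
Unset Printing Implicit Defensive.
Import Order.TTheory GRing.Theory Num.Theory numFieldNormedType.Exports.
Local Open Scope classical_set_scope.
Local Open Scope ring_scope.
Local Open Scope complex_scope.

(* n-dimensional Lebesgue measure, on the product sigma-algebra of n.-tuple R;
   the library has only binary products of measures. *)
Section LebesgueTuple.
Context {R : realType}.
Local Notation RR := (measurableTypeR R).

Definition tcons n (u : RR * n.-tuple RR) : n.+1.-tuple RR :=
  [tuple of u.1 :: u.2].

Definition tuncons n (t : n.+1.-tuple RR) : RR * n.-tuple RR :=
  (tnth t ord0, [tuple of behead t]).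

Lemma measurable_tcons n : measurable_fun setT (@tcons n).
Proof. exact: measurable_cons. Qed.

Lemma measurable_tuncons n : measurable_fun setT (@tuncons n).
Proof.
by apply/measurable_fun_pair; [exact: measurable_tnth|exact: measurable_behead].
Qed.

Lemma tconsK n : cancel (@tcons n) (@tuncons n).
Proof. by case=> x t; rewrite /tuncons /tcons /=; congr pair; exact/val_inj. Qed.

Section step.
Variables (n : nat) (mu : {sigma_finite_measure set (n.-tuple RR) -> \bar R}).

Definition leb_step : set (n.+1.-tuple RR) -> \bar R :=
  pushforward (@lebesgue_measure R \x mu)%E (@tcons n).

Let leb_step_measure : {measure set (n.+1.-tuple RR) -> \bar R} :=
  measure_function_pushforward__canonical__measure_function_Measure
   (@lebesgue_measure R \x mu)%E (@measurable_tcons n).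

Let leb_step0 : leb_step set0 = 0%E.
Proof. exact: (measure0 leb_step_measure). Qed.

Let leb_step_ge0 A : (0 <= leb_step A)%E.
Proof. exact: (measure_ge0 leb_step_measure). Qed.

Let leb_step_additive : semi_sigma_additive leb_step.
Proof. exact: (@measure_semi_sigma_additive _ _ _ leb_step_measure). Qed.

HB.instance Definition _ := isMeasure.Build _ _ _ leb_step
  leb_step0 leb_step_ge0 leb_step_additive.

Let leb_step_sigma_finite : sigma_finite setT leb_step.
Proof.
have /sigma_finiteP[F [TF ndF Foo]] := sigma_finiteT (@lebesgue_measure R).
have /sigma_finiteP[G [TG ndG Goo]] := sigma_finiteT mu.
exists (fun k => @tuncons n @^-1` (F k `*` G k)).
  apply/esym/seteqP; split=> // t _.
  have [k _ Fk] : (\bigcup_k F k) (tuncons t).1 by rewrite -TF.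
  have [l _ Gl] : (\bigcup_k G k) (tuncons t).2 by rewrite -TG.
  exists (maxn k l) => //; split.
    by move: Fk; exact/subsetPset/ndF/leq_maxl.
  by move: Gl; exact/subsetPset/ndG/leq_maxr.
move=> k; have [mF Fk] := Foo k; have [mG Gk] := Goo k; split.
  by rewrite -[X in measurable X]setTI; apply: measurable_tuncons => //;
    exact: measurableX.
rewrite /leb_step /pushforward -comp_preimage (_ : _ \o _ = id) ?preimage_id.
  by rewrite product_measure1E// lte_mul_pinfty// ge0_fin_numE.
by apply/funext => x /=; rewrite tconsK.
Qed.

HB.instance Definition _ := Measure_isSigmaFinite.Build _ _ _ leb_step
  leb_step_sigma_finite.

End step.

Fixpoint lebesgue_tuple n : {sigma_finite_measure set (n.-tuple RR) -> \bar R} :=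
  match n with
  | 0 => \d_([tuple] : 0.-tuple RR)
  | k.+1 => leb_step (lebesgue_tuple k)
  end.
End LebesgueTuple.

Section Integration.
Context {R : realType}.
Local Notation C := R[i].
Local Notation RR := (measurableTypeR R).

Definition vec n (t : n.-tuple RR) : 'rV[R]_n := \row_i tnth t i.

Definition cmeasurable n (f : 'rV[R]_n -> C) : Prop :=
  measurable_fun setT (fun t : n.-tuple RR => complex.Re (f (vec t)) : R) /\
  measurable_fun setT (fun t : n.-tuple RR => complex.Im (f (vec t)) : R).

Definition cintegral n (f : 'rV[R]_n -> C) : C :=
  (\int[lebesgue_tuple n]_t complex.Re (f (vec t)))%R +i*
  (\int[lebesgue_tuple n]_t complex.Im (f (vec t)))%R.

Definition sqint n (f : 'rV[R]_n -> C) : \bar R :=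
  (\int[lebesgue_tuple n]_t (Normc.normc (f (vec t)) ^+ 2)%:E)%E.

Definition L2 n (f : 'rV[R]_n -> C) : Prop :=
  cmeasurable f /\ (sqint f < +oo)%E.

End Integration.

Section Euclidean.
Context {R : realType}.

Definition dot n (u v : 'rV[R]_n) : R := \sum_i u 0 i * v 0 i.

(* Euclidean norm; the norm `|x| of 'rV is the sup norm. *)
Definition enorm n (x : 'rV[R]_n) : R := Num.sqrt (dot x x).

Definition eball n (x : 'rV[R]_n) (r : R) : set 'rV[R]_n :=
  [set y | enorm (y - x) < r].

Definition evec n (i : 'I_n) : 'rV[R]_n := delta_mx 0 i.

(* (0, x_* ) for x = (x_1, x_* ) *)
Definition tail m (x : 'rV[R]_m.+1) : 'rV[R]_m.+1 :=
  \row_i (if i == ord0 then 0 else x 0 i).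

Definition phase_dist n (x xi x' xi' : 'rV[R]_n) : R :=
  enorm xi * enorm xi' * enorm (x - x') ^+ 2 + enorm (xi - xi') ^+ 2.

Definition full_rank_lattice n (Lam : set 'rV[R]_n) : Prop :=
  exists2 B : 'M[R]_n, B \in unitmx &
    Lam = [set z | exists k : 'rV[int]_n, z = map_mx intr k *m B].

End Euclidean.

Section Smooth.
Context {R : realType}.
Local Notation C := R[i].

Definition Dseq (V : normedModType R) (vs : seq V) (f : V -> R) : V -> R :=
  foldr (fun v g => 'D_v g) f vs.

Definition smooth (V : normedModType R) (f : V -> R) : Prop :=
  forall (vs : seq V) (x : V), differentiable (Dseq vs f) x.

Definition DseqC (V : normedModType R) (vs : seq V) (f : V -> C) (x : V) : C :=
  Dseq vs (fun y => complex.Re (f y)) x +i* Dseq vs (fun y => complex.Im (f y)) x.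

Definition smoothC (V : normedModType R) (f : V -> C) : Prop :=
  smooth (fun x => complex.Re (f x)) /\ smooth (fun x => complex.Im (f x)).

(* A multi-index is encoded by a sequence of coordinate directions. *)
Definition symbol0 n (b : 'rV[R]_n -> 'rV[R]_n -> C) : Prop :=
  smoothC (fun z : 'rV[R]_n * 'rV[R]_n => b z.1 z.2) /\
  forall alpha beta : seq 'I_n, exists K : R, forall x xi : 'rV[R]_n,
    Normc.normc (DseqC ([seq (evec i, 0) | i <- beta] ++ [seq (0, evec i) | i <- alpha])
                 (fun z : 'rV[R]_n * 'rV[R]_n => b z.1 z.2) (x, xi))
    <= K / (1 + enorm xi) ^+ size alpha.

Definition schwartz n (f : 'rV[R]_n -> C) : Prop :=
  smoothC f /\
  forall alpha beta : seq 'I_n, exists K : R, forall x : 'rV[R]_n,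
    Normc.normc ((\prod_(i <- alpha) x 0 i)%:C * DseqC [seq evec i | i <- beta] f x)
    <= K.

Definition is_deriveC (f : R -> C) (t : R) (df : C) : Prop :=
  is_derive t 1 (fun s => complex.Re (f s)) (complex.Re df) /\
  is_derive t 1 (fun s => complex.Im (f s)) (complex.Im df).

End Smooth.

Section Sobolev.
Context {R : realType} {n : nat}.
Local Notation C := R[i].
Local Notation V := 'rV[R]_n.

Definition cis (theta : R) : C := cos theta +i* sin theta.

Definition fourier (f : V -> C) (xi : V) : C :=
  cintegral (fun x => f x * cis (- (2 * pi * dot x xi))).

(* Distributions are tested against Schwartz functions only. *)
Definition distr := (V -> C) -> C.

Definition regular (f : V -> C) : distr := fun psi => cintegral (fun x => f x * psi x).

Definition Hs_weight (s : R) (g : V -> C) : \bar R :=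
  sqint (fun xi => ((1 + enorm xi ^+ 2) `^ (s / 2))%:C * g xi).

(* The Fourier transform of u is the function g, with (1+|xi|^2)^(s/2) g in L^2.
   Such u is automatically linear and continuous on Schwartz functions. *)
Definition Hs_rep (s : R) (u : distr) (g : V -> C) : Prop :=
  [/\ cmeasurable g, (Hs_weight s g < +oo)%E &
      forall psi, schwartz psi ->
        u (fourier psi) = cintegral (fun xi => g xi * psi xi)].

(* The infimum is over a single a.e. class, and is +oo outside of H^s. *)
Definition Hs_sqnorm (s : R) (u : distr) : \bar R :=
  ereal_inf [set Hs_weight s g | g in Hs_rep s u].

Definition Hs (s : R) (u : distr) : Prop := (Hs_sqnorm s u < +oo)%E.

End Sobolev.

Section TraceZero.
Context {R : realType} {m : nat}.

(* The trace on {x_1 = 0}, i.e. the continuous extension to H^1 of the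
   restriction of Schwartz functions, vanishes at h. *)
Definition trace0 (h : 'rV[R]_m.+1 -> R[i]) : Prop :=
  exists phi : nat -> 'rV[R]_m.+1 -> R[i],
    [/\ forall k, schwartz (phi k),
        (fun k => Hs_sqnorm 1 (regular (fun x => h x - phi k x))) @ \oo --> 0%E &
        (fun k => sqint (fun y : 'rV[R]_m =>
           phi k (row_mx (0 : 'rV[R]_1) y : 'rV[R]_(1 + m)))) @ \oo --> 0%E].

Definition H1_trace0 (h : 'rV[R]_m.+1 -> R[i]) : Prop :=
  [/\ L2 h, Hs 1 (regular h) & trace0 h].

End TraceZero.

Section Frame.
Context {R : realType} {d : nat}.
Local Notation C := R[i].
Local Notation V := 'rV[R]_d.

(* (j, k, lambda) *)
Definition frame_index := (nat * nat * V)%type.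
Definition lev (g : frame_index) : nat := g.1.1.
Definition dir (g : frame_index) : nat := g.1.2.
Definition site (g : frame_index) : V := g.2.

Definition corona (j : nat) : set V :=
  eball 0 (4 ^+ j.+1) `\` eball 0 (4 ^+ j).

Definition frame_points (N : nat -> nat) (xi : nat -> nat -> V) : Prop :=
  forall j, (1 <= j)%N ->
  [/\ forall k k', (1 <= k <= N j)%N -> (1 <= k' <= N j)%N -> k <> k' ->
        eball (xi j k) (2 ^+ j) `&` eball (xi j k') (2 ^+ j) = set0,
      forall k, (1 <= k <= N j)%N -> eball (xi j k) (2 ^+ j) `<=` corona j &
      corona j `<=`
        \bigcup_(k in [set k | (1 <= k <= N j)%N]) eball (xi j k) (2 ^+ j.+1)].

Variables (N : nat -> nat) (xi : nat -> nat -> V) (Lam : set V).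

Definition Gamma : set frame_index :=
  [set g | [/\ (1 <= lev g)%N, (1 <= dir g <= N (lev g))%N & Lam (site g)]].

Definition Gammabar : set frame_index :=
  Gamma `|` [set g | [/\ lev g = 0%N, dir g = 0%N & Lam (site g)]].

Definition a_st (g : frame_index) : V := 2 ^- lev g *: site g.
Definition xi_st (g : frame_index) : V := xi (lev g) (dir g).
Definition xi_tilde (g : frame_index) : V := (2 * pi / 4 ^+ lev g) *: xi_st g.

Definition gauss (x : V) : R :=
  2 `^ (d%:R / 4) * expR (- (pi * enorm x ^+ 2)).

Definition frame_fun (g : frame_index) (x : V) : C :=
  if lev g == 0%N then (gauss (x - site g))%:C
  else (2 `^ ((lev g)%:R * d%:R / 2))%:C * cis (2 * pi * dot (xi_st g) (x - a_st g))
       * (gauss (2 ^+ lev g *: x - site g))%:C.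

(* <u, phi_g>, linear in u *)
Definition frame_coef (u : @distr R d) (g : frame_index) : C :=
  u (fun x => conjc (frame_fun g x)).

(* v = S u, with unconditional convergence of the series in H^s *)
Definition frame_op (s : R) (u v : @distr R d) : Prop :=
  Hs s v /\
  forall e : R, 0 < e -> exists2 F0 : seq frame_index, [set` F0] `<=` Gammabar &
    forall F : seq frame_index, uniq F -> [set` F] `<=` Gammabar -> {subset F0 <= F} ->
      (Hs_sqnorm s (fun psi => (v psi -
         \sum_(g <- F) frame_coef u g * regular (frame_fun g) psi)%R) <= e%:E)%E.

(* S is a bounded bijection of H^s with bounded inverse; the lower bound
   gives injectivity, S being linear. *)
Definition frame_op_invertible (s : R) : Prop :=
  [/\ forall u, Hs s u -> exists v, frame_op s u v,
      forall v, Hs s v -> exists2 u, Hs s u & frame_op s u v &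
      exists2 K : R, 0 < K & forall u v, Hs s u -> frame_op s u v ->
        (Hs_sqnorm s v <= K%:E * Hs_sqnorm s u)%E /\
        (Hs_sqnorm s u <= K%:E * Hs_sqnorm s v)%E].

Definition frame_norm_equiv (s : R) : Prop :=
  exists2 K : R, 0 < K & forall u, Hs s u ->
    let sumsq := (\esum_(g in Gammabar)
      (4 `^ (2 * (lev g)%:R * s) * Normc.normc (frame_coef u g) ^+ 2)%:E)%E in
    (Hs_sqnorm s u <= K%:E * sumsq)%E /\ (sumsq <= K%:E * Hs_sqnorm s u)%E.

(* S^{-1} phi_g, as an L^2 function *)
Definition dual_frame_fun (g : frame_index) : V -> C :=
  xget (fun=> 0) [set w | L2 w /\ frame_op 0 (regular w) (regular (frame_fun g))].

Definition bv_coef (h : V -> C) (g : frame_index) : C :=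
  cintegral (fun x => h x * conjc (dual_frame_fun g x)).

Definition bv_coef_cut (eta : V -> V -> C) (h : V -> C) (g : frame_index) : C :=
  eta (a_st g) (xi_st g) * bv_coef h g.

Definition Gamma_h (eta : V -> V -> C) (h : V -> C) : set frame_index :=
  [set g | Gamma g /\ bv_coef_cut eta h g <> 0].

End Frame.

Section HamiltonFlow.
Context {R : realType} {d : nat}.
Local Notation C := R[i].
Local Notation V := 'rV[R]_d.

Definition velocity (c : V -> R) : Prop :=
  [/\ smooth c,
      forall alpha : seq 'I_d, exists K : R, forall x,
        `|Dseq [seq evec i | i <- alpha] c x| <= K &
      0 < inf (range c)].

(* H^+ for true and H^- for false *)
Definition Ham (c : V -> R) (pm : bool) (x p : V) : R :=
  (if pm then 1 else -1) * c x * enorm p.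

Section Derivatives.
Variable H : V -> V -> R.

Definition gradx (x p : V) : V := \row_i 'D_(evec i) (fun y => H y p) x.
Definition gradp (x p : V) : V := \row_i 'D_(evec i) (H x) p.
Definition hessxx (x p : V) : 'M[R]_d :=
  \matrix_(i, l) 'D_(evec i) (fun y => 'D_(evec l) (fun z => H z p) y) x.
Definition hessxp (x p : V) : 'M[R]_d :=
  \matrix_(i, l) 'D_(evec i) (fun y => 'D_(evec l) (H y) p) x.
Definition hesspp (x p : V) : 'M[R]_d :=
  \matrix_(i, l) 'D_(evec i) (fun q => 'D_(evec l) (H x) q) p.

(* p = 0 is excluded, as c(x)|p| is not differentiable there *)
Definition ham_flow (x p : R -> V) : Prop :=
  forall t, [/\ p t != 0,
    is_derive t 1 x (gradp (x t) (p t)) & is_derive t 1 p (- gradx (x t) (p t))].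

Definition quad (M : 'M[C]_d) (v : V) : C :=
  \sum_i \sum_l (v 0 i)%:C * M i l * (v 0 l)%:C.

Definition riccati_flow (x p : R -> V) (M : R -> 'M[C]_d) : Prop :=
  forall t (i l : 'I_d),
  let D := map_mx (real_complex R) (hessxx (x t) (p t)) in
  let B := map_mx (real_complex R) (hessxp (x t) (p t)) in
  let X := map_mx (real_complex R) (hesspp (x t) (p t)) in
  is_deriveC (fun s => M s i l) t
    ((- (D + B *m M t + M t *m B^T + M t *m X *m M t)) i l).

Definition amplitude_flow (c : V -> R) (x p : R -> V) (M : R -> 'M[C]_d)
    (A : R -> C) : Prop :=
  forall t,
  is_deriveC A t
    (- (A t / (2 * H (x t) (p t))%:C *
        ((c (x t) ^+ 2)%:C * \tr (M t)
         - (dot (gradp (x t) (p t)) (gradx (x t) (p t)))%:C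
         - quad (M t) (gradp (x t) (p t))))).

End Derivatives.
End HamiltonFlow.

Section Beams.
Context {R : realType} {m : nat}.
Local Notation C := R[i].
Local Notation d := m.+1.
Local Notation V := 'rV[R]_d.

Definition cone_condition (c : V -> R) (T L U : R) : Prop :=
  forall delta : R, 0 < delta <= 1 -> exists2 mu : R, 0 < mu &
    forall (pm : bool) (x p : R -> V), ham_flow (Ham c pm) x p ->
    forall t0, L <= t0 <= U -> x t0 0 ord0 = 0 ->
      delta * enorm (p t0) <= `|p t0 0 ord0| ->
    forall t, - T <= t <= T -> mu * `|t - t0| <= `|x t 0 ord0|.

Definition cutoff (c : V -> R) (L U kappa : R) (a : V -> C) (b : V -> V -> C)
    : Prop :=
  [/\ smoothC a,
      compact (closure [set x | a x != 0]),
      closure [set x | a x != 0] `<=` [set x | L <= x 0 ord0 <= U],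
      symbol0 b &
      forall x xi : V, 1 <= enorm xi ->
        `|xi 0 ord0| / c (tail x) - enorm (tail xi) <= kappa * enorm xi ->
        b x xi = 0].

Variable xi : nat -> nat -> V.

(* Gamma_h^+ for true and Gamma_h^- for false *)
Definition Gamma_h_pm (N : nat -> nat) (Lam : set V) (eta : V -> V -> C)
    (h : V -> C) (pm : bool) : set (@frame_index R d) :=
  [set g | Gamma_h N xi Lam eta h g /\
    (if pm then xi_tilde xi g 0 ord0 < 0 else 0 < xi_tilde xi g 0 ord0)].

(* the time at which the beam g meets {x_1 = 0} *)
Definition t_hit (g : @frame_index R d) : R := a_st g 0 ord0.

Definition beam_data (c : V -> R) (g : @frame_index R d)
    (x p : R -> V) (M : R -> 'M[C]_d) (A : R -> C) : Prop :=
  let tg := t_hit g in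
  let xt := xi_tilde xi g in
  let x' := 'D_1 x tg in
  let p' := 'D_1 p tg in
  [/\ x tg = tail (a_st g),
      tail (p tg) = tail xt /\
      p tg 0 ord0 = - Num.sg (xt 0 ord0) *
        Num.sqrt (xt 0 ord0 ^+ 2 / c (tail (a_st g)) ^+ 2 - enorm (tail xt) ^+ 2),
      A tg = (2 `^ (((lev g)%:R + 1 / 2) * d%:R / 2))%:C,
      (M tg)^T = M tg /\
      (forall k l : 'I_d, k != ord0 -> l != ord0 ->
         M tg k l = if k == l then 0 +i* (2 * pi) else 0) &
      (forall k : 'I_d, k != ord0 ->
         (p' 0 k)%:C - \sum_n M tg k n * (x' 0 n)%:C = 0) /\
      quad (M tg) x' - (dot p' x')%:C = 0 +i* (2 * pi)].

Definition back_propagated (c : V -> R) (pm : bool) (g : @frame_index R d)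
    (x p : R -> V) (M : R -> 'M[C]_d) (A : R -> C) : Prop :=
  [/\ ham_flow (Ham c pm) x p,
      riccati_flow (Ham c pm) x p M,
      amplitude_flow (Ham c pm) c x p M A &
      beam_data c g x p M A].

Definition cmxnorm (M : 'M[C]_d) : R :=
  Num.sqrt (\sum_i \sum_l Normc.normc (M i l) ^+ 2).

(* Amplitudes are complex: A solves a linear equation with complex coefficients. *)
Definition well_spread (N : nat -> nat) (Lam : set V) (G0 : set (@frame_index R d))
    (omega : @frame_index R d -> R) (a xig : @frame_index R d -> V)
    (A : @frame_index R d -> C) (M : @frame_index R d -> 'M[C]_d) : Prop :=
  [/\ G0 `<=` Gamma N Lam,
      forall g, G0 g -> [/\ 0 < omega g, xig g != 0 & A g != 0],
      exists2 K : R, 0 < K & forall g g', G0 g -> G0 g' ->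
        enorm (a_st g - a_st g') <= K * (enorm (a g - a g') + 1),
      exists2 K : R, 0 < K & forall g g', G0 g -> G0 g' ->
        phase_dist (a_st g) (xi_st xi g) (a_st g') (xi_st xi g')
        <= K * phase_dist (a g) (xig g) (a g') (xig g') &
  [/\ forall g, G0 g -> (M g)^T = M g,
      exists2 K : R, 0 < K & forall g, G0 g -> cmxnorm (M g) <= K,
      exists2 k : R, 0 < k & forall g, G0 g -> forall v : V,
        k * enorm v ^+ 2 <= dot (v *m map_mx (@complex.Im R) (M g)) v,
      exists2 K : R, 0 < K & forall g, G0 g ->
        [/\ omega g <= K * 4 ^+ lev g, 4 ^+ lev g <= K * omega g,
            enorm (xig g) <= K * omega g & omega g <= K * enorm (xig g)] &
      exists2 K : R, 0 < K & forall g, G0 g ->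
        Normc.normc (A g) <= K /\ 1 <= K * Normc.normc (A g)]].

End Beams.

(* Main.v *)
(* Every beam starts on {x_1 = 0} at a place and time in the support of the
   cut-off, with unit-size momentum that is uniformly transversal, and
   H = +-c|p| is conserved, so all constants below are uniform.
   Separation in phase space: by homogeneity of H, Gronwall bounds the weighted
   distance W^2|x - y|^2 + |W p - W' q|^2 of two rescaled trajectories at any time
   by its value at time 0; when the first beam hits the hyperplane, the cone
   condition applied to the second one turns its distance to the hyperplane into a
   bound on the difference of the hitting times, and so on the distance of the
   boundary parameters. If W' is much smaller than W, the frequencies alone are
   far apart.
   Riccati: with y = u + iv, the form Im (y M y^* ) - e(t) (|y|^2 + |y M|^2) stays
   positive definite backwards in time for an exponentially decaying e(t); a first
   null vector would contradict the Riccati equation. This single inequality bounds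
   M and bounds Im M from below. Symmetry of M and the bounds on the amplitude
   follow from linear Gronwall estimates. *)
Require Import Defs.
From HB Require Import structures.
From mathcomp Require Import all_boot all_order all_algebra.
From mathcomp Require Import all_classical all_reals all_analysis.
From mathcomp.real_closed Require Import complex.
From mathcomp Require Import ring lra.
Set Implicit Arguments.
Unset Strict Implicit.
Unset Printing Implicit Defensive.
Import Order.TTheory GRing.Theory Num.Theory numFieldNormedType.Exports.
Local Open Scope classical_set_scope.
Local Open Scope ring_scope.
Local Open Scope complex_scope.

(** * Euclidean norm and Gronwall's inequality *)

(** The quadratic term of the Riccati equation rules out a direct Gronwall bound on M. It disappears
    for the pair (y, y M): along y' = y B + y M X this pair solves the linearised Hamiltonian flow,
    which keeps [imform] constant and changes [graphnorm] at a bounded rate. Symmetry of M(t) comes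
    after positivity, because the Gronwall constant for M - M^T contains the bound on M. The
    boundary covector shares only its tangential part with the momentum of the beam. Its first
    component is dual to time and equals c|p| up to sign and the factor 4^j / (2 pi); being
    conserved, it is compared at time 0, free of any shift in hitting time. Gronwall weighs
    positions by W^2, while [phase_dist] offers only W W'. When W' is far below W, the frequency gap
    pays for the position term because all beams start in one bounded set. Condition (i) holds since
    the points [a_st] lie in the compact support of a. Hitting times lie in [L, U], inside (0, T),
    so all estimates live on [0, T]. *)

Section EuclideanAlgebra.
Context {R : realType} {n : nat}.
Implicit Types (u v w : 'rV[R]_n) (k : R).

Lemma dot_mx u v : dot u v = (u *m v^T) 0 0.
Proof. by rewrite mxE; apply: eq_bigr => i _; rewrite mxE. Qed.

Lemma dotC u v : dot u v = dot v u.
Proof. by apply: eq_bigr => i _; rewrite mulrC. Qed.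

Lemma dotDl u v w : dot (u + v) w = dot u w + dot v w.
Proof. by rewrite !dot_mx mulmxDl mxE. Qed.

Lemma dotZl k u w : dot (k *: u) w = k * dot u w.
Proof. by rewrite !dot_mx -scalemxAl mxE. Qed.

Lemma dotNl u w : dot (- u) w = - dot u w.
Proof. by rewrite -scaleN1r dotZl mulN1r. Qed.

Lemma dotDr u v w : dot w (u + v) = dot w u + dot w v.
Proof. by rewrite !(dotC w) dotDl. Qed.

Lemma dotZr k u w : dot w (k *: u) = k * dot w u.
Proof. by rewrite !(dotC w) dotZl. Qed.

Lemma dotNr u w : dot w (- u) = - dot w u.
Proof. by rewrite !(dotC w) dotNl. Qed.

Definition dotE := (dotDl, dotDr, dotNl, dotNr, dotZl, dotZr).

Lemma dot_ge0 u : 0 <= dot u u.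
Proof. by apply: sumr_ge0 => i _; rewrite -expr2 sqr_ge0. Qed.

Lemma dot_coord u i : u 0 i ^+ 2 <= dot u u.
Proof.
rewrite /dot (bigD1 i)//= expr2 lerDl.
by apply: sumr_ge0 => j _; rewrite -expr2 sqr_ge0.
Qed.

Lemma dot_eq0 u : (dot u u == 0) = (u == 0).
Proof.
apply/eqP/eqP => [u0|->]; last by rewrite /dot big1// => i _; rewrite mxE mul0r.
apply/rowP => i; have := dot_coord u i.
by rewrite u0 mxE real_exprn_even_le0 ?num_real//= => /eqP.
Qed.

Lemma dot_mulmxl u v (B : 'M[R]_n) : dot (u *m B) v = dot u (v *m B^T).
Proof. by rewrite !dot_mx trmx_mul trmxK mulmxA. Qed.

Lemma enorm_ge0 u : 0 <= enorm u.
Proof. exact: sqrtr_ge0. Qed.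

Lemma enorm_sqr u : enorm u ^+ 2 = dot u u.
Proof. by rewrite sqr_sqrtr// dot_ge0. Qed.

Lemma enorm_eq0 u : (enorm u == 0) = (u == 0).
Proof. by rewrite -dot_eq0 -enorm_sqr sqrf_eq0. Qed.

Lemma enorm_gt0 u : (0 < enorm u) = (u != 0).
Proof. by rewrite lt_def enorm_ge0 andbT enorm_eq0. Qed.

Lemma enormZ k u : enorm (k *: u) = `|k| * enorm u.
Proof.
by rewrite /enorm !dotE mulrA -expr2 sqrtrM ?sqr_ge0// sqrtr_sqr.
Qed.

Lemma enormN u : enorm (- u) = enorm u.
Proof. by rewrite -scaleN1r enormZ normrN1 mul1r. Qed.

Lemma enorm_distC u v : enorm (u - v) = enorm (v - u).
Proof. by rewrite -enormN opprB. Qed.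

Lemma enorm_le u k : 0 <= k -> dot u u <= k ^+ 2 -> enorm u <= k.
Proof. by move=> k0; rewrite -enorm_sqr ler_pXn2r ?nnegrE ?enorm_ge0. Qed.

Lemma ler_dot u v : dot u v <= enorm u * enorm v.
Proof.
have [->|v0] := eqVneq v 0.
  by rewrite -(scale0r 0) dotZr mul0r mulr_ge0 ?enorm_ge0.
have v1 : 0 < dot v v by rewrite lt_def dot_eq0 v0 dot_ge0.
rewrite (le_trans (ler_norm _))// -(@ler_pXn2r _ 2) ?nnegrE ?mulr_ge0 ?enorm_ge0//.
rewrite exprMn !enorm_sqr real_normK ?num_real//.
have := dot_ge0 (dot v v *: u - dot u v *: v).
rewrite !dotE (dotC v u) => H.
have : 0 <= dot v v * (dot u u * dot v v - dot u v ^+ 2) by nra.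
by rewrite pmulr_rge0// subr_ge0.
Qed.

Lemma ler_norm_dot u v : `|dot u v| <= enorm u * enorm v.
Proof. by rewrite ler_norml ler_dot andbT lerNl -dotNl -(enormN u) ler_dot. Qed.

Lemma enormD u v : enorm (u + v) <= enorm u + enorm v.
Proof.
apply: enorm_le; first by rewrite addr_ge0 ?enorm_ge0.
rewrite !dotE (dotC v u) sqrrD -!enorm_sqr.
have := ler_dot u v; lra.
Qed.

Lemma enormB u v : enorm (u - v) <= enorm u + enorm v.
Proof. by rewrite -(enormN v) enormD. Qed.

Lemma ler_enormB u v : enorm u - enorm v <= enorm (u - v).
Proof. by rewrite lerBlDr -{1}(subrK v u) enormD. Qed.

Lemma enorm_distD w u v : enorm (u - v) <= enorm (u - w) + enorm (w - v).
Proof. by rewrite -{1}(subrK w u) -addrA enormD. Qed.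

Lemma enorm_coord u i : `|u 0 i| <= enorm u.
Proof.
rewrite -(@ler_pXn2r _ 2) ?nnegrE ?enorm_ge0//.
by rewrite enorm_sqr real_normK ?num_real// dot_coord.
Qed.

Lemma enorm_le_sum u : enorm u <= \sum_i `|u 0 i|.
Proof.
have s0 : 0 <= \sum_i `|u 0 i| by exact: sumr_ge0.
apply: enorm_le => //; rewrite expr2 mulr_suml; apply: ler_sum => i _.
rewrite -expr2 -real_normK ?num_real// expr2 ler_wpM2l//.
by rewrite (bigD1 i)//= lerDl sumr_ge0.
Qed.

Lemma enorm_le_const u k : (forall i, `|u 0 i| <= k) -> enorm u <= n%:R * k.
Proof.
move=> uk; apply: (le_trans (enorm_le_sum u)).
apply: (le_trans (ler_sum _ (fun i _ => uk i))).
by rewrite sumr_const card_ord mulr_natl.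
Qed.

Lemma enorm_mulmx u (B : 'M[R]_n) k : (forall i l, `|B i l| <= k) ->
  enorm (u *m B) <= n%:R * (n%:R * k) * enorm u.
Proof.
move=> Bk; rewrite -!mulrA; apply: enorm_le_const => l; rewrite mxE.
apply: (le_trans (ler_norm_sum _ _ _)).
rewrite mulr_natl -[n in _ *+ n]card_ord -sumr_const; apply: ler_sum => i _.
by rewrite normrM mulrC ler_pM ?enorm_coord.
Qed.

End EuclideanAlgebra.

Section CurveCalculus.
Context {R : realType}.
Implicit Types (t : R).

Lemma is_derive_rV n (x : R -> 'rV[R]_n) t (v : 'rV[R]_n) :
  (forall i, is_derive t 1 (fun s => x s 0 i) (v 0 i)) -> is_derive t 1 x v.
Proof.
move=> xv; have dx : derivable x t 1 by apply/derivable_mxP => i j; rewrite ord1.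
apply: DeriveDef => //; rewrite derive_mx//; apply/rowP => j.
by rewrite mxE derive_val.
Qed.

Lemma is_derive_coord n (x : R -> 'rV[R]_n) t (v : 'rV[R]_n) i :
  is_derive t 1 x v -> is_derive t 1 (fun s => x s 0 i) (v 0 i).
Proof.
move=> [dx <-]; rewrite derive_mx// mxE.
by apply/derivableP; move/derivable_mxP : dx.
Qed.

Lemma is_derive_sumf n (f : 'I_n -> R -> R) t (df : 'I_n -> R) :
  (forall i, is_derive t 1 (f i) (df i)) ->
  is_derive t 1 (fun s => \sum_i f i s) (\sum_i df i).
Proof.
move=> fdf; rewrite [X in is_derive _ _ X](_ : _ = \sum_i f i).
  exact: is_derive_sum.
by apply/funext => s; rewrite fct_sumE.
Qed.

Lemma is_deriveMf (f g : R -> R) t df dg :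
  is_derive t 1 f df -> is_derive t 1 g dg ->
  is_derive t 1 (fun s => f s * g s) (f t * dg + df * g t).
Proof.
move=> fd gd; apply: (is_derive_eq (is_deriveM fd gd)).
by rewrite /GRing.scale/= (mulrC df).
Qed.

Lemma is_derive_dot n (x y : R -> 'rV[R]_n) t v w :
  is_derive t 1 x v -> is_derive t 1 y w ->
  is_derive t 1 (fun s => dot (x s) (y s)) (dot (x t) w + dot v (y t)).
Proof.
move=> xv yw; rewrite /dot -big_split/=; apply: is_derive_sumf => i.
by apply: is_deriveMf; exact: is_derive_coord.
Qed.

Lemma is_derive_continuous (f : R -> R) t df :
  is_derive t 1 f df -> {for t, continuous f}.
Proof. by move=> fd; exact/differentiable_continuous/derivable1_diffP. Qed.

(** The hypothesis controls growth and decay alike, so s and t may come in either order; the beams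
    need the backward direction. *)
Lemma gronwall (f df : R -> R) (k a b : R) :
  (forall t, a <= t <= b -> is_derive t 1 f (df t)) ->
  (forall t, a <= t <= b -> `|df t| <= k * f t) ->
  forall s t, a <= s <= b -> a <= t <= b -> f t <= expR (k * `|t - s|) * f s.
Proof.
move=> fd dfk.
(* Integrating factor: [g (- k)] is nonincreasing and serves s <= t, [g k] is nondecreasing and
   serves t < s. *)
pose g (e : R) (u : R) := f u * expR (e * u).
have gd e u : a <= u <= b ->
    is_derive u 1 (g e) (f u * (e * expR (e * u)) + df u * expR (e * u)).
  move=> ab; apply: is_deriveMf; first exact: fd.
  have eu : is_derive u 1 ( *%R e) e.
    by apply: (is_derive_eq (is_deriveZ e (is_derive_id u 1))); exact: mulr1.
  apply: (is_derive_eq (is_derive1_comp (is_derive_expR (e * u)) eu)).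
  by rewrite mulrC.
have gc e u : a <= u <= b -> {for u, continuous (g e)}.
  by move=> ab; apply: is_derive_continuous; exact: gd.
have gcw e s t : a <= s -> t <= b -> {within `[s, t], continuous (g e)}.
  move=> sa tb; apply: continuous_in_subspaceT => u.
  rewrite inE/= in_itv/= => /andP[su ut].
  by apply: gc; rewrite (le_trans sa su) (le_trans ut tb).
have ab' s t u : a <= s -> t <= b -> u \in `]s, t[ -> a <= u <= b.
  rewrite in_itv/= => sa tb /andP[su ut].
  by rewrite (le_trans sa (ltW su)) (le_trans (ltW ut) tb).
move=> s t /andP[sa sb] /andP[ta tb]; have [st|ts] := leP s t.
- rewrite ger0_norm ?subr_ge0//.
  suff : g (- k) t <= g (- k) s.
    rewrite /g !mulNr !expRN -/(_ / _) ler_pdivrMr ?expR_gt0//.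
    by rewrite mulrBr expRD expRN; lra.
  apply: (@ler0_derive1_le_cc _ (g (- k)) s t) => //.
  + by move=> u /(ab' _ _ _ sa tb) abu; case: (gd (- k) u abu).
  + move=> u /(ab' _ _ _ sa tb) abu.
    rewrite derive1E (@derive_val _ _ _ _ _ _ _ (gd _ _ abu)).
    have := dfk _ abu; rewrite ler_norml => /andP[_ H].
    by have := expR_gt0 (- k * u); nra.
  + exact: gcw.
  + by rewrite in_itv/= lexx st.
  + by rewrite in_itv/= lexx st.
- rewrite ltr0_norm ?subr_lt0// opprB.
  suff : g k t <= g k s.
    rewrite /g => H; rewrite mulrBr expRD expRN mulrAC ler_pdivlMr ?expR_gt0//.
    lra.
  apply: (@ger0_derive1_le_cc _ (g k) t s); rewrite ?in_itv/= ?lexx ?(ltW ts)//.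
  + by move=> u /(ab' _ _ _ ta sb) abu; case: (gd k u abu).
  + move=> u /(ab' _ _ _ ta sb) abu.
    rewrite derive1E (@derive_val _ _ _ _ _ _ _ (gd _ _ abu)).
    have := dfk _ abu; rewrite ler_norml => /andP[H _].
    by have := expR_gt0 (k * u); nra.
  + exact: gcw.
Qed.

End CurveCalculus.

(** * Positivity along the Riccati flow *)

Section RiccatiPositivity.
Context {R : realType} {n : nat}.
Local Notation V := 'rV[R]_n.
Implicit Types (u v w : V) (P Q D B X : 'M[R]_n).

(* [mxre P Q u v] and [mxim P Q u v] are the real and the imaginary part of the
   row vector (u + i v)(P + i Q). *)
Definition mxre P Q u v : V := u *m P - v *m Q.
Definition mxim P Q u v : V := u *m Q + v *m P.

(* For y = u + i v and M = P + i Q: Im (y M y^* ). *)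
Definition imform P Q u v : R := dot u (mxim P Q u v) - dot v (mxre P Q u v).

(* For y = u + i v and M = P + i Q: |y|^2 + |y M|^2. *)
Definition graphnorm P Q u v : R :=
  dot u u + dot v v + dot (mxre P Q u v) (mxre P Q u v)
  + dot (mxim P Q u v) (mxim P Q u v).

Definition gap (e : R) P Q u v : R := imform P Q u v - e * graphnorm P Q u v.

Lemma rowDE u v i : (u + v) 0 i = u 0 i + v 0 i. Proof. by rewrite mxE. Qed.
Lemma rowNE u i : (- u) 0 i = - u 0 i. Proof. by rewrite mxE. Qed.
Lemma rowZE (k : R) u i : (k *: u) 0 i = k * u 0 i. Proof. by rewrite mxE. Qed.

Lemma mxre_lin P Q u v w z (h : R) :
  mxre P Q (u + h *: w) (v + h *: z) = mxre P Q u v + h *: mxre P Q w z.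
Proof.
rewrite /mxre !mulmxDl -!scalemxAl; apply/rowP => i.
by rewrite !(rowDE, rowNE, rowZE); ring.
Qed.

Lemma mxim_lin P Q u v w z (h : R) :
  mxim P Q (u + h *: w) (v + h *: z) = mxim P Q u v + h *: mxim P Q w z.
Proof.
rewrite /mxim !mulmxDl -!scalemxAl; apply/rowP => i.
by rewrite !(rowDE, rowNE, rowZE); ring.
Qed.

Lemma linear_coef_eq0 (p r : R) : (forall h, 0 <= h * p + h ^+ 2 * r) -> p = 0.
Proof.
move=> H; have r0 : 0 <= r by have := H 1; have := H (-1); nra.
have r1 : 0 < r + 1 by rewrite ltr_wpDl.
(* At this point the quadratic equals -(p / (r + 1))^2; the shift by 1 keeps the denominator
   positive when r = 0. *)
have := H (- p / (r + 1)).
have -> : - p / (r + 1) * p + (- p / (r + 1)) ^+ 2 * r = - (p / (r + 1)) ^+ 2.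
  by field; rewrite gt_eqF.
rewrite oppr_ge0 real_exprn_even_le0 ?num_real//= mulf_eq0 invr_eq0.
by rewrite (gt_eqF r1) orbF => /eqP.
Qed.

(** A null vector minimises a nonnegative quadratic form, so the first variation vanishes in every
    direction (w, z): that of [imform] equals e times that of [graphnorm]. *)
Lemma gap_null e P Q u v w z : (forall u v, 0 <= gap e P Q u v) ->
  gap e P Q u v = 0 ->
  dot w (mxim P Q u v) - dot z (mxre P Q u v)
  + dot u (mxim P Q w z) - dot v (mxre P Q w z)
  = 2 * e * (dot w u + dot z v + dot (mxre P Q w z) (mxre P Q u v)
             + dot (mxim P Q w z) (mxim P Q u v)).
Proof.
move=> g0 guv; apply/eqP; rewrite -subr_eq0; apply/eqP.
apply: (@linear_coef_eq0 _ (gap e P Q w z)) => h.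
have := g0 (u + h *: w) (v + h *: z).
suff -> : gap e P Q (u + h *: w) (v + h *: z) = gap e P Q u v + (h *
   (dot w (mxim P Q u v) - dot z (mxre P Q u v)
  + dot u (mxim P Q w z) - dot v (mxre P Q w z)
  - 2 * e * (dot w u + dot z v + dot (mxre P Q w z) (mxre P Q u v)
             + dot (mxim P Q w z) (mxim P Q u v)))
   + h ^+ 2 * gap e P Q w z) by rewrite guv add0r.
rewrite /gap /imform /graphnorm !mxre_lin !mxim_lin.
move: (mxre P Q u v) (mxim P Q u v) (mxre P Q w z) (mxim P Q w z) => a b a' b'.
rewrite !dotE (dotC u w) (dotC v z) (dotC a a') (dotC b b'); ring.
Qed.

Lemma gapZ e P Q u v h : gap e P Q (h *: u) (h *: v) = h ^+ 2 * gap e P Q u v.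
Proof.
rewrite -[h *: u]add0r -[h *: v]add0r /gap /imform /graphnorm mxre_lin mxim_lin.
have -> : mxre P Q 0 0 = 0 by rewrite /mxre !mul0mx subr0.
have -> : mxim P Q 0 0 = 0 by rewrite /mxim !mul0mx addr0.
by rewrite !add0r !dotE; ring.
Qed.

(* Real and imaginary part of - (D + B M + M B^T + M X M), M = P + i Q. *)
Definition ricre D B X P Q : 'M[R]_n :=
  - (D + B *m P + P *m B^T + P *m X *m P - Q *m X *m Q).
Definition ricim B X P Q : 'M[R]_n :=
  - (B *m Q + Q *m B^T + P *m X *m Q + Q *m X *m P).

Section slope.
Variables (D B X P Q : 'M[R]_n) (u v : V).
Let a := mxre P Q u v.
Let b := mxim P Q u v.
Let w := u *m B + a *m X.
Let z := v *m B + b *m X.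
Let a' := mxre (ricre D B X P Q) (ricim B X P Q) u v.
Let b' := mxim (ricre D B X P Q) (ricim B X P Q) u v.

(** Here w + i z = y B + y M X. In y times the Riccati right-hand side, y B M and y M X M combine to
    (w + i z) M, and what remains is linear in (y, y M). *)
Lemma mxre_ric : a' = - (u *m D + a *m B^T) - mxre P Q w z.
Proof.
rewrite /a' /w /z /a /b /mxre /mxim /ricre /ricim.
rewrite !(mulmxDl, mulmxDr, mulmxN, mulNmx, mulmxA); apply/rowP => i.
by rewrite !(rowDE, rowNE); ring.
Qed.

Lemma mxim_ric : b' = - (v *m D + b *m B^T) - mxim P Q w z.
Proof.
rewrite /b' /w /z /a /b /mxre /mxim /ricre /ricim.
rewrite !(mulmxDl, mulmxDr, mulmxN, mulNmx, mulmxA); apply/rowP => i.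
by rewrite !(rowDE, rowNE); ring.
Qed.

Variables (e k : R).
Hypotheses (Ds : D^T = D) (Xs : X^T = X) (e0 : 0 < e) (k0 : 0 <= k).
Hypotheses (Dk : forall y : V, enorm (y *m D) <= k * enorm y)
  (Bk : forall y : V, enorm (y *m B) <= k * enorm y)
  (Btk : forall y : V, enorm (y *m B^T) <= k * enorm y)
  (Xk : forall y : V, enorm (y *m X) <= k * enorm y).
Hypotheses (g0 : forall u v, 0 <= gap e P Q u v) (guv : gap e P Q u v = 0).
Hypothesis (uv1 : dot u u + dot v v = 1).

(* Moving y = u + i v along y B + y M X keeps [imform] constant, so at a null
   vector of [gap] the slope of [imform] is a multiple of the slope of
   [graphnorm] along that motion; the terms quadratic in M cancel. *)
Lemma gap_slope_lt0 :
  dot u b' - dot v a' - (4 * k + 1) * e * graphnorm P Q u v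
  - e * (2 * dot a a' + 2 * dot b b') < 0.
Proof.
have := gap_null w z g0 guv; rewrite -/a -/b mxre_ric mxim_ric.
move: (mxre P Q w z) (mxim P Q w z) => a'' b'' nul.
(* Symmetry of D and X makes their contributions to the slope of [imform] cancel; those of B^T are
   rewritten through w and z, to match [nul]. *)
have d1 : dot u (v *m D) = dot v (u *m D) by rewrite dotC dot_mulmxl Ds.
have d2 : dot u (b *m B^T) = dot w b - dot a (b *m X).
  by rewrite /w dotDl !dot_mulmxl Xs addrK.
have d3 : dot v (a *m B^T) = dot z a - dot a (b *m X).
  by rewrite /z dotDl dot_mulmxl (dotC (b *m X)) addrK.
have wu : dot w u = dot u (u *m B) + dot u (a *m X).
  by rewrite /w dotDl !(dotC _ u).
have zv : dot z v = dot v (v *m B) + dot v (b *m X).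
  by rewrite /z dotDl !(dotC _ v).
have -> : graphnorm P Q u v = 1 + dot a a + dot b b by rewrite -uv1.
clearbody a' b' w z a b.
have -> : dot u (- (v *m D + b *m B^T) - b'') - dot v (- (u *m D + a *m B^T) - a'')
  - (4 * k + 1) * e * (1 + dot a a + dot b b)
  - e * (2 * dot a (- (u *m D + a *m B^T) - a'')
         + 2 * dot b (- (v *m D + b *m B^T) - b''))
  = e * (- 2 * (dot w u + dot z v) - (4 * k + 1) * (1 + dot a a + dot b b)
    + 2 * (dot a (u *m D) + dot a (a *m B^T) + dot b (v *m D) + dot b (b *m B^T))).
  rewrite !dotE d1 d2 d3 (dotC a a'') (dotC b b'').
  move: nul; move: (dot w b) (dot z a) (dot u b'') (dot v a'') => x1 x2 x3 x4.
  move=> nul; have {}nul : x1 = x2 - x3 + x4 + 2 * e *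
    (dot w u + dot z v + dot a'' a + dot b'' b) by rewrite -nul; ring.
  by rewrite nul; ring.
rewrite pmulr_rlt0// wu zv.
(* Each of the eight pairings costs k times two squares, and each of |u|^2, |v|^2, |a|^2, |b|^2
   occurs four times in all. This is the 4 k of the rate; the additional 1 makes the sign strict. *)
have cs (y y' : V) (x : V) : enorm y <= k * enorm x ->
    2 * `|dot y' y| <= k * (dot y' y' + dot x x).
  move=> yx; rewrite -!enorm_sqr.
  have := ler_norm_dot y' y; have := enorm_ge0 y'; have := enorm_ge0 x.
  move: yx; move: (enorm y) (enorm y') (enorm x) => r s t rt t0 s0 H.
  have : 2 * `|dot y' y| <= 2 * (s * (k * t)).
    by rewrite ler_pM2l// (le_trans H)// ler_wpM2l.
  move=> /le_trans; apply.
  by have := mulr_ge0 k0 (sqr_ge0 (s - t)); nra.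
have := cs _ u _ (Bk u); have := cs _ u _ (Xk a).
have := cs _ v _ (Bk v); have := cs _ v _ (Xk b).
have := cs _ a _ (Dk u); have := cs _ b _ (Dk v).
have := cs _ a _ (Btk a); have := cs _ b _ (Btk b).
have nn (x y : R) : 2 * `|x| <= y -> - y <= 2 * x <= y.
  by move=> H; rewrite -ler_norml normrM ger0_norm.
do 8![move=> /nn/andP[? ?]].
have ka : 0 <= k * dot a a by rewrite mulr_ge0// dot_ge0.
have kb : 0 <= k * dot b b by rewrite mulr_ge0// dot_ge0.
have ? := dot_ge0 a; have ? := dot_ge0 b.
have uvk : k * dot u u + k * dot v v = k by rewrite -mulrDr uv1 mulr1.
lra.
Qed.

End slope.
End RiccatiPositivity.

Section RightSlope.
Context {R : realType}.

Lemma is_derive_right_ge0 (f : R -> R) (t t1 df : R) : t < t1 ->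
  is_derive t 1 f df -> (forall s, t < s <= t1 -> f t <= f s) -> 0 <= df.
Proof.
move=> tt1 [dft <-] ft; rewrite ['D_1 f t]cvg_at_rightE//.
apply: limr_ge.
  rewrite -(cvg_at_rightE (fun h : R => h^-1 *: ((f \o shift t) _ - f t)))//.
  apply: cvg_trans dft; apply: cvg_app.
  by move=> A [e egt0 Ae]; exists e => // x xe xgt0; apply: Ae => //; exact/lt0r_neq0.
near=> h; have h0 : 0 < h by near: h; exists 1 => /=.
apply: mulr_ge0; first by rewrite invr_ge0 ltW.
rewrite subr_ge0 [_%:A]mulr1; apply: ft; rewrite /= ltrDr h0 -lerBrDr ltW//.
by near: h; apply: nbhs_right_lt; rewrite subr_gt0.
Unshelve. all: by end_near. Qed.

End RightSlope.

Section ContinuousRows.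
Context {R : realType} {T : topologicalType} {n : nat}.
Implicit Types f g : T -> 'rV[R]_n.

Lemma continuous_sumf m (F : 'I_m -> T -> R) :
  (forall i, continuous (F i)) -> continuous (fun x => \sum_i F i x).
Proof. by move=> cF; apply: continuous_big => //; exact: add_continuous. Qed.

Lemma continuous_fctD (f g : T -> R) : continuous f -> continuous g ->
  continuous (fun x => f x + g x).
Proof. by move=> cf cg x; apply: continuousD; [exact: cf|exact: cg]. Qed.

Lemma continuous_fctB (f g : T -> R) : continuous f -> continuous g ->
  continuous (fun x => f x - g x).
Proof. by move=> cf cg x; apply: continuousB; [exact: cf|exact: cg]. Qed.

Lemma continuous_fctM (f g : T -> R) : continuous f -> continuous g ->
  continuous (fun x => f x * g x).
Proof. by move=> cf cg x; apply: continuousM; [exact: cf|exact: cg]. Qed.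

Definition row_continuous f := forall i, continuous (fun x => f x 0 i).

Lemma continuous_dot f g : row_continuous f -> row_continuous g ->
  continuous (fun x => dot (f x) (g x)).
Proof.
move=> cf cg; apply: continuous_sumf => i x.
by apply: continuousM; [exact: cf|exact: cg].
Qed.

Lemma row_continuousD f g : row_continuous f -> row_continuous g ->
  row_continuous (fun x => f x + g x).
Proof.
move=> cf cg i x.
rewrite (_ : (fun x => _) = fun x => f x 0 i + g x 0 i); last first.
  by apply/funext => y; rewrite mxE.
by apply: continuousD; [exact: cf|exact: cg].
Qed.

Lemma row_continuousB f g : row_continuous f -> row_continuous g ->
  row_continuous (fun x => f x - g x).
Proof.
move=> cf cg i x.
rewrite (_ : (fun x => _) = fun x => f x 0 i - g x 0 i); last first.
  by apply/funext => y; rewrite !mxE.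
by apply: continuousB; [exact: cf|exact: cg].
Qed.

Lemma row_continuous_mulmx f (A : T -> 'M[R]_n) : row_continuous f ->
  (forall i l, continuous (fun x => A x i l)) ->
  row_continuous (fun x => f x *m A x).
Proof.
move=> cf cA l.
rewrite (_ : (fun x => _) = fun x => \sum_i f x 0 i * A x i l); last first.
  by apply/funext => y; rewrite !mxE.
by apply: continuous_sumf => i x; apply: continuousM; [exact: cf|exact: cA].
Qed.

End ContinuousRows.

Lemma is_derive_mulmx {R : realType} n (P : R -> 'M[R]_n) (u : 'rV[R]_n) (t : R)
    (dP : 'M[R]_n) :
  (forall i l, is_derive t 1 (fun s => P s i l) (dP i l)) ->
  is_derive t 1 (fun s => u *m P s) (u *m dP).
Proof.
move=> PdP; apply: is_derive_rV => l; rewrite mxE.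
rewrite (_ : (fun s => _) = fun s => \sum_i u 0 i * P s i l); last first.
  by apply/funext => s; rewrite mxE.
exact: (@is_derive_sumf _ _ (fun i s => u 0 i * P s i l)
  _ _ (fun i => is_deriveZ (u 0 i) (PdP i l))).
Qed.

(** * Backward propagation of the gap inequality *)

Section RiccatiFlow.
Context {R : realType} {n : nat}.
Local Notation V := 'rV[R]_n.
Variables (P Q D B X : R -> 'M[R]_n).
Hypotheses
  (dP : forall (t : R) i l, is_derive t 1 (fun s => P s i l)
      (ricre (D t) (B t) (X t) (P t) (Q t) i l))
  (dQ : forall (t : R) i l, is_derive t 1 (fun s => Q s i l)
      (ricim (B t) (X t) (P t) (Q t) i l))
  (Ds : forall t, (D t)^T = D t) (Xs : forall t, (X t)^T = X t).
Variable k : R.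
Hypotheses (k0 : 0 <= k)
  (Dk : forall t (y : V), enorm (y *m D t) <= k * enorm y)
  (Bk : forall t (y : V), enorm (y *m B t) <= k * enorm y)
  (Btk : forall t (y : V), enorm (y *m (B t)^T) <= k * enorm y)
  (Xk : forall t (y : V), enorm (y *m X t) <= k * enorm y).
Variables (t0 t1 e1 : R).
Hypotheses (e10 : 0 < e1).
Hypothesis gap1 : forall u v : V, dot u u + dot v v = 1 ->
  0 < gap e1 (P t1) (Q t1) u v.

(** Equal to e1 at the final time t1, with the logarithmic derivative 4 k + 1 that [gap_slope_lt0]
    requires. *)
Let eps t := e1 * expR ((4 * k + 1) * (t - t1)).

Let eps_gt0 t : 0 < eps t.
Proof. by rewrite mulr_gt0// expR_gt0. Qed.

Let is_derive_eps (t : R) : is_derive t 1 eps ((4 * k + 1) * eps t).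
Proof.
have lin : is_derive t 1 (fun s => (4 * k + 1) * (s - t1)) (4 * k + 1).
  have sh : is_derive t 1 (fun s => s - t1) (1 - 0).
    exact: (is_deriveB (is_derive_id t 1) (is_derive_cst t1 t 1)).
  apply: (is_derive_eq (is_deriveZ (4 * k + 1) sh)).
  by rewrite subr0; exact: mulr1.
have ex := @is_derive1_comp _ expR (fun s => (4 * k + 1) * (s - t1)) t _ _
  (is_derive_expR _) lin.
apply: (is_derive_eq (is_deriveZ e1 ex)).
by rewrite /eps/= /GRing.scale/=; ring.
Qed.

Let q t u v := gap (eps t) (P t) (Q t) u v.

Let is_derive_q (t : R) (u v : V) (a := mxre (P t) (Q t) u v) (b := mxim (P t) (Q t) u v)
   (a' := mxre (ricre (D t) (B t) (X t) (P t) (Q t)) (ricim (B t) (X t) (P t) (Q t)) u v)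
   (b' := mxim (ricre (D t) (B t) (X t) (P t) (Q t)) (ricim (B t) (X t) (P t) (Q t)) u v) :
  is_derive t 1 (fun s => q s u v)
    (dot u b' - dot v a' - (4 * k + 1) * eps t * graphnorm (P t) (Q t) u v
     - eps t * (2 * dot a a' + 2 * dot b b')).
Proof.
have da : is_derive t 1 (fun s => mxre (P s) (Q s) u v) a'.
  by apply: is_deriveB; apply: is_derive_mulmx.
have db : is_derive t 1 (fun s => mxim (P s) (Q s) u v) b'.
  by apply: is_deriveD; apply: is_derive_mulmx.
have dF : is_derive t 1 (fun s => imform (P s) (Q s) u v) (dot u b' - dot v a').
  have H w : is_derive t 1 (fun _ : R => w : V) 0 by exact: is_derive_cst.
  apply: (is_derive_eq (is_deriveB (is_derive_dot (H u) db) (is_derive_dot (H v) da))).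
  by rewrite -(scale0r 0) !dotZl !mul0r !addr0.
have dE : is_derive t 1 (fun s => graphnorm (P s) (Q s) u v)
    (2 * dot a a' + 2 * dot b b').
  have c1 : is_derive t 1 (fun _ : R => dot u u + dot v v) 0 by exact: is_derive_cst.
  apply: (is_derive_eq (is_deriveD (is_deriveD c1 (is_derive_dot da da))
     (is_derive_dot db db))).
  by rewrite -/a -/b (dotC a' a) (dotC b' b); ring.
apply: (is_derive_eq (is_deriveB dF (is_deriveMf (is_derive_eps t) dE))).
ring.
Qed.

Let cu : row_continuous (fun z : R * (V * V) => z.2.1).
Proof.
move=> i z; apply: (@continuous_comp _ _ _ (fun z : R * (V * V) => z.2.1)
  (fun y : V => y 0 i)); last exact: coord_continuous.
by apply: (@continuous_comp _ _ _ snd fst); [exact: cvg_snd|exact: cvg_fst].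
Qed.

Let cv : row_continuous (fun z : R * (V * V) => z.2.2).
Proof.
move=> i z; apply: (@continuous_comp _ _ _ (fun z : R * (V * V) => z.2.2)
  (fun y : V => y 0 i)); last exact: coord_continuous.
by apply: (@continuous_comp _ _ _ snd snd); exact: cvg_snd.
Qed.

Let continuous_q :
  continuous (fun z : R * (V * V) => q z.1 z.2.1 z.2.2).
Proof.
have cfst (f : R -> R) : continuous f -> continuous (fun z : R * (V * V) => f z.1).
  by move=> cf z; apply: (@continuous_comp _ _ _ fst f); [exact: cvg_fst|exact: cf].
have cP i l : continuous (fun z : R * (V * V) => P z.1 i l).
  by apply: (cfst (fun s => P s i l)) => t; exact: is_derive_continuous (dP t i l).
have cQ i l : continuous (fun z : R * (V * V) => Q z.1 i l).
  by apply: (cfst (fun s => Q s i l)) => t; exact: is_derive_continuous (dQ t i l).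
have ce : continuous (fun z : R * (V * V) => eps z.1).
  by apply: cfst => t; exact: is_derive_continuous (is_derive_eps t).
have ca : row_continuous (fun z : R * (V * V) => mxre (P z.1) (Q z.1) z.2.1 z.2.2).
  by apply: row_continuousB; exact: row_continuous_mulmx.
have cb : row_continuous (fun z : R * (V * V) => mxim (P z.1) (Q z.1) z.2.1 z.2.2).
  by apply: row_continuousD; exact: row_continuous_mulmx.
have cF := continuous_fctB (continuous_dot cu cb) (continuous_dot cv ca).
have cE := continuous_fctD (continuous_fctD (continuous_fctD
  (continuous_dot cu cu) (continuous_dot cv cv)) (continuous_dot ca ca))
  (continuous_dot cb cb).
exact: (continuous_fctB cF (continuous_fctM ce cE)).
Qed.

Let sphere : set (V * V) := [set y | dot y.1 y.1 + dot y.2 y.2 = 1].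

(** Time and vector are taken jointly, so that a latest failure time is attained together with a
    vector failing at it. Restricting to unit vectors confines them to a box. *)
Let compact_failures :
  compact [set z : R * (V * V) | [/\ t0 <= z.1 <= t1, sphere z.2 &
                                  q z.1 z.2.1 z.2.2 <= 0]].
Proof.
pose I (i : 'I_n) : set R := `[-1, 1]%classic.
have cI : compact [set y : V | forall i, I i (y 0 i)].
  by apply: rV_compact => i; exact: segment_compact.
apply: (@subclosed_compact _ _ (`[t0, t1]%classic `*`
  ([set y : V | forall i, I i (y 0 i)] `*` [set y : V | forall i, I i (y 0 i)]))).
- have -> : [set z : R * (V * V) | [/\ t0 <= z.1 <= t1, sphere z.2 &
               q z.1 z.2.1 z.2.2 <= 0]] =
    (fun z => z.1) @^-1` [set x | t0 <= x] `&` ((fun z => z.1) @^-1` [set x | x <= t1]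
    `&` ((fun z : R * (V * V) => dot z.2.1 z.2.1 + dot z.2.2 z.2.2) @^-1` [set x | x = 1]
    `&` (fun z : R * (V * V) => q z.1 z.2.1 z.2.2) @^-1` [set x | x <= 0])).
    apply/seteqP; split=> z /=; first by move=> [/andP[-> ->] ? ?].
    by move=> [-> [-> [? ?]]].
  have c1 : continuous (fun z : R * (V * V) => z.1) by move=> z; exact: cvg_fst.
  have cs : continuous (fun z : R * (V * V) => dot z.2.1 z.2.1 + dot z.2.2 z.2.2).
    by apply: continuous_fctD; exact: continuous_dot.
  apply: closedI; first by apply: preimage_closed; [move=> z _; exact: c1|exact: closed_ge].
  apply: closedI; first by apply: preimage_closed; [move=> z _; exact: c1|exact: closed_le].
  apply: closedI; first by apply: preimage_closed; [move=> z _; exact: cs|exact: closed_eq].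
  by apply: preimage_closed; [move=> z _; exact: continuous_q|exact: closed_le].
- by apply: compact_setX; [exact: segment_compact|exact: compact_setX].
- move=> [t [u v]] /= [tt uv _].
  have b (y z : V) : dot y y + dot z z = 1 -> forall i, I i (y 0 i).
    move=> yz i; rewrite /I /= in_itv/= -ler_norml.
    rewrite -(@ler_pXn2r _ 2)// ?nnegrE// expr1n real_normK ?num_real//.
    by rewrite (le_trans (dot_coord _ _))// -yz lerDl dot_ge0.
  split; first by rewrite in_itv.
  by split; [exact: b uv|apply: (b v u); rewrite addrC].
Qed.

(* At the last failure time the form [gap] is nonnegative and has a null
   vector, along which it would decrease strictly in time. *)
Lemma riccati_gap_gt0 t (u v : V) : t0 <= t <= t1 -> dot u u + dot v v = 1 ->
  0 < q t u v.
Proof.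
move=> tt uv; rewrite ltNge; apply/negP => qtuv.
have [||] := compact_EVT_max _ compact_failures (f := fun z : R * (V * V) => z.1).
- by exists (t, (u, v)).
- by apply: continuous_subspaceT => z; exact: cvg_fst.
move=> {t u v tt uv qtuv} [t [u v]]; rewrite inE/= => -[/andP[t0t tt1] uv quv] tmax.
have {tmax} after s (u' v' : V) : t < s <= t1 -> dot u' u' + dot v' v' = 1 ->
    0 < q s u' v'.
  move=> /andP[ts st1] uv'; rewrite ltNge; apply/negP => qs.
  have : s <= t.
    apply: (tmax (s, (u', v'))); rewrite inE/=; split => //.
    by rewrite st1 (le_trans t0t (ltW ts)).
  by rewrite leNgt ts.
(* The last failure precedes t1, where [gap1] holds, so there are later times and all of them have a
   positive form. *)
have lt1 : t < t1.
  rewrite lt_neqAle tt1 andbT; apply: contraTneq quv => ->.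
  by rewrite -ltNge /q /eps subrr mulr0 expR0 mulr1 gap1.
have qc (u' v' : V) : continuous (fun s => q s u' v').
  by move=> s; apply: is_derive_continuous; exact: is_derive_q.
(* Limit from the right of the positive values at later times; homogeneity then extends the sign
   from the sphere to all vectors. *)
have sph0 (u' v' : V) : dot u' u' + dot v' v' = 1 -> 0 <= q t u' v'.
  move=> uv'; apply: (@cvgr_to_ge _ (t^'+) _ _ (fun s => q s u' v') _ 0).
    by apply: cvg_at_right_filter; exact: qc.
  near=> s; apply/ltW/after => //; apply/andP; split; last first.
    by near: s; exact: nbhs_right_ltW.
  by near: s; exact: nbhs_right_gt.
have all0 (u' v' : V) : 0 <= gap (eps t) (P t) (Q t) u' v'.
  have [s0|s0] := eqVneq (dot u' u' + dot v' v') 0.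
    have [u0 v0] : u' = 0 /\ v' = 0.
      have := dot_ge0 u'; have := dot_ge0 v' => ? ?.
      by split; apply/eqP; rewrite -dot_eq0 eq_le dot_ge0 andbT; lra.
    by rewrite u0 v0 -(scale0r (0 : V)) gapZ expr0n mul0r.
  set r := Num.sqrt (dot u' u' + dot v' v').
  have r2 : r ^+ 2 = dot u' u' + dot v' v' by rewrite sqr_sqrtr// addr_ge0 ?dot_ge0.
  have r0 : r != 0 by rewrite -sqrf_eq0 r2.
  have := sph0 (r^-1 *: u') (r^-1 *: v'); rewrite !dotE -!mulrDr -r2.
  rewrite mulrA -expr2 exprVn mulVf ?sqrf_eq0// /q gapZ => /(_ erefl).
  by rewrite pmulr_rge0// exprn_even_gt0//= invr_eq0.
have q0 : gap (eps t) (P t) (Q t) u v = 0 by apply/eqP; rewrite eq_le all0 andbT.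
have := gap_slope_lt0 (Ds t) (Xs t) (eps_gt0 t) k0 (Dk t) (Bk t) (Btk t) (Xk t)
  all0 q0 uv.
apply/negP; rewrite -leNgt.
apply: (is_derive_right_ge0 lt1 (is_derive_q t u v)) => s ts.
by rewrite (le_trans quv)// ltW// after.
Unshelve. all: by end_near. Qed.

End RiccatiFlow.

(** * Directional derivatives *)

Section AlongCurves.
Context {R : realType} {V : normedModType R}.
Implicit Types (f : V -> R) (u v : V).

Lemma is_derive_curve f (x : R -> V) (t : R) v : differentiable f (x t) ->
  is_derive t 1 x v -> is_derive t 1 (fun s => f (x s)) ('D_v f (x t)).
Proof.
move=> df [/derivable1_diffP dx <-].
have dfx : differentiable (f \o x) t by exact: differentiable_comp.
apply: DeriveDef; first exact/derivable1_diffP.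
rewrite (deriveE _ dfx) (diff_comp dx df)/= (deriveE _ df).
by rewrite -(deriveE _ dx).
Qed.

Lemma is_derive_line y u (s : R) : is_derive s 1 (fun r : R => y + r *: u) u.
Proof.
have d1 : is_derive s 1 (fun r : R => r *: u) u.
  have d : differentiable (fun r : R => r *: u) s by exact: differentiableZl.
  apply: DeriveDef; first exact/derivable1_diffP.
  by rewrite deriveE// (diff_val (f := fun r : R => r *: u)) scale1r.
by apply: (is_derive_eq (is_deriveD (is_derive_cst y s 1) d1)); rewrite add0r.
Qed.

Lemma MVT_line f y u (h : R) : (forall z, differentiable f z) -> 0 < h ->
  exists2 s, 0 < s < h & f (y + h *: u) - f y = 'D_u f (y + s *: u) * h.
Proof.
move=> df h0.
have d (s : R) : is_derive s 1 (fun r : R => f (y + r *: u)) ('D_u f (y + s *: u)).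
  by apply: (is_derive_curve (df _)); exact: is_derive_line.
have [s] := MVT h0 (fun s _ => d s) (continuous_subspaceT
  (fun s => is_derive_continuous (d s))).
rewrite in_itv/= => s0h; rewrite scale0r addr0 subr0 => E.
by exists s.
Qed.

(** The mean value theorem twice: along u for the increment z -> f(z + h v) - f(z), then along v for
    the derivative of f in direction u. *)
Lemma mixed_difference f x u v (h : R) : (forall z, differentiable f z) ->
  (forall z, differentiable ('D_u f) z) -> 0 < h ->
  exists r s, [/\ 0 < r < h, 0 < s < h &
    f (x + h *: u + h *: v) - f (x + h *: u) - f (x + h *: v) + f x
    = 'D_v ('D_u f) (x + r *: u + s *: v) * h * h].
Proof.
move=> df du h0.
pose g z := f (z + h *: v) - f z.
have dfv z : differentiable (fun y => f (y + h *: v)) z.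
  have dt : differentiable ((id : V -> V) + cst (h *: v)) z.
    exact: ex_diff.
  exact: (differentiable_comp dt (df _)).
have Dfv z : 'D_u (fun y => f (y + h *: v)) z = 'D_u f (z + h *: v).
  rewrite /derive; do 2 f_equal; apply/funext => r /=.
  by rewrite addrA.
have dg z : differentiable g z := differentiableB (dfv z) (df z).
have [r r0h E1] := MVT_line x u dg h0.
have [s s0h E2] := MVT_line (x + r *: u) v du h0.
exists r, s; split => //; rewrite -E2.
have -> : 'D_u f (x + r *: u + h *: v) - 'D_u f (x + r *: u) = 'D_u g (x + r *: u).
  rewrite -Dfv -(@deriveB _ _ _ (fun y => f (y + h *: v)) f)//; exact: diff_derivable.
by rewrite -E1 /g; ring.
Qed.

Lemma dist_halves (x y z e : R) :
  `|z - x| < e / 2 -> `|z - y| < e / 2 -> `|x - y| <= e.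
Proof.
rewrite distrC => xz zy; rewrite -(subrKA z) (le_trans (ler_normD _ _))//.
by rewrite [leRHS]splitr lerD// ltW.
Qed.

(** The second difference is symmetric in u and v, so the two mixed derivatives agree at two points
    near x, and both are continuous at x. The step h = m / (|u| + |v| + 1) keeps these points within
    m of x, even for u = v = 0. *)
Lemma derive_comm f x u v : (forall z, differentiable f z) ->
  (forall w z, differentiable ('D_w f) z) ->
  (forall w w' z, differentiable ('D_w ('D_w' f)) z) ->
  'D_u ('D_v f) x = 'D_v ('D_u f) x.
Proof.
move=> df d1 d2.
have near_line w w' (F := 'D_w ('D_w' f)) (e : R) : 0 < e ->
    exists2 d : R, 0 < d & forall z, `|z - x| < d -> `|F z - F x| < e.
  move=> e0; have /cvgrPdist_lt/(_ _ e0) := differentiable_continuous (d2 w w' x).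
  move=> /nbhs_ballP[d d0 H]; exists d => // z zd.
  by rewrite distrC; apply: H; rewrite -ball_normE/= distrC.
apply/eqP; rewrite -subr_eq0 -normr_le0; apply/ler_addgt0Pl => e e0.
rewrite addr0.
have e2 : 0 < e / 2 by rewrite divr_gt0.
have [d d0 H] := near_line u v _ e2.
have [d' d'0 H'] := near_line v u _ e2.
pose m := Num.min d d'.
have md : m <= d by rewrite ge_min lexx.
have md' : m <= d' by rewrite ge_min lexx orbT.
have m0 : 0 < m by rewrite lt_min d0 d'0.
pose K := `|u| + `|v| + 1.
have K0 : 0 < K by rewrite ltr_wpDl// addr_ge0.
pose h := m / K.
have h0 : 0 < h by rewrite divr_gt0.
have small r s : 0 < r < h -> 0 < s < h -> `|x + r *: u + s *: v - x| < m.
  move=> /andP[r0 rh] /andP[s0 sh].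
  rewrite -[x + _ + _]addrA addrAC subrr add0r (le_lt_trans (ler_normD _ _))// !normrZ.
  rewrite (gtr0_norm r0) (gtr0_norm s0).
  have -> : m = h * `|u| + h * `|v| + h * 1.
    by rewrite -!mulrDr -[m in LHS](divfK (lt0r_neq0 K0)).
  apply: (@le_lt_trans _ _ (h * `|u| + h * `|v|)); last by rewrite mulr1 ltrDl.
  by apply: lerD; apply: ler_wpM2r => //; exact: ltW.
have [r [s [r0 s0 E]]] := @mixed_difference f x u v h df (d1 u) h0.
have [s' [r' [s'0 r'0 E']]] := @mixed_difference f x v u h df (d1 v) h0.
have : 'D_v ('D_u f) (x + r *: u + s *: v) = 'D_u ('D_v f) (x + s' *: v + r' *: u).
  apply: (mulIf (lt0r_neq0 h0)); apply: (mulIf (lt0r_neq0 h0)).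
  apply: (etrans (esym E)); apply: (etrans _ E').
  have <- : x + h *: u + h *: v = x + h *: v + h *: u by exact: addrAC.
  by congr (_ + _); exact: addrAC.
rewrite (addrAC x (s' *: v)) => F.
have Hd := H _ (lt_le_trans (small _ _ r'0 s'0) md).
have Hd' := H' _ (lt_le_trans (small _ _ r0 s0) md').
rewrite F in Hd'.
exact: dist_halves Hd Hd'.
Qed.

End AlongCurves.

Section Gradient.
Context {R : realType} {n : nat}.
Local Notation V := 'rV[R]_n.
Implicit Types (f : V -> R) (u v : V).

Definition grad f (x : V) : V := \row_i 'D_(evec i) f x.

Lemma derive_grad f x v : differentiable f x -> 'D_v f x = dot v (grad f x).
Proof.
move=> df; rewrite deriveE// {1}(row_sum_delta v) linear_sum.
by apply: eq_bigr => i _; rewrite linearZ /grad mxE deriveE.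
Qed.

Lemma grad_lipschitz f (k : R) : (forall z, differentiable f z) ->
  (forall z i, `|'D_(evec i) f z| <= k) ->
  forall x y, `|f x - f y| <= n%:R * k * enorm (x - y).
Proof.
move=> df fk x y.
have [s _] := MVT_line y (x - y) df ltr01.
rewrite scale1r subrKC mulr1 => ->; rewrite derive_grad// mulrC.
rewrite (le_trans (ler_norm_dot _ _))// ler_wpM2l ?enorm_ge0//.
by apply: enorm_le_const => i; rewrite mxE.
Qed.

Lemma enorm_le_norm u : enorm u <= n%:R * `|u|.
Proof.
apply: enorm_le_const => i.
rewrite /Num.Def.normr/= mx_normrE.
exact: (le_bigmax _ (fun ij : 'I_1 * 'I_n => `|u ij.1 ij.2|) (0, i)).
Qed.

End Gradient.

(** * The Hamiltonians c|p| and -c|p| *)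

Section HamiltonDerivatives.
Context {R : realType} {n : nat}.
Local Notation V := 'rV[R]_n.
Implicit Types (x p v : V) (pm : bool).

Definition sgn pm : R := if pm then 1 else -1.

Lemma norm_sgn pm : `|sgn pm| = 1.
Proof. by case: pm; rewrite /sgn ?normrN normr1. Qed.

Lemma is_derive_dir (f : V -> R) x v df :
  is_derive (0 : R) 1 (fun h : R => f (h *: v + x)) df -> is_derive x v f df.
Proof.
move=> [d <-]; apply: DeriveDef; first exact/derivable1P.
rewrite /derive; do 2 f_equal; apply/funext => h /=.
by rewrite addr0 scale0r add0r [_%:A]mulr1.
Qed.

Lemma is_derive_affine x v (t : R) : is_derive t 1 (fun h : R => h *: v + x) v.
Proof.
under [X in is_derive _ _ X _]eq_fun do rewrite addrC.
exact: is_derive_line.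
Qed.

Lemma is_derive_enorm_line p v : p != 0 ->
  is_derive (0 : R) 1 (fun h : R => enorm (h *: v + p)) (dot v p / enorm p).
Proof.
move=> p0; rewrite /enorm.
have d := is_derive_affine p v 0.
have dd := is_derive_dot d d.
have p1 : 0 < dot (0 *: v + p) (0 *: v + p).
  by rewrite scale0r add0r lt_def dot_eq0 p0 dot_ge0.
apply: (is_derive_eq (@is_derive1_comp _ Num.sqrt
  (fun h => dot (h *: v + p) (h *: v + p)) 0 _ _ (is_derive1_sqrt p1) dd)).
rewrite scale0r add0r (dotC p v); field.
by rewrite -/(enorm p) enorm_eq0.
Qed.

Lemma is_derive_enorm p v : p != 0 ->
  is_derive p v (@enorm R n) (dot v p / enorm p).
Proof. by move=> p0; apply/is_derive_dir/is_derive_enorm_line. Qed.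

Lemma is_derive_inv_enorm p v : p != 0 ->
  is_derive p v (fun q => (enorm q)^-1) (- (dot v p / enorm p ^+ 3)).
Proof.
move=> p0; apply: is_derive_dir.
have e0 : enorm p != 0 by rewrite enorm_eq0.
have e1 : enorm (0 *: v + p) != 0 by rewrite scale0r add0r.
apply: (is_derive_eq (@is_deriveV _ (fun h => enorm (h *: v + p)) _ _ _ e1
  (is_derive_enorm_line v p0))).
by rewrite scale0r add0r /GRing.scale/=; field.
Qed.

Lemma is_derive_rowcoord p v i : is_derive p v (fun q : V => q 0 i) (v 0 i).
Proof.
apply: (@is_derive_dir (fun q : V => q 0 i)).
exact: (is_derive_coord i (is_derive_affine p v 0)).
Qed.

Lemma near_neq0 p : p != 0 -> \forall q \near nbhs p, q != 0.
Proof.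
by move=> p0; apply: (@cvgr_neq0 _ _ _ _ _ (fun q : V => q) p _ p0); exact: cvg_id.
Qed.

Lemma dot_evec i v : dot (evec i) v = v 0 i.
Proof. by rewrite /evec dotC dot_mx trmx_delta -colE mxE. Qed.

Section Explicit.
Variables (c : V -> R) (pm : bool).
Hypotheses (dc : forall x, differentiable c x)
  (ddc : forall w x, differentiable ('D_w c) x).
Let H := Ham c pm.
Let s := sgn pm.

Lemma HamE x p : H x p = s * c x * enorm p. Proof. by []. Qed.

Lemma derive_Ham_p v x p : p != 0 -> 'D_v (H x) p = s * c x * (dot v p / enorm p).
Proof.
by move=> p0; have [_] := is_deriveZ (s * c x) (is_derive_enorm v p0).
Qed.

Lemma derive_Ham_x v x p : 'D_v (fun y => H y p) x = s * enorm p * 'D_v c x.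
Proof.
have -> : (fun y => H y p) = (s * enorm p) \*: c.
  by apply/funext => y; rewrite HamE [RHS]/(s * enorm p * c y) mulrAC.
by rewrite deriveZ//; exact: diff_derivable.
Qed.

Lemma gradp_Ham x p : p != 0 -> gradp H x p = (s * c x / enorm p) *: p.
Proof.
move=> p0; apply/rowP => i; rewrite !mxE derive_Ham_p// dot_evec; ring.
Qed.

Lemma gradx_Ham x p : gradx H x p = (s * enorm p) *: grad c x.
Proof. by apply/rowP => i; rewrite !mxE derive_Ham_x. Qed.

Lemma hessxx_Ham x p i l :
  hessxx H x p i l = s * enorm p * 'D_(evec i) ('D_(evec l) c) x.
Proof.
rewrite mxE.
have -> : (fun y => 'D_(evec l) (H^~ p) y) = (s * enorm p) \*: 'D_(evec l) c.
  by apply/funext => y; rewrite derive_Ham_x.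
by rewrite deriveZ//; exact: diff_derivable.
Qed.

Lemma hessxp_Ham x p i l : p != 0 ->
  hessxp H x p i l = s * 'D_(evec i) c x * (p 0 l / enorm p).
Proof.
move=> p0; rewrite mxE.
have -> : (fun y => 'D_(evec l) (H y) p) = (s * (p 0 l / enorm p)) \*: c.
  apply/funext => y; rewrite derive_Ham_p// dot_evec.
  by rewrite [RHS]/(s * (p 0 l / enorm p) * c y) mulrAC.
rewrite deriveZ; last exact: diff_derivable.
rewrite /GRing.scale/=; ring.
Qed.

Lemma hesspp_Ham x p i l : p != 0 ->
  hesspp H x p i l =
    s * c x * ((i == l)%:R / enorm p - p 0 i * p 0 l / enorm p ^+ 3).
Proof.
move=> p0; rewrite mxE.
(* The formula for the inner derivative holds for q != 0, so the two functions are compared only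
   near p. *)
have -> : 'D_(evec i) (fun q => 'D_(evec l) (H x) q) p =
    'D_(evec i) (s * c x \*: ((fun q : V => q 0 l) * (fun q => (enorm q)^-1))) p.
  apply: near_eq_derive; near=> q; rewrite derive_Ham_p ?dot_evec//.
  by near: q; exact: near_neq0.
have d := is_deriveZ (s * c x) (is_deriveM (is_derive_rowcoord p (evec i) l)
  (is_derive_inv_enorm (evec i) p0)).
have [_ ->] := d.
rewrite !dot_evec /evec mxE eqxx/= (eq_sym l) /GRing.scale/=; ring.
Unshelve. all: by end_near. Qed.

Lemma hessxx_Ham_sym x p :
  (forall w w' z, differentiable ('D_w ('D_w' c)) z) ->
  (hessxx H x p)^T = hessxx H x p.
Proof.
move=> d3; apply/matrixP => i l; rewrite mxE !hessxx_Ham.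
by rewrite (derive_comm x (evec l) (evec i) dc ddc d3).
Qed.

Lemma hesspp_Ham_sym x p : p != 0 -> (hesspp H x p)^T = hesspp H x p.
Proof.
move=> p0; apply/matrixP => i l; rewrite mxE !hesspp_Ham// (eq_sym i).
by rewrite (mulrC (p 0 i)).
Qed.

Variables (c1 r0 r1 : R).
Hypotheses (cc1 : forall x, `|c x| <= c1)
  (gc1 : forall x i, `|'D_(evec i) c x| <= c1)
  (hc1 : forall x i l, `|'D_(evec i) ('D_(evec l) c) x| <= c1).
Hypotheses (r00 : 0 < r0).

Lemma hessxx_Ham_le x p i l : enorm p <= r1 -> `|hessxx H x p i l| <= r1 * c1.
Proof.
move=> pr; rewrite hessxx_Ham !normrM norm_sgn mul1r ger0_norm ?enorm_ge0//.
by rewrite ler_pM ?enorm_ge0.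
Qed.

Lemma hessxp_Ham_le x p i l : p != 0 -> `|hessxp H x p i l| <= c1.
Proof.
move=> p0; rewrite hessxp_Ham// !normrM norm_sgn mul1r -[leRHS]mulr1.
rewrite ler_pM// normfV [`|enorm p|]ger0_norm ?enorm_ge0//.
by rewrite ler_pdivrMr ?enorm_gt0// mul1r enorm_coord.
Qed.

Lemma hesspp_Ham_le x p i l : r0 <= enorm p -> `|hesspp H x p i l| <= c1 * (2 / r0).
Proof.
move=> rp; have e0 : 0 < enorm p by exact: lt_le_trans rp.
have p0 : p != 0 by rewrite -enorm_gt0.
rewrite hesspp_Ham// !normrM norm_sgn mul1r ler_pM//.
apply: (@le_trans _ _ (2 / enorm p)); last by rewrite ler_pM2l// lef_pV2.
rewrite mulr2n mulrDl mul1r (le_trans (ler_normB _ _))// lerD//.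
  rewrite normrM normfV (gtr0_norm e0) ler_piMl ?invr_ge0 ?enorm_ge0//.
  by case: (i == l); rewrite ?normr1 ?normr0.
rewrite !normrM normfV (gtr0_norm (exprn_gt0 _ e0)) ler_pdivrMr ?exprn_gt0//.
rewrite exprS mulKf ?gt_eqF// expr2.
by rewrite ler_pM ?enorm_coord.
Qed.

Lemma ham_flow_ode (x p : R -> V) : ham_flow H x p -> forall t : R,
  [/\ p t != 0, is_derive t 1 x ((s * c (x t) / enorm (p t)) *: p t) &
   is_derive t 1 p (- ((s * enorm (p t)) *: grad c (x t)))].
Proof.
by move=> + t => /(_ t)[p0]; rewrite gradp_Ham// gradx_Ham.
Qed.

(** The square of the Hamiltonian is used to avoid differentiating a root. The change of c along x',
    parallel to p, cancels the change of |p|^2 along p', parallel to the gradient of c. *)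
Lemma ham_flow_conserved (x p : R -> V) : ham_flow H x p -> forall t t' : R,
  c (x t) ^+ 2 * dot (p t) (p t) = c (x t') ^+ 2 * dot (p t') (p t').
Proof.
move=> /ham_flow_ode hf t t'.
apply: (@is_derive_0_is_cst _ (fun t => c (x t) ^+ 2 * dot (p t) (p t))) => u.
have [p0 dx dp] := hf u.
have dcx := is_derive_curve (dc (x u)) dx.
apply: (is_derive_eq (is_deriveMf (is_deriveMf dcx dcx) (is_derive_dot dp dp))).
rewrite derive_grad// !dotE (dotC (grad _ _) (p u)) -enorm_sqr.
by field; rewrite enorm_eq0.
Qed.

End Explicit.
End HamiltonDerivatives.

(** * Symmetry along the Riccati flow *)

Section EntryBounds.
Context {R : realType} {n : nat}.
Implicit Types A B : 'M[R]_n.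

Lemma mxDE A B i l : (A + B) i l = A i l + B i l. Proof. by rewrite mxE. Qed.
Lemma mxNE A i l : (- A) i l = - A i l. Proof. by rewrite mxE. Qed.

Lemma mxTE A i l : A^T i l = A l i. Proof. by rewrite mxE. Qed.
Lemma trmxDE A B : (A + B)^T = A^T + B^T. Proof. exact: linearD. Qed.
Lemma trmxNE A : (- A)^T = - A^T. Proof. exact: linearN. Qed.

Definition entries_le A (k : R) := forall i l, `|A i l| <= k.

Lemma entries_leD A B a b : entries_le A a -> entries_le B b ->
  entries_le (A + B) (a + b).
Proof. by move=> Aa Bb i l; rewrite mxE (le_trans (ler_normD _ _))// lerD. Qed.

Lemma entries_leN A a : entries_le A a -> entries_le (- A) a.
Proof. by move=> Aa i l; rewrite mxE normrN. Qed.

Lemma entries_le_tr A a : entries_le A a -> entries_le A^T a.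
Proof. by move=> Aa i l; rewrite mxE. Qed.

Lemma entries_leM A B a b : entries_le A a -> entries_le B b ->
  entries_le (A *m B) (n%:R * (a * b)).
Proof.
move=> Aa Bb i l; rewrite mxE (le_trans (ler_norm_sum _ _ _))//.
rewrite mulr_natl -[n in leRHS]card_ord -sumr_const; apply: ler_sum => j _.
by rewrite normrM ler_pM.
Qed.

Lemma is_derive_entries_sqr (F dF : R -> 'M[R]_n) (t : R) :
  (forall i l, is_derive t 1 (fun s => F s i l) (dF t i l)) ->
  is_derive t 1 (fun s => \sum_i \sum_l F s i l * F s i l)
    (\sum_i \sum_l 2 * (F t i l * dF t i l)).
Proof.
move=> FdF.
apply: (@is_derive_sumf _ _ (fun i s => \sum_l F s i l * F s i l)
  _ (fun i => \sum_l 2 * (F t i l * dF t i l))) => i.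
apply: (@is_derive_sumf _ _ (fun l s => F s i l * F s i l)
  _ (fun l => 2 * (F t i l * dF t i l))) => l.
by apply: (is_derive_eq (is_deriveMf (FdF i l) (FdF i l))); ring.
Qed.

Lemma entries_le_sqrt A (f : R) : \sum_i \sum_l A i l * A i l <= f ->
  entries_le A (Num.sqrt f).
Proof.
move=> Af i l; rewrite -sqrtr_sqr ler_wsqrtr// expr2.
apply: le_trans Af; rewrite (bigD1 i)//= (bigD1 l)//= -addrA lerDl.
rewrite addr_ge0// sumr_ge0// => *; last rewrite sumr_ge0// => *;
  by rewrite -expr2 sqr_ge0.
Qed.

Lemma entries_slope A dA (f k : R) : 0 <= f -> entries_le A (Num.sqrt f) ->
  entries_le dA (k * Num.sqrt f) ->
  `|\sum_i \sum_l 2 * (A i l * dA i l)| <= 2 * n%:R ^+ 2 * k * f.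
Proof.
move=> f0 Af dAf.
have E (x : R) : n%:R * x = \sum_(i < n) x by rewrite sumr_const card_ord mulr_natl.
have -> : 2 * n%:R ^+ 2 * k * f = n%:R * (n%:R * (2 * (k * f))) by ring.
rewrite E (le_trans (ler_norm_sum _ _ _))//; apply: ler_sum => i _.
rewrite E (le_trans (ler_norm_sum _ _ _))//; apply: ler_sum => l _.
rewrite normrM ger0_norm// ler_pM2l// normrM.
rewrite -[f in leRHS]sqr_sqrtr// expr2 mulrCA.
by rewrite ler_pM.
Qed.

End EntryBounds.

Section RiccatiSymmetry.
Context {R : realType} {n : nat}.
Variables (P Q D B X : R -> 'M[R]_n).
Hypotheses
  (dP : forall (t : R) i l, is_derive t 1 (fun s => P s i l)
      (ricre (D t) (B t) (X t) (P t) (Q t) i l))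
  (dQ : forall (t : R) i l, is_derive t 1 (fun s => Q s i l)
      (ricim (B t) (X t) (P t) (Q t) i l))
  (Ds : forall t, (D t)^T = D t) (Xs : forall t, (X t)^T = X t).
Variables (t0 t1 k : R).
Hypotheses (Bk : forall t, entries_le (B t) k)
  (Xk : forall t, entries_le (X t) k)
  (Pk : forall t, t0 <= t <= t1 -> entries_le (P t) k)
  (Qk : forall t, t0 <= t <= t1 -> entries_le (Q t) k).

Let F t := P t - (P t)^T.
Let G t := Q t - (Q t)^T.
(** From M X M - M^T X M^T = (M - M^T) X M + M^T X (M - M^T): the defect F + i G of symmetry solves
    a homogeneous linear equation, of which [dF] and [dG] are the real and imaginary parts. *)
Let dF t := - (B t *m F t + F t *m (B t)^T
  + (F t *m (X t *m P t) + (P t)^T *m X t *m F t)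
  - (G t *m (X t *m Q t) + (Q t)^T *m X t *m G t)).
Let dG t := - (B t *m G t + G t *m (B t)^T
  + (F t *m (X t *m Q t) + (P t)^T *m X t *m G t)
  + (G t *m (X t *m P t) + (Q t)^T *m X t *m F t)).

Let ricreE t : ricre (D t) (B t) (X t) (P t) (Q t)
  - (ricre (D t) (B t) (X t) (P t) (Q t))^T = dF t.
Proof.
rewrite /ricre /dF /F /G !(trmxDE, trmxNE, trmx_mul, trmxK) Ds Xs.
rewrite !(mulmxDl, mulmxDr, mulmxN, mulNmx, mulmxA).
by apply/matrixP => i l; rewrite !(mxDE, mxNE); ring.
Qed.

Let ricimE t : ricim (B t) (X t) (P t) (Q t)
  - (ricim (B t) (X t) (P t) (Q t))^T = dG t.
Proof.
rewrite /ricim /dG /F /G !(trmxDE, trmxNE, trmx_mul, trmxK) Xs.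
rewrite !(mulmxDl, mulmxDr, mulmxN, mulNmx, mulmxA).
by apply/matrixP => i l; rewrite !(mxDE, mxNE); ring.
Qed.

Let is_deriveF (t : R) i l : is_derive t 1 (fun s => F s i l) (dF t i l).
Proof.
have := dP t; rewrite -ricreE; move: (ricre _ _ _ _ _) => dPt dP'.
rewrite mxDE mxNE mxTE.
rewrite (_ : (fun s => _) = (fun s => P s i l - P s l i)).
  exact: (is_deriveB (dP' i l) (dP' l i)).
by apply/funext => s; rewrite !mxE.
Qed.

Let is_deriveG (t : R) i l : is_derive t 1 (fun s => G s i l) (dG t i l).
Proof.
have := dQ t; rewrite -ricimE; move: (ricim _ _ _ _) => dQt dQ'.
rewrite mxDE mxNE mxTE.
rewrite (_ : (fun s => _) = (fun s => Q s i l - Q s l i)).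
  exact: (is_deriveB (dQ' i l) (dQ' l i)).
by apply/funext => s; rewrite !mxE.
Qed.

Let f t := \sum_i \sum_l F t i l * F t i l + \sum_i \sum_l G t i l * G t i l.

Let sqr_sum_ge0 (A : 'M[R]_n) : 0 <= \sum_i \sum_l A i l * A i l.
Proof.
by apply: sumr_ge0 => i _; apply: sumr_ge0 => l _; rewrite -expr2 sqr_ge0.
Qed.

(** Gronwall for the sum of the squared entries of the defect, which vanishes at t1. *)
Lemma riccati_symmetric : (P t1)^T = P t1 -> (Q t1)^T = Q t1 ->
  forall t, t0 <= t <= t1 -> (P t)^T = P t /\ (Q t)^T = Q t.
Proof.
move=> P1 Q1.
pose a (t : R) := Num.sqrt (f t).
have f0 t : 0 <= f t by rewrite addr_ge0.
have Fa t : entries_le (F t) (a t) by apply: entries_le_sqrt; rewrite lerDl.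
have Ga t : entries_le (G t) (a t) by apply: entries_le_sqrt; rewrite lerDr.
pose n1 : R := n%:R.
(* Two products of two matrices and four of three, each containing one factor F or G. *)
pose K : R := 2 * (n1 * k) + 4 * (n1 * (n1 * (k * k))).
have dFa t : t0 <= t <= t1 -> entries_le (dF t) (K * a t).
  move=> tt; have P' := Pk tt; have Q' := Qk tt.
  have XP := entries_leM (Xk t) P'; have XQ := entries_leM (Xk t) Q'.
  have PX := entries_leM (entries_le_tr P') (Xk t).
  have QX := entries_leM (entries_le_tr Q') (Xk t).
  have := entries_leN (entries_leD (entries_leD (entries_leD
    (entries_leM (Bk t) (Fa t)) (entries_leM (Fa t) (entries_le_tr (Bk t))))
    (entries_leD (entries_leM (Fa t) XP) (entries_leM PX (Fa t))))
    (entries_leN (entries_leD (entries_leM (Ga t) XQ) (entries_leM QX (Ga t))))).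
  move=> H i l; apply: (le_trans (H i l)).
  by rewrite /K -/n1 le_eqVlt; apply/orP; left; apply/eqP; ring.
have dGa t : t0 <= t <= t1 -> entries_le (dG t) (K * a t).
  move=> tt; have P' := Pk tt; have Q' := Qk tt.
  have XP := entries_leM (Xk t) P'; have XQ := entries_leM (Xk t) Q'.
  have PX := entries_leM (entries_le_tr P') (Xk t).
  have QX := entries_leM (entries_le_tr Q') (Xk t).
  have := entries_leN (entries_leD (entries_leD (entries_leD
    (entries_leM (Bk t) (Ga t)) (entries_leM (Ga t) (entries_le_tr (Bk t))))
    (entries_leD (entries_leM (Fa t) XQ) (entries_leM PX (Ga t))))
    (entries_leD (entries_leM (Ga t) XP) (entries_leM QX (Fa t)))).
  move=> H i l; apply: (le_trans (H i l)).
  by rewrite /K -/n1 le_eqVlt; apply/orP; left; apply/eqP; ring.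
pose df t := \sum_i \sum_l 2 * (F t i l * dF t i l)
  + \sum_i \sum_l 2 * (G t i l * dG t i l).
have fdf (t : R) : t0 <= t <= t1 -> is_derive t 1 f (df t).
  move=> _; exact: is_deriveD (is_derive_entries_sqr (is_deriveF t))
    (is_derive_entries_sqr (is_deriveG t)).
have dff t : t0 <= t <= t1 -> `|df t| <= 2 * (2 * n1 ^+ 2 * K) * f t.
  move=> tt; rewrite (le_trans (ler_normD _ _))//.
  rewrite [leRHS](_ : _ = 2 * n1 ^+ 2 * K * f t + 2 * n1 ^+ 2 * K * f t); last by ring.
  by rewrite lerD//; apply: entries_slope => //; [exact: dFa|exact: dGa].
move=> t tt; have t11 : t0 <= t1 <= t1.
  by rewrite lexx andbT; case/andP: tt; exact: le_trans.
have ft : f t <= 0.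
  have F1 : F t1 = 0 by rewrite /F P1 subrr.
  have G1 : G t1 = 0 by rewrite /G Q1 subrr.
  have f1 : f t1 = 0.
    by rewrite /f F1 G1 !big1 ?addr0// => i _; rewrite big1// => l _; rewrite mxE mul0r.
  by have := gronwall fdf dff t11 tt; rewrite f1 mulr0.
have a0 : a t = 0 by apply/eqP; rewrite sqrtr_eq0.
split; apply/esym/eqP; rewrite -subr_eq0; apply/eqP/matrixP => i l;
  apply/eqP; rewrite [X in _ == X]mxE -normr_le0 -a0; [exact: Fa|exact: Ga].
Qed.

End RiccatiSymmetry.

(** * Complex coefficients and the initial matrix *)

Section ComplexParts.
Context {R : realType}.
Local Notation C := R[i].
Local Notation Re := (@complex.Re R).
Local Notation Im := (@complex.Im R).
Implicit Types (z w : C) (r : R).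

Lemma ReD z w : Re (z + w) = Re z + Re w. Proof. by case: z; case: w. Qed.
Lemma ImD z w : Im (z + w) = Im z + Im w. Proof. by case: z; case: w. Qed.
Lemma ReN z : Re (- z) = - Re z. Proof. by case: z. Qed.
Lemma ImN z : Im (- z) = - Im z. Proof. by case: z. Qed.
Lemma ReM z w : Re (z * w) = Re z * Re w - Im z * Im w.
Proof. by case: z; case: w. Qed.
Lemma ImM z w : Im (z * w) = Re z * Im w + Im z * Re w.
Proof. by case: z; case: w. Qed.
Lemma Re_real r : Re r%:C = r. Proof. by []. Qed.
Lemma Im_real r : Im r%:C = 0. Proof. by []. Qed.
Lemma Re_sum I (s : seq I) (F : I -> C) :
  Re (\sum_(j <- s) F j) = \sum_(j <- s) Re (F j).
Proof. exact: (big_morph _ ReD (erefl _)). Qed.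
Lemma Im_sum I (s : seq I) (F : I -> C) :
  Im (\sum_(j <- s) F j) = \sum_(j <- s) Im (F j).
Proof. exact: (big_morph _ ImD (erefl _)). Qed.

Lemma normc_sqr z : Normc.normc z ^+ 2 = Re z ^+ 2 + Im z ^+ 2.
Proof. by case: z => a b; rewrite /Normc.normc sqr_sqrtr// addr_ge0 ?sqr_ge0. Qed.

Lemma normc_ge0 z : 0 <= Normc.normc z.
Proof. by case: z => a b; exact: sqrtr_ge0. Qed.

Lemma normc_real r : Normc.normc r%:C = `|r|.
Proof. by rewrite /Normc.normc/= expr0n addr0 sqrtr_sqr. Qed.

Section matrices.
Context {n : nat}.
Implicit Types (A B M : 'M[C]_n) (D X : 'M[R]_n).
Local Notation mxRe := (map_mx Re).
Local Notation mxIm := (map_mx Im).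
Local Notation mxC := (map_mx (real_complex R)).

Lemma mxReM A B : mxRe (A *m B) = mxRe A *m mxRe B - mxIm A *m mxIm B.
Proof.
apply/matrixP => i l; rewrite !mxE Re_sum -sumrB; apply: eq_bigr => j _.
by rewrite !mxE ReM.
Qed.

Lemma mxImM A B : mxIm (A *m B) = mxRe A *m mxIm B + mxIm A *m mxRe B.
Proof.
apply/matrixP => i l; rewrite !mxE Im_sum -big_split; apply: eq_bigr => j _.
by rewrite !mxE ImM.
Qed.

Lemma mxReD A B : mxRe (A + B) = mxRe A + mxRe B.
Proof. by apply/matrixP => i l; rewrite !mxE ReD. Qed.
Lemma mxImD A B : mxIm (A + B) = mxIm A + mxIm B.
Proof. by apply/matrixP => i l; rewrite !mxE ImD. Qed.
Lemma mxReN A : mxRe (- A) = - mxRe A.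
Proof. by apply/matrixP => i l; rewrite !mxE ReN. Qed.
Lemma mxImN A : mxIm (- A) = - mxIm A.
Proof. by apply/matrixP => i l; rewrite !mxE ImN. Qed.
Lemma mxReC D : mxRe (mxC D) = D.
Proof. by apply/matrixP => i l; rewrite !mxE. Qed.
Lemma mxImC D : mxIm (mxC D) = 0.
Proof. by apply/matrixP => i l; rewrite !mxE. Qed.

Lemma mxC_tr D : (mxC D)^T = mxC D^T.
Proof. by apply/matrixP => i l; rewrite !mxE. Qed.

Lemma mxRe_riccati D (B X : 'M[R]_n) M :
  mxRe (- (mxC D + mxC B *m M + M *m (mxC B)^T + M *m mxC X *m M))
  = ricre D B X (mxRe M) (mxIm M).
Proof.
rewrite mxC_tr !(mxReD, mxReN, mxReM, mxReC, mxImC, mxImM).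
rewrite !(mul0mx, mulmx0, subr0, addr0, add0r) /ricre; congr (- _).
by rewrite addrA.
Qed.

Lemma mxIm_riccati D (B X : 'M[R]_n) M :
  mxIm (- (mxC D + mxC B *m M + M *m (mxC B)^T + M *m mxC X *m M))
  = ricim B X (mxRe M) (mxIm M).
Proof.
rewrite mxC_tr !(mxImD, mxImN, mxReM, mxReC, mxImC, mxImM).
by rewrite !(mul0mx, mulmx0, subr0, addr0, add0r) /ricim; congr (- _); rewrite addrA.
Qed.

Lemma riccati_flow_parts (H : 'rV[R]_n -> 'rV[R]_n -> R) (x p : R -> 'rV[R]_n)
    (M : R -> 'M[C]_n) : riccati_flow H x p M -> forall (t : R) i l,
  is_derive t 1 (fun s => mxRe (M s) i l) (ricre (hessxx H (x t) (p t))
    (hessxp H (x t) (p t)) (hesspp H (x t) (p t)) (mxRe (M t)) (mxIm (M t)) i l) /\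
  is_derive t 1 (fun s => mxIm (M s) i l) (ricim
    (hessxp H (x t) (p t)) (hesspp H (x t) (p t)) (mxRe (M t)) (mxIm (M t)) i l).
Proof.
move=> ric t i l; have [] := ric t i l.
rewrite -(mxRe_riccati (hessxx H (x t) (p t))).
rewrite -(mxIm_riccati (hessxx H (x t) (p t))).
rewrite [map_mx Re _ i l]mxE [map_mx Im _ i l]mxE => dr di.
by split; [move: dr|move: di]; congr (is_derive _ _ _ _);
  apply/funext => s; rewrite mxE.
Qed.

Lemma trmx_parts M : (mxRe M)^T = mxRe M -> (mxIm M)^T = mxIm M -> M^T = M.
Proof.
move=> /matrixP Mr /matrixP Mi; apply/matrixP => i l; rewrite mxE.
have := Mr i l; have := Mi i l; rewrite !mxE.
by case: (M l i) (M i l) => [a b] [a' b'] /= -> ->.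
Qed.

Lemma cmxnorm_le m (N : 'M[C]_m.+1) (k : R) :
  entries_le (map_mx Re N) k -> entries_le (map_mx Im N) k ->
  cmxnorm N <= 2 * m.+1%:R * k.
Proof.
move=> Nr Ni; have k0 : 0 <= k by exact: le_trans (Nr 0 0).
have nk : 0 <= 2 * m.+1%:R * k by rewrite !mulr_ge0.
rewrite /cmxnorm -[leRHS]ger0_norm// -sqrtr_sqr ler_wsqrtr//.
have E (x : R) : m.+1%:R * x = \sum_(i < m.+1) x.
  by rewrite sumr_const card_ord mulr_natl.
have -> : (2 * m.+1%:R * k) ^+ 2 = m.+1%:R * (m.+1%:R * (4 * k ^+ 2)) by ring.
rewrite E; apply: ler_sum => i _; rewrite E; apply: ler_sum => l _.
have sq (x : R) : `|x| <= k -> x ^+ 2 <= k ^+ 2.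
  by move=> xk; rewrite -real_normK ?num_real// ler_pXn2r// nnegrE.
have := sq _ (Nr i l); have := sq _ (Ni i l); rewrite !mxE normc_sqr.
by have := sqr_ge0 k; lra.
Qed.

End matrices.

Section amplitude.
Variables (A kappa : R -> C) (k a b : R).
Hypotheses (dA : forall t, is_deriveC A t (- (A t * kappa t)))
  (kk : forall t, a <= t <= b -> `|Re (kappa t)| <= k).

(** From A' = - A kappa the derivative of |A|^2 is -2 Re(kappa) |A|^2; the imaginary part of kappa
    only turns the phase. *)
Lemma amplitude_gronwall s t : a <= s <= b -> a <= t <= b ->
  Normc.normc (A t) ^+ 2 <= expR (2 * k * `|t - s|) * Normc.normc (A s) ^+ 2.
Proof.
pose f s := Re (A s) * Re (A s) + Im (A s) * Im (A s).
have fE u : Normc.normc (A u) ^+ 2 = f u by rewrite normc_sqr /f !expr2.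
rewrite !fE.
apply: (@gronwall _ f (fun t => - 2 * Re (kappa t) * f t)).
  move=> u _; have [dr di] := dA u.
  apply: (is_derive_eq (is_deriveD (is_deriveMf dr dr) (is_deriveMf di di))).
  by rewrite ReN ImN ReM ImM /f; ring.
move=> u /kk uk; have f0 : 0 <= f u by rewrite -fE sqr_ge0.
rewrite !normrM normrN (ger0_norm f0) [`|2|]ger0_norm//.
by apply: ler_wpM2r => //; rewrite ler_pM2l.
Qed.

End amplitude.
End ComplexParts.

(** * Quantitative positivity of the matrix at the hitting time *)

Section InitialMatrix.
Context {R : realType} {m : nat}.
Local Notation V := 'rV[R]_m.+1.
Variables (P Q : 'M[R]_m.+1) (x' p' : V) (e rho K : R).
Hypotheses (e0 : 0 < e) (rho0 : 0 < rho) (x'rho : rho <= `|x' 0 0|)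
  (x'K : enorm x' <= K) (p'K : enorm p' <= K).
Hypotheses (Ps : P^T = P) (Qs : Q^T = Q)
  (P00 : forall k l, k != ord0 -> l != ord0 -> P k l = 0)
  (Q00 : forall k l, k != ord0 -> l != ord0 -> Q k l = if k == l then e else 0)
  (Px : forall k, k != ord0 -> (x' *m P) 0 k = p' 0 k)
  (Qx : forall k, k != ord0 -> (x' *m Q) 0 k = 0)
  (Pxx : dot (x' *m P) x' = dot p' x') (Qxx : dot (x' *m Q) x' = e).

Let x0 : x' 0 0 != 0.
Proof. by rewrite -normr_gt0; exact: lt_le_trans x'rho. Qed.

Let K0 : 0 <= K. Proof. exact: le_trans (enorm_ge0 _) x'K. Qed.

Let QxE : x' *m Q = (e / x' 0 0) *: evec ord0.
Proof.
have Q0 : (x' *m Q) 0 0 * x' 0 0 = e.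
  rewrite -Qxx /dot (bigD1 ord0)//= big1 ?addr0// => k k0.
  by rewrite Qx// mul0r.
apply/rowP => k; rewrite /evec rowZE [(delta_mx _ _) _ _]mxE eqxx/=.
have [->|k0] := eqVneq k ord0; last by rewrite Qx// mulr0.
by rewrite mulr1 -Q0 mulfK.
Qed.

Let PxE : x' *m P = p'.
Proof.
have P0 : (x' *m P) 0 0 * x' 0 0 = p' 0 0 * x' 0 0.
  have := Pxx; rewrite /dot (bigD1 ord0)//= [in RHS](bigD1 ord0)//=.
  rewrite (eq_bigr (fun k => p' 0 k * x' 0 k)); first by move/addIr.
  by move=> k k0; rewrite Px.
apply/rowP => k; have [->|k0] := eqVneq k ord0; last exact: Px.
exact: (mulIf x0 P0).
Qed.

(* Decompose v along x' and the hyperplane of vanishing first coordinate; the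
   two parts are Q-orthogonal because x' Q is a multiple of the first basis
   vector. *)
Lemma initial_im_ge (v : V) :
  e * dot v v <= 2 * (K ^+ 2 + 1) * dot (v *m Q) v.
Proof.
pose al := v 0 0 / x' 0 0; pose w := v - al *: x'.
have w0 : w 0 0 = 0 by rewrite !mxE divfK// subrr.
have vE : v = w + al *: x' by rewrite subrK.
clearbody w al.
have xw : dot (x' *m Q) w = 0 by rewrite QxE dotZl dot_evec w0 mulr0.
have ww : dot (w *m Q) w = e * dot w w.
  rewrite /dot mulr_sumr; apply: eq_bigr => l _.
  have [->|l0] := eqVneq l ord0; first by rewrite w0 !mulr0.
  rewrite mulrA; congr (_ * _); rewrite mxE (bigD1 l)//= big1 ?addr0.
    by rewrite Q00// eqxx mulrC.
  move=> k kl; have [->|k0] := eqVneq k ord0; first by rewrite w0 mul0r.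
  by rewrite Q00// (negbTE kl) mulr0.
have QvE : dot (v *m Q) v = e * dot w w + al ^+ 2 * e.
  rewrite vE mulmxDl -scalemxAl !dotE ww xw Qxx.
  by rewrite dot_mulmxl Qs dotC xw; ring.
have Kx : dot x' x' <= K ^+ 2 by rewrite -enorm_sqr ler_pXn2r ?nnegrE ?enorm_ge0.
(* The square of w - al x' gives |v|^2 <= 2 |w|^2 + 2 al^2 |x'|^2. *)
have vv : dot v v <= 2 * (K ^+ 2 + 1) * (dot w w + al ^+ 2).
  have := dot_ge0 (w - al *: x'); rewrite vE !dotE (dotC x' w).
  have := dot_ge0 w; have := mulr_ge0 (sqr_ge0 K) (dot_ge0 w).
  have := ler_wpM2l (sqr_ge0 al) Kx; have := sqr_ge0 al; nra.
by rewrite QvE; have := ler_wpM2l (ltW e0) vv; lra.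
Qed.

(** Column k of x' S = y determines S_0k from the rest of that column, after division by x'_0, which
    is at least rho in modulus. This is used for k != 0 with the given block, then with symmetry for
    S_00; hence the nested constant. *)
Let entries_bound (S : 'M[R]_m.+1) (y : V) (f g : R) : S^T = S ->
  x' *m S = y -> 0 <= f -> (forall k l, k != ord0 -> l != ord0 -> `|S k l| <= f) ->
  (forall k, `|y 0 k| <= g) ->
  entries_le S (f + (g + m.+1%:R * (K * f)) / rho
    + (g + m.+1%:R * (K * ((g + m.+1%:R * (K * f)) / rho))) / rho).
Proof.
move=> Ss xS f0 Sf yg; have g0 : 0 <= g by exact: le_trans (yg 0).
set n := m.+1%:R; have n0 : 0 <= n :> R by [].
have col k b : 0 <= b -> (forall l, l != ord0 -> `|S l k| <= b) ->
    `|S 0 k| <= (g + n * (K * b)) / rho.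
  move=> b0 Sb; rewrite ler_pdivlMr//.
  apply: (@le_trans _ _ (`|S 0 k| * `|x' 0 0|)); first by rewrite ler_wpM2l.
  rewrite -normrM.
  have -> : S 0 k * x' 0 0 = y 0 k - \sum_(l | l != ord0) x' 0 l * S l k.
    by rewrite -xS mxE (bigD1 ord0)//= addrK mulrC.
  apply: (le_trans (ler_normB _ _)); apply: lerD; first exact: yg.
  apply: (le_trans (ler_norm_sum _ _ _)).
  rewrite /n mulr_natl -[m.+1 in leRHS]card_ord -sumr_const big_mkcond.
  apply: ler_sum => l _; case: ifP => [l0|_]; last by rewrite mulr_ge0.
  by rewrite normrM ler_pM ?Sb// (le_trans (enorm_coord _ _)).
set h := (g + n * (K * f)) / rho.
have r0 := ltW rho0.
have h0 : 0 <= h by rewrite !(divr_ge0, addr_ge0, mulr_ge0).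
have h'0 : 0 <= (g + n * (K * h)) / rho.
  by rewrite !(divr_ge0, addr_ge0, mulr_ge0).
have Sh k : k != ord0 -> `|S 0 k| <= h.
  by move=> k0; apply: col => // l l0; exact: Sf.
have Ssym i l : S i l = S l i by rewrite -{1}Ss mxE.
move=> i l; have [->|i0] := eqVneq i ord0; last first.
  have [->|l0] := eqVneq l ord0; last by have := Sf _ _ i0 l0; lra.
  by rewrite Ssym; have := Sh _ i0; lra.
have [->|l0] := eqVneq l ord0; last by have := Sh _ l0; lra.
suff : `|S 0 0| <= (g + n * (K * h)) / rho by lra.
by apply: col => // l' l'0; rewrite Ssym; exact: Sh.
Qed.

(** The constant of [entries_bound] for P (zero block, right-hand side p') plus the one for Q (block
    e I, right-hand side of size e / rho). *)
Definition initial_bound (e rho K : R) : R :=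
  (K / rho + (K + m.+1%:R * (K * (K / rho))) / rho) +
  (e + (e / rho + m.+1%:R * (K * e)) / rho +
    (e / rho + m.+1%:R * (K * ((e / rho + m.+1%:R * (K * e)) / rho))) / rho).

Lemma initial_entries_le : entries_le P (initial_bound e rho K) /\
  entries_le Q (initial_bound e rho K).
Proof.
have BP := @entries_bound P p' 0 K Ps PxE (lexx _) _ _.
have BQ := @entries_bound Q _ e (e / rho) Qs QxE (ltW e0) _ _.
have {}BP : entries_le P (K / rho + (K + m.+1%:R * (K * (K / rho))) / rho).
  move=> i l; have := BP _ _ i l; rewrite !mulr0 addr0 add0r; apply.
    by move=> k' l' k0 l0; rewrite P00 ?normr0.
  by move=> k; rewrite (le_trans (enorm_coord _ _)).
have {}BQ : entries_le Q (e + (e / rho + m.+1%:R * (K * e)) / rho +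
    (e / rho + m.+1%:R * (K * ((e / rho + m.+1%:R * (K * e)) / rho))) / rho).
  apply: BQ => [k l k0 l0|k].
    by rewrite Q00//; case: (k == l); [rewrite gtr0_norm|rewrite normr0 ltW].
  rewrite rowZE normrM normrM normfV (gtr0_norm e0) -[leRHS]mulr1.
  apply: ler_pM => //; first by rewrite divr_ge0 ?(ltW e0).
    by rewrite ler_pM2l// lef_pV2// posrE// normr_gt0.
  by rewrite mxE; case: (_ && _); rewrite ?normr0 ?normr1.
have r0 := ltW rho0; have e00 := ltW e0; have n0 : 0 <= m.+1%:R :> R by [].
split=> i l; rewrite /initial_bound.
  by rewrite (le_trans (BP i l))// lerDl !(addr_ge0, mulr_ge0, invr_ge0).
by rewrite (le_trans (BQ i l))// lerDr !(addr_ge0, mulr_ge0, invr_ge0).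
Qed.

(** On unit vectors [imform] is at least e / (2 (K^2 + 1)) and [graphnorm] at most 1 + 8 L^2, with L
    the operator bound of P and Q. Half of the quotient is taken, for a strict inequality. *)
Definition initial_gap (e rho K : R) : R :=
  e / (4 * (K ^+ 2 + 1) * (1 + 8 * (m.+1%:R * (m.+1%:R * initial_bound e rho K)) ^+ 2)).

Lemma initial_gap_gt0 : 0 < initial_gap e rho K.
Proof.
rewrite divr_gt0// mulr_gt0//; first by have := sqr_ge0 K; lra.
by have := sqr_ge0 (m.+1%:R * (m.+1%:R * initial_bound e rho K)); lra.
Qed.

Lemma initial_gap_ge (u v : V) : dot u u + dot v v = 1 ->
  0 < gap (initial_gap e rho K) P Q u v.
Proof.
move=> uv; rewrite /gap subr_gt0.
have [BP BQ] := initial_entries_le.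
set L := m.+1%:R * (m.+1%:R * initial_bound e rho K).
have PL y : enorm (y *m P) <= L * enorm y := enorm_mulmx y BP.
have QL y : enorm (y *m Q) <= L * enorm y := enorm_mulmx y BQ.
have L0 : 0 <= L by rewrite mulr_ge0// mulr_ge0// (le_trans _ (BP 0 0)).
have KQ : e <= 2 * (K ^+ 2 + 1) * imform P Q u v.
  (* Symmetry of P removes the cross terms between u and v. *)
  have -> : imform P Q u v = dot (u *m Q) u + dot (v *m Q) v.
    rewrite /imform /mxre /mxim !dotE (dotC u (v *m P)) dot_mulmxl Ps.
    by rewrite (dotC u (u *m Q)) (dotC v (v *m Q)); ring.
  have eE : e * dot u u + e * dot v v = e by rewrite -mulrDr uv mulr1.
  by have := initial_im_ge u; have := initial_im_ge v; lra.
have un : enorm u <= 1 by apply: enorm_le => //; rewrite expr1n -uv lerDl dot_ge0.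
have vn : enorm v <= 1 by apply: enorm_le => //; rewrite expr1n -uv lerDr dot_ge0.
have bd (y : V) : enorm y <= 1 -> forall S : 'M[R]_m.+1,
    (forall y, enorm (y *m S) <= L * enorm y) -> enorm (y *m S) <= L.
  by move=> y1 S SL; rewrite (le_trans (SL y))// ler_piMr.
have sq (y : V) : enorm y <= L + L -> dot y y <= 4 * L ^+ 2.
  move=> yL; rewrite -enorm_sqr.
  have -> : 4 * L ^+ 2 = (L + L) ^+ 2 by ring.
  by rewrite ler_pXn2r ?nnegrE ?enorm_ge0 ?addr_ge0.
have re2 := sq _ (le_trans (enormB _ _) (lerD (bd _ un _ PL) (bd _ vn _ QL))).
have im2 := sq _ (le_trans (enormD _ _) (lerD (bd _ un _ QL) (bd _ vn _ PL))).
have G : graphnorm P Q u v <= 1 + 8 * L ^+ 2.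
  by rewrite /graphnorm uv -/(mxre P Q u v) -/(mxim P Q u v) in re2 im2 *; lra.
have L1 : 0 < 1 + 8 * L ^+ 2 by have := sqr_ge0 L; lra.
have K1 : 0 < K ^+ 2 + 1 by have := sqr_ge0 K; lra.
apply: (@le_lt_trans _ _ (initial_gap e rho K * (1 + 8 * L ^+ 2))).
  by rewrite ler_wpM2l// ltW// initial_gap_gt0.
have -> : initial_gap e rho K * (1 + 8 * L ^+ 2) = e / (4 * (K ^+ 2 + 1)).
  by rewrite /initial_gap -/L; field; rewrite !gt_eqF.
rewrite ltr_pdivrMr; last by rewrite mulr_gt0.
by have := e0; lra.
Qed.

End InitialMatrix.

(** * Pairs of trajectories *)

Section VelocityBounds.
Context {R : realType} {n : nat}.
Local Notation V := 'rV[R]_n.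

Definition velocity_le (c : V -> R) (c0 C : R) :=
  [/\ 0 < c0, forall x, c0 <= c x, forall x, c x <= C,
      forall x i, `|'D_(evec i) c x| <= C &
      forall x i l, `|'D_(evec i) ('D_(evec l) c) x| <= C].

Lemma velocity_bounds (c : V -> R) : velocity c ->
  exists c0, exists C, velocity_le c c0 C.
Proof.
case=> _ bnd i0; have /choice[K KP] : forall alpha : seq 'I_n, exists K : R,
    forall x, `|Dseq [seq evec i | i <- alpha] c x| <= K by exact: bnd.
exists (inf (range c)), (`|K [::]| + \sum_i `|K [:: i]|
  + \sum_i \sum_l `|K [:: i; l]|).
(* [inf] takes the value 0 on a set without infimum, so a positive [inf] forces a lower bound. *)
have hl : has_lbound (range c).
  by apply: contrapT => nl; move: i0; rewrite inf_out ?ltxx// => -[].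
have s1 : 0 <= \sum_i `|K [:: i]| by exact: sumr_ge0.
have s2 : 0 <= \sum_i \sum_l `|K [:: i; l]|.
  by apply: sumr_ge0 => i _; exact: sumr_ge0.
split=> //.
- by move=> x; apply: ge_inf => //; exists x.
- move=> x; have := KP [::] x; have := ler_norm (K [::]); have := ler_norm (c x).
  by rewrite /=; lra.
- move=> x i; have := KP [:: i] x; have := ler_norm (K [:: i]).
  have : `|K [:: i]| <= \sum_i `|K [:: i]| by rewrite (bigD1 i)//= lerDl sumr_ge0.
  by have := normr_ge0 (K [::]); rewrite /=; lra.
- move=> x i l; have := KP [:: i; l] x; have := ler_norm (K [:: i; l]).
  have : `|K [:: i; l]| <= \sum_i \sum_l `|K [:: i; l]|.
    rewrite (bigD1 i)//= (bigD1 l)//= -addrA lerDl addr_ge0 ?sumr_ge0// => *.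
    exact: sumr_ge0.
  by have := normr_ge0 (K [::]); rewrite /=; lra.
Qed.

Lemma ler_dist_enorm (u v : V) : `|enorm u - enorm v| <= enorm (u - v).
Proof. by rewrite ler_norml ler_enormB andbT lerNl opprB enorm_distC ler_enormB. Qed.

(** The rescaled difference of directions is u - v plus (|v| - |u|) v / |v|, and both have length at
    most |u - v|. *)
Lemma unit_dist (u v : V) : u != 0 -> v != 0 ->
  enorm u * enorm ((enorm u)^-1 *: u - (enorm v)^-1 *: v) <= 2 * enorm (u - v).
Proof.
move=> u0 v0; have u1 : enorm u != 0 by rewrite enorm_eq0.
have v1 : enorm v != 0 by rewrite enorm_eq0.
rewrite -{1}[enorm u]ger0_norm ?enorm_ge0// -enormZ.
have -> : enorm u *: ((enorm u)^-1 *: u - (enorm v)^-1 *: v)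
    = (u - v) + ((enorm v - enorm u) / enorm v) *: v.
  rewrite scalerBr !scalerA divff// scale1r mulrBl divff// scalerBl scale1r.
  by rewrite addrA subrK.
rewrite (le_trans (enormD _ _))// enormZ normrM normfV.
rewrite [`|enorm v|]ger0_norm ?enorm_ge0// divfK// mulr2n mulrDl mul1r lerD2l.
by rewrite [leRHS]enorm_distC ler_dist_enorm.
Qed.

Lemma curve_dist (x v : R -> V) (k s t : R) :
  (forall u : R, is_derive u 1 x (v u)) -> (forall u i, `|v u 0 i| <= k) ->
  enorm (x t - x s) <= n%:R * (k * `|t - s|).
Proof.
move=> dx vk; apply: enorm_le_const => i; rewrite !mxE.
have d (u : R) : is_derive u 1 (fun r => x r 0 i) (v u 0 i).
  exact: is_derive_coord (dx u).
wlog st : s t / s <= t => [H|].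
  by have [/H//|/ltW/H] := leP s t; rewrite distrC [`|s - t|]distrC.
have [u _ ->] := MVT_segment st (fun u _ => d u)
  (continuous_subspaceT (fun u => is_derive_continuous (d u))).
by rewrite normrM ler_wpM2r.
Qed.

End VelocityBounds.

Section FlowPair.
Context {R : realType} {n : nat}.
Local Notation V := 'rV[R]_n.
Variables (c : V -> R) (c0 C r0 r1 : R) (pm : bool).
Hypotheses (dc : forall z, differentiable c z)
  (ddc : forall (w : V) z, differentiable ('D_w c) z)
  (cb : velocity_le c c0 C) (r00 : 0 < r0).
Local Notation nn := (n%:R : R).
Let s : R := sgn pm.

Definition is_flow (x p : R -> V) := ham_flow (Ham c pm) x p /\
  forall t, r0 <= enorm (p t) <= r1.

Let C0 : 0 <= C.
Proof. by have [+ c0c cC _ _] := cb; have := c0c 0; have := cC 0; lra. Qed.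

Let normc_le x : `|c x| <= C.
Proof. by have [? c0c cC _ _] := cb; rewrite ger0_norm// (le_trans _ (c0c x))// ltW. Qed.

Lemma grad_le x : enorm (grad c x) <= nn * C.
Proof.
by apply: enorm_le_const => i; rewrite mxE; case: cb => _ _ _ + _; apply.
Qed.

Lemma velocity_lip x y : `|c x - c y| <= nn * C * enorm (x - y).
Proof. by apply: grad_lipschitz => //; case: cb. Qed.

Lemma grad_lip x y : enorm (grad c x - grad c y) <= nn * (nn * C * enorm (x - y)).
Proof.
apply: enorm_le_const => i; rewrite !mxE.
apply: (@grad_lipschitz _ _ ('D_(evec i) c) C); first exact: ddc.
by move=> z l; case: cb => _ _ _ _; apply.
Qed.

Lemma is_flow_neq0 x p : is_flow x p -> forall t, p t != 0.
Proof.
by move=> [_ pr] t; rewrite -enorm_gt0; have /andP[+ _] := pr t; exact: lt_le_trans.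
Qed.

Lemma flow_speed x p : is_flow x p -> forall t t',
  enorm (x t - x t') <= nn * (C * `|t - t'|).
Proof.
move=> [hf pr] t t'; have p0 := is_flow_neq0 (conj hf pr).
apply: (@curve_dist _ _ x (fun t => (s * c (x t) / enorm (p t)) *: p t)).
  by move=> u; have [] := ham_flow_ode dc hf u.
move=> u i; rewrite mxE -!mulrA !normrM norm_sgn mul1r -[leRHS]mulr1.
rewrite ler_pM// mulrC normfV [`|enorm _|]ger0_norm ?enorm_ge0//.
by rewrite ler_pdivrMr ?enorm_gt0// mul1r enorm_coord.
Qed.

Lemma flow_force x p : is_flow x p -> forall t t',
  enorm (p t - p t') <= nn * (r1 * C * `|t - t'|).
Proof.
move=> [hf pr] t t'.
apply: (@curve_dist _ _ p (fun t => - ((s * enorm (p t)) *: grad c (x t)))).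
  by move=> u; have [] := ham_flow_ode dc hf u.
move=> u i; rewrite !mxE normrN !normrM norm_sgn mul1r ger0_norm ?enorm_ge0//.
by have /andP[_ pr1] := pr u; rewrite ler_pM ?enorm_ge0//; case: cb.
Qed.

Variables (x p y q : R -> V) (W W' : R).
Hypotheses (xp : is_flow x p) (yq : is_flow y q) (W'0 : 0 < W') (WW : W' <= W).

(** The phase-space distance of (x, W p) and (y, W' q), with the product of the frequencies replaced
    by the square of the larger weight W. *)
Definition pair_dist (t : R) : R :=
  W ^+ 2 * dot (x t - y t) (x t - y t)
  + dot (W *: p t - W' *: q t) (W *: p t - W' *: q t).

(** The first term comes from the Lipschitz constant of c and the size of its gradient; the others
    are the mixed terms, from the direction p / |p| and from the Lipschitz constant of the gradient,
    through 2 a b <= a^2 + b^2. *)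
Definition pair_rate : R := 2 * (nn * C) + 2 * C / r0 + r1 * nn ^+ 2 * C.

(* The rate does not depend on the weights: the Hamiltonian is homogeneous of
   degree one in p, so W p and W' q solve the same equations as p and q, and
   only |W p| >= r0 W and |W' q| <= r1 W enter. *)
Lemma pair_gronwall t t' :
  pair_dist t' <= expR (pair_rate * `|t' - t|) * pair_dist t.
Proof.
have W0 : 0 < W by exact: lt_le_trans WW.
pose vx (z r : R -> V) t := (s * c (z t) / enorm (r t)) *: r t.
pose vp (z r : R -> V) t := - ((s * enorm (r t)) *: grad c (z t)).
pose dx t := vx x p t - vx y q t.
pose dP t := W *: vp x p t - W' *: vp y q t.
pose df t := W ^+ 2 * (2 * dot (x t - y t) (dx t))
  + 2 * dot (W *: p t - W' *: q t) (dP t).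
have fdf (u : R) : is_derive u 1 pair_dist (df u).
  have [_ d1 d2] := ham_flow_ode dc xp.1 u; have [_ d3 d4] := ham_flow_ode dc yq.1 u.
  have dX := is_deriveB d1 d3.
  have dQ := is_deriveB (is_deriveZ W d2) (is_deriveZ W' d4).
  apply: (is_derive_eq (is_deriveD (is_deriveZ (W ^+ 2) (is_derive_dot dX dX))
    (is_derive_dot dQ dQ))).
  rewrite /df /dx /dP /vx /vp /s /GRing.scale/=.
  by rewrite (dotC (_ - _) (x u - y u)) (dotC (_ - _) (W *: p u - W' *: q u)); ring.
pose mn := Num.min t t'; pose mx := Num.max t t'.
apply: (@gronwall _ pair_dist df pair_rate mn mx).
- move=> u _.
  set a := W * enorm (x u - y u); set b := enorm (W *: p u - W' *: q u).
  have fE : pair_dist u = a ^+ 2 + b ^+ 2 by rewrite exprMn !enorm_sqr.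
  have a0 : 0 <= a by rewrite mulr_ge0 ?enorm_ge0// ltW.
  have b0 : 0 <= b by exact: enorm_ge0.
  have p0 := is_flow_neq0 xp u; have q0 := is_flow_neq0 yq u.
  have /andP[pr0 pr1] := xp.2 u; have /andP[qr0 qr1] := yq.2 u.
  have Wr : 0 < W * r0 by rewrite mulr_gt0.
  (* Directions ignore the positive weights, so [unit_dist] applies to W p and W' q, and |W p| >= W
     r0 is divided out. *)
  have e12 : W * enorm ((enorm (p u))^-1 *: p u - (enorm (q u))^-1 *: q u)
      <= 2 / r0 * b.
    have := @unit_dist _ _ (W *: p u) (W' *: q u).
    rewrite !scaler_eq0 !gt_eqF//= => /(_ p0 q0).
    have wK (w z : R) : 0 < w -> (w * z)^-1 * w = z^-1.
      by move=> w0; rewrite invfM mulrAC mulVf ?mul1r// gt_eqF.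
    rewrite !enormZ (gtr0_norm W0) (gtr0_norm W'0) !scalerA !wK// -/b => H.
    rewrite mulrAC ler_pdivlMr//; apply: le_trans H.
    by rewrite mulrAC ler_wpM2r ?enorm_ge0// ler_pM2l.
  have dxle : W * enorm (dx u) <= nn * C * a + C * (2 / r0 * b).
    have -> : dx u = s *: ((c (x u) - c (y u)) *: ((enorm (p u))^-1 *: p u)
        + c (y u) *: ((enorm (p u))^-1 *: p u - (enorm (q u))^-1 *: q u)).
      rewrite /dx /vx; apply/rowP => i; rewrite !(rowDE, rowNE, rowZE); ring.
    rewrite enormZ norm_sgn mul1r.
    apply: (@le_trans _ _ (W * (nn * C * enorm (x u - y u)
      + C * enorm ((enorm (p u))^-1 *: p u - (enorm (q u))^-1 *: q u)))).
      rewrite ler_wpM2l ?(ltW W0)// (le_trans (enormD _ _))// lerD//.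
        rewrite !enormZ normfV [`|enorm (p u)|]ger0_norm ?enorm_ge0//.
        by rewrite mulVf ?enorm_eq0// mulr1 velocity_lip.
      by rewrite enormZ ler_wpM2r ?enorm_ge0.
    rewrite mulrDr lerD//; first by rewrite /a mulrCA.
    by rewrite mulrCA ler_wpM2l.
  have dPle : enorm (dP u) <= nn * C * b + r1 * nn ^+ 2 * C * a.
    have -> : dP u = (- s) *: ((W * enorm (p u) - W' * enorm (q u)) *: grad c (x u)
        + (W' * enorm (q u)) *: (grad c (x u) - grad c (y u))).
      rewrite /dP /vp; apply/rowP => i; rewrite !(rowDE, rowNE, rowZE); ring.
    rewrite enormZ normrN norm_sgn mul1r (le_trans (enormD _ _))// lerD//.
      rewrite enormZ mulrC ler_pM ?enorm_ge0 ?grad_le//.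
      have -> : W * enorm (p u) = enorm (W *: p u) by rewrite enormZ gtr0_norm.
      have -> : W' * enorm (q u) = enorm (W' *: q u) by rewrite enormZ gtr0_norm.
      exact: ler_dist_enorm.
    rewrite enormZ ger0_norm ?mulr_ge0 ?enorm_ge0 ?(ltW W'0)//.
    apply: (@le_trans _ _ (W * r1 * (nn * (nn * C * enorm (x u - y u))))).
      by rewrite ler_pM ?grad_lip ?enorm_ge0 ?mulr_ge0 ?enorm_ge0 ?(ltW W'0)//
        ler_pM ?enorm_ge0 ?(ltW W'0).
    by rewrite le_eqVlt; apply/orP; left; apply/eqP; rewrite /a; ring.
  have D1 : `|W ^+ 2 * (2 * dot (x u - y u) (dx u))|
      <= 2 * (a * (nn * C * a + C * (2 / r0 * b))).
    rewrite (normrM (W ^+ 2)) (normrM 2) [`|2|]ger0_norm//.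
    rewrite [`|W ^+ 2|]ger0_norm ?sqr_ge0// mulrCA.
    rewrite ler_pM2l// (@le_trans _ _ (a * (W * enorm (dx u))))//.
      rewrite /a mulrACA -expr2 ler_wpM2l ?sqr_ge0//; exact: ler_norm_dot.
    by rewrite ler_wpM2l.
  have D2 : `|2 * dot (W *: p u - W' *: q u) (dP u)|
      <= 2 * (b * (nn * C * b + r1 * nn ^+ 2 * C * a)).
    rewrite normrM [`|2|]ger0_norm// ler_pM2l//.
    by rewrite (le_trans (ler_norm_dot _ _))// ler_wpM2l.
  rewrite (_ : C * (2 / r0 * b) = 2 * C / r0 * b) in D1; last by ring.
  rewrite (le_trans (ler_normD _ _))// (le_trans (lerD D1 D2))// fE.
  have r10 : 0 <= r1 by rewrite (le_trans _ pr1) ?enorm_ge0.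
  have ab := sqr_ge0 (a - b).
  have K1 : 0 <= 2 * C / r0 by rewrite !mulr_ge0// invr_ge0 ltW.
  have K2 : 0 <= r1 * nn ^+ 2 * C by rewrite !mulr_ge0// sqr_ge0.
  have := mulr_ge0 K1 ab; have := mulr_ge0 K2 ab; rewrite /pair_rate.
  move: (2 * C / r0) (r1 * nn ^+ 2 * C) (nn * C) K1 K2 => k1 k2 k3 _ _ H1 H2.
  by lra.
- by rewrite /mn /mx ge_min le_max lexx.
- by rewrite /mn /mx ge_min le_max lexx !orbT.
Qed.

End FlowPair.

(** * Beams hitting the boundary *)

Section OneBeam.
Context {R : realType} {m : nat}.
Local Notation V := 'rV[R]_m.+1.
Local Notation C := R[i].

Lemma dot_tail (u : V) : dot u u = u 0 ord0 ^+ 2 + dot (tail u) (tail u).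
Proof.
rewrite /dot (bigD1 ord0)//= [X in _ = _ + X](bigD1 ord0)//= !mxE eqxx mul0r add0r.
by congr (_ + _); apply: eq_bigr => i /negbTE i0; rewrite !mxE i0.
Qed.

Lemma enorm_tail (u : V) : enorm (tail u) <= enorm u.
Proof.
by apply: enorm_le; rewrite ?enorm_ge0// enorm_sqr (dot_tail u) lerDr sqr_ge0.
Qed.

Lemma tailB (u v : V) : tail (u - v) = tail u - tail v.
Proof. by apply/rowP => i; rewrite !mxE; case: ifP; rewrite ?subrr. Qed.

Lemma tailZ (k : R) (u : V) : tail (k *: u) = k *: tail u.
Proof. by apply/rowP => i; rewrite !mxE; case: ifP; rewrite ?mulr0. Qed.

Lemma enorm_le_tail (u : V) : enorm u <= `|u 0 ord0| + enorm (tail u).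
Proof.
apply: enorm_le; first by rewrite addr_ge0 ?enorm_ge0.
rewrite dot_tail sqrrD enorm_sqr real_normK ?num_real// lerD2r lerDl.
by rewrite mulrn_wge0// mulr_ge0 ?enorm_ge0.
Qed.

Lemma cutoff_support_bounded (c : V -> R) L U kappa (a : V -> C) b :
  cutoff c L U kappa a b -> exists2 K : R, 0 < K & forall y, a y != 0 -> enorm y <= K.
Proof.
case=> _ /compact_bounded/ex_strict_bound_gt0[k k0 ak] _ _ _.
exists (m.+1%:R * k) => [|y ay]; first by rewrite mulr_gt0.
apply: (le_trans (enorm_le_norm y)); rewrite ler_pM2l// ltW// ak//.
exact: subset_closure.
Qed.

Variables (c : V -> R) (c0 cC L U kappa : R) (a : V -> C) (b : V -> V -> C).
Variables (N : nat -> nat) (xi : nat -> nat -> V) (Lam : set V) (h : V -> C).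
Hypotheses (dc : forall z, differentiable c z)
  (cb : velocity_le c c0 cC) (hxi : frame_points N xi) (kappa0 : 0 < kappa)
  (hab : cutoff c L U kappa a b).
Variables (pm : bool) (g : @frame_index R m.+1) (x p : R -> V)
  (M : R -> 'M[C]_m.+1) (A : R -> C).
Hypotheses (Gg : Gamma_h_pm xi N Lam (fun y zeta => a y * b y zeta) h pm g)
  (bp : back_propagated xi c pm g x p M A).
Local Notation tg := (t_hit g).
Local Notation xt := (xi_tilde xi g).
Local Notation s := (sgn pm : R).

Let w : R := 4 ^+ lev g.
Let w0 : 0 < w. Proof. exact: exprn_gt0. Qed.

Let c00 : 0 < c0. Proof. by case: cb. Qed.
Let c0c z : c0 <= c z. Proof. by case: cb. Qed.
Let c_gt0 z : 0 < c z. Proof. exact: lt_le_trans (c0c z). Qed.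

(** The frequency point is the centre of a ball contained in the corona. *)
Lemma beam_xi_st : w <= enorm (xi_st xi g) <= 4 * w.
Proof.
have [[[j1 k1 _] _] _] := Gg; have [_ + _] := hxi j1.
move=> /(_ _ k1 (xi_st xi g)); rewrite /eball/= subrr.
have e0 : enorm (0 : V) < 2 ^+ lev g.
  by rewrite (_ : enorm _ = 0) ?exprn_gt0//; apply/eqP; rewrite enorm_eq0.
by move=> /(_ e0)[]; rewrite /eball/= !subr0 exprS => /ltW -> /negP; rewrite -leNgt => ->.
Qed.

Lemma beam_neq0 : a (a_st g) != 0 /\ b (a_st g) (xi_st xi g) != 0.
Proof.
have [[_ + _]] := Gg; rewrite /bv_coef_cut => /eqP.
by rewrite !mulf_eq0 !negb_or => /andP[/andP[]].
Qed.

Lemma beam_time : L <= tg <= U.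
Proof. by case: hab => _ _ + _ _; apply; exact/subset_closure/beam_neq0.1. Qed.

Lemma xi_tildeE : xi_st xi g = (w / (2 * pi)) *: xt.
Proof.
rewrite /xi_tilde scalerA (_ : _ * _ = 1) ?scale1r//.
have pi0 : 0 < 2 * pi :> R by rewrite mulr_gt0// pi_gt0.
by rewrite -/w mulrA divfK ?mulfV// gt_eqF.
Qed.

Let xt_norm : 2 * pi <= enorm xt <= 8 * pi.
Proof.
have := beam_xi_st; rewrite xi_tildeE enormZ.
have q0 : 0 < w / (2 * pi) by rewrite divr_gt0// mulr_gt0// pi_gt0.
rewrite gtr0_norm// mulrAC ler_pdivlMr ?ler_pdivrMr ?mulr_gt0 ?pi_gt0//.
by rewrite ler_pM2l// (mulrC 4) -mulrA ler_pM2l// mulrA -natrM.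
Qed.

Let X := `|xt 0 ord0| / c (tail (a_st g)).

(** Since g is in [Gamma_h], b does not vanish at it, and |[xi_st]| >= 4^j >= 1; the vanishing
    condition must therefore fail. That condition is homogeneous, so it passes to [xi_tilde]. *)
Let X_gt : kappa * enorm xt < X - enorm (tail xt).
Proof.
rewrite ltNge; apply/negP => Hle; have [_ /negP] := beam_neq0; apply; apply/eqP.
case: hab => _ _ _ _; apply.
  have /andP[+ _] := beam_xi_st; apply: le_trans.
  by rewrite exprn_ege1// ler1n.
have : 0 < w / (2 * pi) by rewrite divr_gt0// mulr_gt0// pi_gt0.
rewrite xi_tildeE; move: (w / (2 * pi)) => r r0.
rewrite tailZ !(enormZ r) rowZE normrM.
by rewrite gtr0_norm// -(mulrA r) -mulrBr mulrCA ler_pM2l.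
Qed.

Let xt0 : 0 < enorm xt.
Proof. by have /andP[+ _] := xt_norm; apply: lt_le_trans; rewrite mulr_gt0// pi_gt0. Qed.

Let D := xt 0 ord0 ^+ 2 / c (tail (a_st g)) ^+ 2 - enorm (tail xt) ^+ 2.

(** D is a difference of squares with both factors at least kappa |xt|. In particular the square
    root in the initial momentum is a genuine one, not the default 0 of a negative argument. *)
Let D_ge : (kappa * enorm xt) ^+ 2 <= D.
Proof.
have -> : D = (X - enorm (tail xt)) * (X + enorm (tail xt)).
  rewrite /D /X -subr_sqr; congr (_ - _).
  by rewrite expr_div_n real_normK ?num_real.
have k0 : 0 < kappa * enorm xt by rewrite mulr_gt0.
rewrite expr2 ler_pM ?(ltW k0) ?(ltW X_gt)//.
by have := X_gt; have := enorm_ge0 (tail xt); lra.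
Qed.

Let xt1_neq0 : xt 0 ord0 != 0.
Proof.
apply: contraTneq X_gt => E; rewrite /X E normr0 mul0r sub0r -leNgt.
by rewrite (@le_trans _ _ 0) ?oppr_le0 ?enorm_ge0 ?mulr_ge0 ?enorm_ge0// ltW.
Qed.

Let p_first : p tg 0 ord0 ^+ 2 = D.
Proof.
have [_ _ _ [_ [_ ->] _ _ _]] := bp.
rewrite exprMn sqrrN sqr_sg xt1_neq0 mul1r sqr_sqrtr//.
by rewrite (le_trans _ D_ge)// sqr_ge0.
Qed.

Let x_hit : x tg = tail (a_st g). Proof. by have [_ _ _ []] := bp. Qed.

Let p_hit : enorm (p tg) = X.
Proof.
have [_ _ _ [_ [ptail _] _ _ _]] := bp.
have X0 : 0 <= X by rewrite divr_ge0// ltW.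
apply/eqP; rewrite -(@eqrXn2 _ 2) ?enorm_ge0// enorm_sqr dot_tail p_first ptail.
by rewrite -enorm_sqr /D subrK /X expr_div_n real_normK ?num_real.
Qed.

(** The initial momentum is chosen so that c|p| = |xt_1| at the hitting time; conservation carries
    this to all t, and the sign of xt_1 is fixed by the splitting into the two families. The
    boundary frequency can thus be read off at time 0. *)
Lemma beam_speed_xi t : xt 0 ord0 = - s * (c (x t) * enorm (p t)).
Proof.
have [hf _ _ _] := bp.
have E : c (x t) * enorm (p t) = `|xt 0 ord0|.
  have -> : `|xt 0 ord0| = c (x tg) * enorm (p tg).
    by rewrite p_hit x_hit /X mulrC divfK// gt_eqF.
  apply/eqP; rewrite -(@eqrXn2 _ 2) ?mulr_ge0 ?enorm_ge0 ?(ltW (c_gt0 _))//.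
  by rewrite !exprMn !enorm_sqr (ham_flow_conserved dc hf t tg).
rewrite E; have [_] := Gg; rewrite /sgn; case: (pm) => xts.
  by rewrite ltr0_norm// mulN1r opprK.
by rewrite opprK mul1r gtr0_norm.
Qed.

(** At the hitting time |p| = X > kappa |xt| >= 2 pi kappa and |xt| <= 8 pi; conservation of c|p|
    spreads both bounds to all times, at the price of c0 and cC. *)
Definition p_min : R := c0 * (2 * pi * kappa) / cC.
Definition p_max : R := 8 * pi / c0.

Let cC0 : 0 < cC.
Proof. by have [_ _ cCle _ _] := cb; exact: lt_le_trans (cCle 0). Qed.

Lemma p_min_gt0 : 0 < p_min.
Proof. by rewrite divr_gt0// mulr_gt0// mulr_gt0// mulr_gt0// pi_gt0. Qed.

Lemma beam_is_flow : is_flow c p_min p_max pm x p.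
Proof.
have [hf _ _ _] := bp; split=> // t.
have E : c (x t) * enorm (p t) = `|xt 0 ord0|.
  rewrite (beam_speed_xi t) !normrM normrN norm_sgn mul1r.
  by rewrite !ger0_norm ?enorm_ge0// ltW.
have cXt : `|xt 0 ord0| = c (tail (a_st g)) * X by rewrite /X mulrC divfK// gt_eqF.
have /andP[xt2 xt8] := xt_norm; have [_ _ cCle _ _] := cb.
apply/andP; split.
  rewrite /p_min ler_pdivrMr//.
  apply: (@le_trans _ _ (c (x t) * enorm (p t))); last first.
    by rewrite mulrC ler_wpM2l ?enorm_ge0.
  rewrite E cXt ler_pM ?(ltW c00)//.
    by rewrite !mulr_ge0 ?pi_ge0// ltW.
  have := X_gt; have := enorm_ge0 (tail xt).
  have := ler_wpM2r (ltW kappa0) xt2; lra.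
rewrite /p_max ler_pdivlMr// mulrC.
apply: (@le_trans _ _ (c (x t) * enorm (p t))); first by rewrite ler_wpM2r ?enorm_ge0.
by rewrite E (le_trans (enorm_coord _ _)).
Qed.

(** |p_1| is the square root of D, hence at least kappa |xt| >= kappa |xt_1| = kappa c |p|. *)
Lemma beam_transversal : kappa * c0 * enorm (p tg) <= `|p tg 0 ord0|.
Proof.
have : kappa * enorm xt <= `|p tg 0 ord0|.
  rewrite -(@ler_pXn2r _ 2) ?nnegrE ?mulr_ge0 ?(ltW kappa0) ?(ltW xt0)//.
  by rewrite [leRHS]real_normK ?num_real// p_first.
apply: le_trans; rewrite -mulrA ler_wpM2l ?(ltW kappa0)//.
rewrite (le_trans _ (enorm_coord xt ord0))// p_hit.
apply: (@le_trans _ _ (c (tail (a_st g)) * X)).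
  by rewrite ler_wpM2r// divr_ge0// ltW.
by rewrite /X mulrC divfK// gt_eqF.
Qed.

End OneBeam.

(** * Separation of two beams in phase space *)

Section BeamPair.
Context {R : realType} {m : nat}.
Local Notation V := 'rV[R]_m.+1.
Variables (c : V -> R) (c0 C r0 r1 T Ka mu : R) (pm : bool).
Hypotheses (dc : forall z, differentiable c z)
  (ddc : forall (w : V) z, differentiable ('D_w c) z)
  (cb : velocity_le c c0 C) (r00 : 0 < r0) (T0 : 0 < T) (mu0 : 0 < mu).
Local Notation nn := (m.+1%:R : R).
Local Notation pi2 := (2 * pi : R).

(* The beam (x, p), with frequency W, crosses {x_1 = 0} at the time and place
   encoded by z, with zeta the covector of the boundary value. *)
Record beam_hit (W : R) (x p : R -> V) (z zeta : V) : Prop := BeamHit {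
  hit_flow : is_flow c r0 r1 pm x p;
  hit_freq : 0 < W;
  hit_time : 0 <= z 0 ord0 <= T;
  hit_bound : enorm z <= Ka;
  hit_place : x (z 0 ord0) = tail z;
  hit_tail : tail zeta = (W / pi2) *: tail (p (z 0 ord0));
  hit_first : zeta 0 ord0 = - sgn pm * (W / pi2 * (c (x 0) * enorm (p 0)));
  hit_norm : enorm zeta <= 4 * W;
  hit_cone : forall t, 0 <= t <= T -> mu * `|t - z 0 ord0| <= `|x t 0 ord0| }.

Let C0 : 0 < C.
Proof. by have [+ c0c cC _ _] := cb; have := c0c 0; have := cC 0; lra. Qed.

Let pi20 : 0 < pi2. Proof. by rewrite mulr_gt0// pi_gt0. Qed.

Let pi2V : pi2^-1 <= 1.
Proof. by rewrite invf_le1//; have := @pi_ge2 R; lra. Qed.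

Section pair.
Variables (W W' : R) (x p y q : R -> V) (z zeta z' zeta' : V).
Hypotheses (hz : beam_hit W x p z zeta) (hz' : beam_hit W' y q z' zeta')
  (WW : W' <= W).
Let W0 : 0 < W. Proof. by case: hz. Qed.
Let W'0 : 0 < W'. Proof. by case: hz'. Qed.
Let F0 := pair_dist x p y q W W' 0.
Let E := expR (pair_rate (n := m.+1) C r0 r1 * T).
Let S := Num.sqrt (E * F0).

Let r10 : 0 < r1.
Proof.
have [_ /(_ 0)/andP[rp pr]] := hit_flow hz.
exact: lt_le_trans r00 (le_trans rp pr).
Qed.

Let rate0 : 0 <= pair_rate (n := m.+1) C r0 r1.
Proof.
have C1 := ltW C0; have r1' := ltW r10; have r0' := ltW r00.
by rewrite /pair_rate !(addr_ge0, mulr_ge0, invr_ge0, exprn_ge0).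
Qed.

Let F00 t : 0 <= pair_dist x p y q W W' t.
Proof. by apply: addr_ge0; [apply: mulr_ge0; [exact: sqr_ge0|]|]; exact: dot_ge0. Qed.

Let E0 : 0 < E. Proof. exact: expR_gt0. Qed.

Let EF0 : 0 <= E * F0. Proof. by apply: mulr_ge0; [exact: ltW|exact: F00]. Qed.

Let pair_le t : 0 <= t <= T -> pair_dist x p y q W W' t <= S ^+ 2.
Proof.
move=> /andP[t0 tT]; rewrite (sqr_sqrtr EF0).
apply: (le_trans (pair_gronwall dc ddc cb r00 (hit_flow hz) (hit_flow hz')
  W'0 WW 0 t)).
by apply: ler_wpM2r; [exact: F00|rewrite ler_expR subr0 ger0_norm// ler_wpM2l].
Qed.

Let S0 : 0 <= S. Proof. exact: sqrtr_ge0. Qed.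

Let space_le t : 0 <= t <= T -> W * enorm (x t - y t) <= S.
Proof.
move=> /pair_le H; rewrite -(@ler_pXn2r _ 2) ?nnegrE ?mulr_ge0 ?enorm_ge0 ?(ltW W0)//.
by apply: le_trans H; rewrite exprMn enorm_sqr lerDl dot_ge0.
Qed.

Let freq_le t : 0 <= t <= T -> enorm (W *: p t - W' *: q t) <= S.
Proof.
move=> /pair_le H; rewrite -(@ler_pXn2r _ 2) ?nnegrE ?enorm_ge0//.
by apply: le_trans H; rewrite enorm_sqr lerDr; apply: mulr_ge0;
  [exact: sqr_ge0|exact: dot_ge0].
Qed.

Let tau := z 0 ord0.
Let tau' := z' 0 ord0.

Let time_le : W * `|tau - tau'| <= S / mu.
Proof.
rewrite ler_pdivlMr// -mulrA (mulrC _ mu).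
have H := hit_cone hz' (hit_time hz).
apply: le_trans (space_le (hit_time hz)); rewrite ler_pM2l//.
apply: (le_trans H).
have -> : y (z 0 ord0) 0 ord0 = - ((x (z 0 ord0) - y (z 0 ord0)) 0 ord0).
  by rewrite rowDE rowNE (hit_place hz) mxE eqxx sub0r opprK.
by rewrite normrN enorm_coord.
Qed.

Let kA := (1 + nn * C) / mu + 1.
Let kX := 1 + nn * (r1 * C) / mu + (nn * C * r1 + C).

Let place_le : W * enorm (z - z') <= kA * S.
Proof.
have D1 : enorm (z - z') <= `|tau - tau'| + (enorm (x tau - y tau)
    + nn * (C * `|tau - tau'|)).
  apply: (le_trans (enorm_le_tail _)); rewrite rowDE rowNE lerD2l tailB.
  rewrite -(hit_place hz) -(hit_place hz') -/tau -/tau'.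
  rewrite (le_trans (enorm_distD (y tau) _ _))// lerD2l.
  exact: (flow_speed dc cb r00 (hit_flow hz') tau tau').
apply: (le_trans (ler_wpM2l (ltW W0) D1)).
have := space_le (hit_time hz); rewrite -/tau.
have nC : 0 <= 1 + nn * C by rewrite addr_ge0// mulr_ge0// ltW.
have := ler_wpM2l nC time_le.
have -> : kA * S = (1 + nn * C) * (S / mu) + S by rewrite /kA; ring.
lra.
Qed.

(** The tangential part is compared at the hitting time of the first beam, plus the drift of q up to
    its own hitting time; the first component is compared at time 0. The factor 1 / (2 pi) is simply
    bounded by 1. *)
Let covector_le : enorm (zeta - zeta') <= kX * S.
Proof.
have i0 : 0 <= pi2^-1 by rewrite invr_ge0 ltW.
have D1 : enorm (tail (zeta - zeta')) <= S + nn * (r1 * C) / mu * S.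
  have -> : tail (zeta - zeta') = pi2^-1 *: tail ((W *: p tau - W' *: q tau)
      + W' *: (q tau - q tau')).
    rewrite tailB (hit_tail hz) (hit_tail hz') -/tau -/tau' !(mulrC _ pi2^-1).
    rewrite scalerBr addrA subrK tailB !tailZ scalerBr !scalerA.
    by [].
  rewrite enormZ ger0_norm//.
  apply: (@le_trans _ _ (1 * (S + nn * (r1 * C) / mu * S))); last by rewrite mul1r.
  rewrite ler_pM ?enorm_ge0// (le_trans (enorm_tail _))//.
  rewrite (le_trans (enormD _ _))// lerD ?freq_le ?(hit_time hz)//.
  rewrite enormZ (gtr0_norm W'0).
  apply: (@le_trans _ _ (W * (nn * (r1 * C * `|tau - tau'|)))).
    apply: ler_pM; [exact: ltW|exact: enorm_ge0|exact: WW|].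
    exact: (flow_force dc cb (hit_flow hz') tau tau').
  have -> : W * (nn * (r1 * C * `|tau - tau'|)) = nn * (r1 * C) * (W * `|tau - tau'|).
    by ring.
  have -> : nn * (r1 * C) / mu * S = nn * (r1 * C) * (S / mu) by ring.
  by rewrite ler_wpM2l// mulr_ge0// mulr_ge0 ?(ltW C0) ?(ltW r10).
have TT : 0 <= (0 : R) <= T by rewrite lexx ltW.
have D2 : `|(zeta - zeta') 0 ord0| <= (nn * C * r1 + C) * S.
  rewrite rowDE rowNE (hit_first hz) (hit_first hz').
  have -> : - sgn pm * (W / pi2 * (c (x 0) * enorm (p 0))) -
      - sgn pm * (W' / pi2 * (c (y 0) * enorm (q 0)))
    = - sgn pm * (pi2^-1 * ((c (x 0) - c (y 0)) * (W' * enorm (q 0))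
      + c (x 0) * (W * enorm (p 0) - W' * enorm (q 0)))) by ring.
  rewrite !normrM normrN norm_sgn mul1r [`|pi2^-1|]ger0_norm//.
  apply: (@le_trans _ _ (1 * ((nn * C * r1 + C) * S))); last by rewrite mul1r.
  apply: ler_pM => //; rewrite [leRHS]mulrDl.
  apply: (le_trans (ler_normD _ _)); apply: lerD.
    rewrite normrM [`|W' * _|]ger0_norm ?mulr_ge0 ?enorm_ge0 ?(ltW W'0)//.
    apply: (@le_trans _ _ (nn * C * enorm (x 0 - y 0) * (W * r1))).
      have [_ /(_ 0)/andP[_ qr]] := hit_flow hz'.
      apply: ler_pM => //; first by rewrite mulr_ge0 ?enorm_ge0 ?(ltW W'0).
        exact: (velocity_lip dc cb).
      by apply: ler_pM; rewrite ?enorm_ge0 ?(ltW W'0).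
    have -> : nn * C * enorm (x 0 - y 0) * (W * r1)
      = nn * C * r1 * (W * enorm (x 0 - y 0)) by ring.
    by rewrite ler_wpM2l ?space_le// !mulr_ge0 ?(ltW C0) ?(ltW r10).
  rewrite normrM; apply: ler_pM => //.
    have [c00 c0c cC _ _] := cb.
    by rewrite ger0_norm// (le_trans _ (c0c _))// ltW.
  have -> : W * enorm (p 0) = enorm (W *: p 0) by rewrite enormZ gtr0_norm.
  have -> : W' * enorm (q 0) = enorm (W' *: q 0) by rewrite enormZ gtr0_norm.
  exact: le_trans (ler_dist_enorm _ _) (freq_le TT).
apply: (le_trans (enorm_le_tail _)); rewrite /kX; lra.
Qed.

Let phase_dist_st : phase_dist z zeta z' zeta' <= (16 * kA ^+ 2 + kX ^+ 2) * (E * F0).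
Proof.
have kA0 : 0 <= kA.
  by rewrite addr_ge0// divr_ge0 ?(ltW mu0)// addr_ge0// mulr_ge0// ltW.
have kX0 : 0 <= kX.
  have := ltW C0; have := ltW r10; have := ltW mu0 => ? ? ?.
  by rewrite !(addr_ge0, mulr_ge0, invr_ge0).
have -> : E * F0 = S ^+ 2 by rewrite (sqr_sqrtr EF0).
rewrite mulrDl /phase_dist lerD//; last first.
  by rewrite -exprMn ler_pXn2r ?nnegrE ?enorm_ge0 ?mulr_ge0.
apply: (@le_trans _ _ (4 * W * (4 * W) * enorm (z - z') ^+ 2)).
  rewrite ler_wpM2r ?sqr_ge0// ler_pM ?enorm_ge0 ?(hit_norm hz)//.
  by rewrite (le_trans (hit_norm hz'))// ler_pM2l.
have -> : 4 * W * (4 * W) * enorm (z - z') ^+ 2 = 16 * (W * enorm (z - z')) ^+ 2 by ring.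
rewrite -mulrA -exprMn ler_pM2l// ler_pXn2r ?nnegrE ?mulr_ge0 ?enorm_ge0//.
exact: ltW.
Qed.

(** Threshold between the two regimes: if W' < rho W then |W' q| <= W r0 / 2, at most half of |W p|.
    B bounds the distance of any two starting points. *)
Let rho := r0 / (2 * r1).
Let B := 2 * (Ka + nn * (C * T)).
Let kB := 1 + (rho * r0 ^+ 2)^-1 + 4 * B ^+ 2 / r0 ^+ 2.

Let start_le W1 x1 p1 z1 zeta1 : beam_hit W1 x1 p1 z1 zeta1 ->
  enorm (x1 0) <= Ka + nn * (C * T).
Proof.
move=> hz1; have := enorm_distD (x1 (z1 0 ord0)) (x1 0) 0.
rewrite !subr0 => /le_trans; apply; rewrite addrC lerD//.
  by rewrite (hit_place hz1) (le_trans (enorm_tail _))// (hit_bound hz1).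
rewrite (le_trans (flow_speed dc cb r00 (hit_flow hz1) _ _))//.
have /andP[t0 tT] := hit_time hz1.
by rewrite ler_pM2l ?ltr0n// ler_pM2l// sub0r normrN ger0_norm.
Qed.

(* If W' is much smaller than W the frequencies alone separate the two beams. *)
Let start_dist_le : F0 <= kB * (W * enorm (p 0) * (W' * enorm (q 0))
  * enorm (x 0 - y 0) ^+ 2 + enorm (W *: p 0 - W' *: q 0) ^+ 2).
Proof.
have [_ /(_ 0)/andP[pr0 pr1]] := hit_flow hz.
have [_ /(_ 0)/andP[qr0 qr1]] := hit_flow hz'.
have rho0 : 0 < rho by rewrite divr_gt0// mulr_gt0.
rewrite /F0 /pair_dist -!enorm_sqr.
set d := enorm (x 0 - y 0); set f := enorm (W *: p 0 - W' *: q 0).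
set e := W * enorm (p 0) * (W' * enorm (q 0)).
have e0 : 0 <= e * d ^+ 2.
  by rewrite !mulr_ge0 ?enorm_ge0 ?sqr_ge0 ?ltW.
have f0 : 0 <= f ^+ 2 by exact: sqr_ge0.
have k1 : 0 <= (rho * r0 ^+ 2)^-1 by rewrite invr_ge0 mulr_ge0 ?sqr_ge0 ?ltW.
have k2 : 0 <= 4 * B ^+ 2 / r0 ^+ 2.
  by apply: divr_ge0; [apply: mulr_ge0|]; rewrite ?sqr_ge0.
suff : W ^+ 2 * d ^+ 2 <= (rho * r0 ^+ 2)^-1 * (e * d ^+ 2)
    \/ W ^+ 2 * d ^+ 2 <= 4 * B ^+ 2 / r0 ^+ 2 * f ^+ 2.
  have := mulr_ge0 k1 e0; have := mulr_ge0 k2 e0.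
  have := mulr_ge0 k1 f0; have := mulr_ge0 k2 f0.
  by rewrite /kB; move=> ? ? ? ? [] ?; lra.
have [WrW|WrW] := leP (rho * W) W'; [left|right].
  rewrite (mulrA _ e); apply: ler_wpM2r; first exact: sqr_ge0.
  rewrite ler_pdivlMl; last by rewrite mulr_gt0// exprn_gt0.
  rewrite /e (_ : rho * r0 ^+ 2 * W ^+ 2 = W * r0 * (rho * W * r0)); last by ring.
  have r0' := ltW r00; have W0' := ltW W0; have W'0' := ltW W'0; have rho' := ltW rho0.
  have rW : 0 <= rho * W by exact: mulr_ge0.
  apply: ler_pM; [exact: mulr_ge0|exact: mulr_ge0|exact: ler_pM|exact: ler_pM].
have fW : W * r0 / 2 <= f.
  have := ler_enormB (W *: p 0) (W' *: q 0); rewrite -/f !enormZ !gtr0_norm//.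
  have H1 : W * r0 <= W * enorm (p 0) by rewrite ler_pM2l.
  have H2 : W' * enorm (q 0) <= rho * W * r1.
    by rewrite ler_pM ?enorm_ge0 ?(ltW W'0) ?(ltW WrW).
  have H3 : rho * W * r1 = W * r0 / 2.
    by rewrite /rho; field; rewrite gt_eqF.
  lra.
have dB : d <= B.
  rewrite (le_trans (enormB _ _))// /B mulr2n mulrDl mul1r.
  by rewrite lerD// ?(start_le hz) ?(start_le hz').
have Wf : W <= 2 / r0 * f.
  by rewrite mulrAC ler_pdivlMr//; lra.
have -> : 4 * B ^+ 2 / r0 ^+ 2 * f ^+ 2 = (2 / r0 * f) ^+ 2 * B ^+ 2.
  by field; rewrite gt_eqF.
have sq (u v : R) : 0 <= u -> u <= v -> u ^+ 2 <= v ^+ 2.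
  by move=> u0 uv; rewrite ler_pXn2r// nnegrE (le_trans u0).
apply: ler_pM; [exact: sqr_ge0|exact: sqr_ge0|by apply: sq => //; exact: ltW|].
by apply: sq => //; exact: enorm_ge0.
Qed.

Definition pair_bound : R := (16 * kA ^+ 2 + kX ^+ 2) * E * kB * pi2 ^+ 2.

Lemma phase_dist_back : phase_dist z zeta z' zeta' <=
  pair_bound * phase_dist (x 0) ((W / pi2) *: p 0) (y 0) ((W' / pi2) *: q 0).
Proof.
apply: (le_trans phase_dist_st).
have K1 : 0 <= (16 * kA ^+ 2 + kX ^+ 2) * E.
  apply: mulr_ge0; [apply: addr_ge0; [apply: mulr_ge0 => //|]|exact: ltW];
    exact: sqr_ge0.
have i0 : 0 < pi2^-1 by rewrite invr_gt0.
(* Both terms of [phase_dist] are quadratic in frequency, so the 1 / (2 pi) in the covectors costs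
   (2 pi)^2. *)
have back : W * enorm (p 0) * (W' * enorm (q 0)) * enorm (x 0 - y 0) ^+ 2
    + enorm (W *: p 0 - W' *: q 0) ^+ 2
  = pi2 ^+ 2 * phase_dist (x 0) ((W / pi2) *: p 0) (y 0) ((W' / pi2) *: q 0).
  have e1 : (W / pi2) *: p 0 - (W' / pi2) *: q 0 = pi2^-1 *: (W *: p 0 - W' *: q 0).
    by rewrite scalerBr !scalerA !(mulrC pi2^-1).
  rewrite /phase_dist e1 (enormZ (W / pi2)) (enormZ (W' / pi2)) (enormZ pi2^-1).
  rewrite (gtr0_norm i0) !gtr0_norm ?divr_gt0//.
  by move: pi2 pi20 => r r_gt0; field; rewrite gt_eqF.
have := ler_wpM2l K1 start_dist_le; rewrite back.
by rewrite /pair_bound !mulrA.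
Qed.

End pair.
End BeamPair.

(** * Matrix and amplitude of a beam *)

Section BeamMatrix.
Context {R : realType} {m : nat}.
Local Notation V := 'rV[R]_m.+1.
Local Notation C := R[i].
Local Notation Re := (@complex.Re R).
Local Notation Im := (@complex.Im R).
Local Notation nn := (m.+1%:R : R).

Lemma dot0l (v : V) : dot 0 v = 0.
Proof. by rewrite -(scale0r (0 : V)) dotZl mul0r. Qed.

(** On real unit vectors u the gap reads e (1 + |u P|^2 + |u Q|^2) < u . u Q <= |u Q|. This yields
    |u Q| < 1/e, then |u P| < 1/e; basis vectors give the entries, and scaling gives the lower bound
    on Q. *)
Lemma gap_bounds (e : R) (P Q : 'M[R]_m.+1) : 0 < e ->
  (forall u v, dot u u + dot v v = 1 -> 0 < gap e P Q u v) ->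
  [/\ entries_le P e^-1, entries_le Q e^-1 &
      forall v, e * dot v v <= dot (v *m Q) v].
Proof.
move=> e0 gp.
have im0 u : imform P Q u 0 = dot u (u *m Q).
  by rewrite /imform /mxim /mxre !mul0mx addr0 dot0l subr0.
have gn u : graphnorm P Q u 0 = dot u u + dot (u *m P) (u *m P) + dot (u *m Q) (u *m Q).
  by rewrite /graphnorm /mxim /mxre !mul0mx addr0 subr0 dot0l addr0.
have gp0 u : dot u u = 1 -> e * (1 + dot (u *m P) (u *m P) + dot (u *m Q) (u *m Q))
    < dot u (u *m Q).
  move=> u1; have := gp u 0.
  rewrite dot0l addr0 => /(_ u1).
  by rewrite /gap im0 gn u1 subr_gt0.
have rows i : enorm (evec i *m P) <= e^-1 /\ enorm (evec i *m Q) <= e^-1.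
  have ei : dot (evec i) (evec i) = 1 :> R by rewrite dot_evec /evec mxE !eqxx.
  have := gp0 _ ei; rewrite -!enorm_sqr.
  have := ler_dot (evec i) (evec i *m Q).
  have -> : enorm (evec i : V) = 1 by rewrite /enorm ei sqrtr1.
  rewrite mul1r; move: (enorm_ge0 (evec i *m P)) (enorm_ge0 (evec i *m Q)).
  move: (enorm (evec i *m P)) (enorm (evec i *m Q)) (dot (evec i) (evec i *m Q)).
  move=> r s d r0 s0 ds H.
  have r2 := mulr_ge0 (ltW e0) (sqr_ge0 r); have s2 := mulr_ge0 (ltW e0) (sqr_ge0 s).
  have es : e * s < 1.
    have [->|s1] := eqVneq s 0; first by rewrite mulr0.
    have sp : 0 < s by rewrite lt_def s1.
    rewrite -(ltr_pM2r sp) mul1r; nra.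
  have er : e * r < 1.
    rewrite -(@ltr_pXn2r _ 2) ?nnegrE ?mulr_ge0 ?(ltW e0)// expr1n exprMn.
    have : e * (e * r ^+ 2) < e * s by rewrite ltr_pM2l//; nra.
    by rewrite mulrA -expr2; lra.
  have inv y : e * y < 1 -> y <= e^-1.
    by move=> ey; rewrite -[e^-1]mul1r ler_pdivlMr// mulrC ltW.
  by split; exact: inv.
split.
- move=> i l; apply: le_trans (rows i).1; apply: le_trans (enorm_coord _ l).
  by rewrite /evec -rowE mxE.
- move=> i l; apply: le_trans (rows i).2; apply: le_trans (enorm_coord _ l).
  by rewrite /evec -rowE mxE.
- move=> v; have [->|v0] := eqVneq v 0.
    by rewrite mul0mx dot0l mulr0.
  have n0 : enorm v != 0 by rewrite enorm_eq0.
  set w := (enorm v)^-1 *: v.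
  have w1 : dot w w = 1.
    by rewrite !dotE -enorm_sqr; field.
  have ew : e <= dot (w *m Q) w.
    have := gp0 _ w1; rewrite (dotC (w *m Q)).
    have := mulr_ge0 (ltW e0) (dot_ge0 (w *m P)).
    by have := mulr_ge0 (ltW e0) (dot_ge0 (w *m Q)); lra.
  have vE : v = enorm v *: w by rewrite /w scalerA divff// scale1r.
  clearbody w; move: (enorm v) vE => r ->.
  rewrite -scalemxAl !dotE w1 !mulrA mulr1.
  by have := ler_wpM2l (sqr_ge0 r) ew; lra.
Qed.

Lemma Re_quad (M : 'M[C]_m.+1) (v : V) :
  Re (quad M v) = dot (v *m map_mx Re M) v.
Proof.
rewrite /quad Re_sum /dot.
under eq_bigr do rewrite Re_sum.
rewrite exchange_big/=; apply: eq_bigr => l _; rewrite mxE mulr_suml.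
by apply: eq_bigr => i _; rewrite !ReM !ImM !Re_real !Im_real mxE; ring.
Qed.

Lemma Im_quad (M : 'M[C]_m.+1) (v : V) :
  Im (quad M v) = dot (v *m map_mx Im M) v.
Proof.
rewrite /quad Im_sum /dot.
under eq_bigr do rewrite Im_sum.
rewrite exchange_big/=; apply: eq_bigr => l _; rewrite mxE mulr_suml.
by apply: eq_bigr => i _; rewrite !ImM !ReM !Re_real !Im_real mxE; ring.
Qed.

Variables (c : V -> R) (c0 cC r0 r1 T delta : R) (pm : bool).
Hypotheses (dc : forall z, differentiable c z)
  (ddc : forall (w : V) z, differentiable ('D_w c) z)
  (dddc : forall (w w' : V) z, differentiable ('D_w ('D_w' c)) z)
  (cb : velocity_le c c0 cC) (r00 : 0 < r0) (delta0 : 0 < delta).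
Variables (xi : nat -> nat -> V) (g : @frame_index R m.+1) (x p : R -> V)
  (M : R -> 'M[C]_m.+1) (A : R -> C).
Hypotheses (xp : is_flow c r0 r1 pm x p) (ric : riccati_flow (Ham c pm) x p M)
  (amp : amplitude_flow (Ham c pm) c x p M A) (dat : beam_data xi c g x p M A).
Local Notation tg := (t_hit g).
Hypotheses (tgT : 0 <= tg <= T)
  (trans : delta * enorm (p tg) <= `|p tg 0 ord0|).

Let P t := map_mx Re (M t).
Let Q t := map_mx Im (M t).
Let D t := hessxx (Ham c pm) (x t) (p t).
Let B t := hessxp (Ham c pm) (x t) (p t).
Let X t := hesspp (Ham c pm) (x t) (p t).

Let c00 : 0 < c0. Proof. by case: cb. Qed.
Let cC0 : 0 < cC.
Proof. by have [_ c0c cCle _ _] := cb; exact: lt_le_trans c00 (le_trans (c0c 0) (cCle 0)). Qed.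
Let r10 : 0 < r1.
Proof. by have [_ /(_ 0)/andP[rp pr]] := xp; exact: lt_le_trans r00 (le_trans rp pr). Qed.
Let normc_le y : `|c y| <= cC.
Proof. by have [? c0c cle _ _] := cb; rewrite ger0_norm// (le_trans _ (c0c y))// ltW. Qed.

Definition hess_bound : R := r1 * cC + cC + cC * (2 / r0).

Let D_le t : entries_le (D t) hess_bound.
Proof.
move=> i l; have [_ _ _ _ c2] := cb; have [_ /(_ t)/andP[_ pr]] := xp.
apply: (le_trans (hessxx_Ham_le pm dc ddc c2 (x t) i l pr)).
by rewrite /hess_bound -addrA lerDl addr_ge0 ?mulr_ge0 ?invr_ge0 ?ltW.
Qed.

Let p_neq0 t : p t != 0. Proof. exact: (is_flow_neq0 r00 xp). Qed.

Let B_le t : entries_le (B t) hess_bound.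
Proof.
move=> i l; have [_ _ _ c2 _] := cb.
apply: (le_trans (hessxp_Ham_le pm dc c2 (x t) i l (p_neq0 t))).
rewrite /hess_bound addrAC lerDr addr_ge0 ?mulr_ge0 ?invr_ge0 ?ltW//.
Qed.

Let X_le t : entries_le (X t) hess_bound.
Proof.
move=> i l; have [_ /(_ t)/andP[pr _]] := xp.
apply: (le_trans (hesspp_Ham_le pm normc_le r00 (x t) i l pr)).
by rewrite /hess_bound lerDr addr_ge0 ?mulr_ge0 ?ltW.
Qed.

Let k : R := nn * (nn * hess_bound).

Let hess0 : 0 <= hess_bound. Proof. exact: le_trans (D_le 0 0 0). Qed.
Let k0 : 0 <= k. Proof. by rewrite !mulr_ge0. Qed.

Definition speed_bound : R := cC + r1 * (nn * cC).

(** Initial gap for the diagonal value 2 pi and a first velocity component of at least c0 delta,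
    times the worst exponential loss over a time T. *)
Definition gap_min : R :=
  initial_gap (m := m) (2 * pi) (c0 * delta) speed_bound
  * expR (- ((4 * (nn * (nn * hess_bound)) + 1) * T)).

Let pi2 : 0 < 2 * pi :> R. Proof. by rewrite mulr_gt0// pi_gt0. Qed.

Lemma gap_min_gt0 : 0 < gap_min.
Proof. by rewrite mulr_gt0 ?expR_gt0// initial_gap_gt0. Qed.

Let x' := (sgn pm * c (x tg) / enorm (p tg)) *: p tg.
Let p' := - ((sgn pm * enorm (p tg)) *: grad c (x tg)).

Let x'E : 'D_1 x tg = x'.
Proof. by have [_ [_ ->]] := ham_flow_ode dc xp.1 tg. Qed.
Let p'E : 'D_1 p tg = p'.
Proof. by have [_ _ [_ ->]] := ham_flow_ode dc xp.1 tg. Qed.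

Let e_p : 0 < enorm (p tg). Proof. by rewrite enorm_gt0. Qed.

(** Velocity is parallel to momentum, so the transversality of p passes to x'; this is the rho by
    which the initial matrix is solved for. *)
Let x'_first : c0 * delta <= `|x' 0 0|.
Proof.
rewrite rowZE !normrM norm_sgn mul1r normfV [`|enorm _|]ger0_norm ?enorm_ge0//.
have [_ c0c _ _ _] := cb; rewrite -mulrA; apply: ler_pM; rewrite ?(ltW c00) ?(ltW delta0)//.
  by rewrite (le_trans (c0c (x tg)))// ler_norm.
by rewrite mulrC ler_pdivlMr.
Qed.

Let x'_le : enorm x' <= speed_bound.
Proof.
rewrite enormZ !normrM norm_sgn mul1r normfV [`|enorm _|]ger0_norm ?enorm_ge0//.
rewrite divfK ?gt_eqF// (le_trans (normc_le _))// lerDl.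
by rewrite !mulr_ge0 ?ltW.
Qed.

Let p'_le : enorm p' <= speed_bound.
Proof.
rewrite enormN enormZ !normrM norm_sgn mul1r ger0_norm ?enorm_ge0//.
have [_ /(_ tg)/andP[_ pr]] := xp.
apply: (@le_trans _ _ (r1 * (nn * cC))); last by rewrite lerDr ltW.
by apply: ler_pM; rewrite ?enorm_ge0//; exact: (grad_le cb).
Qed.

Let M_sym : (M tg)^T = M tg. Proof. by have [_ _ _ []] := dat. Qed.

Let trP : (P tg)^T = P tg.
Proof. by apply/matrixP => i l; rewrite !mxE -[in LHS]M_sym mxE. Qed.
Let trQ : (Q tg)^T = Q tg.
Proof. by apply/matrixP => i l; rewrite !mxE -[in LHS]M_sym mxE. Qed.

Let initial u v : dot u u + dot v v = 1 ->
  0 < gap (initial_gap (m := m) (2 * pi) (c0 * delta) speed_bound) (P tg) (Q tg) u v.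
Proof.
have [_ _ _ [_ M0] [Mk Mq]] := dat; rewrite x'E p'E in Mk Mq.
have rho0 : 0 < c0 * delta by rewrite mulr_gt0.
apply: (initial_gap_ge pi2 rho0 x'_first x'_le p'_le trP trQ).
- by move=> i l i0 l0; rewrite mxE M0//; case: (i == l).
- by move=> i l i0 l0; rewrite mxE M0//; case: (i == l).
- move=> i i0; have /(congr1 Re) := Mk i i0; rewrite ReD ReN Re_real Re_sum => /eqP.
  rewrite subr_eq0 => /eqP ->; rewrite mxE; apply: eq_bigr => l _.
  by rewrite ReM Re_real Im_real mulr0 subr0 mulrC !mxE -[in LHS]M_sym mxE.
- move=> i i0; have /(congr1 Im) := Mk i i0; rewrite ImD ImN Im_real Im_sum add0r => /eqP.
  rewrite oppr_eq0 => /eqP H; rewrite -[RHS]H mxE; apply: eq_bigr => l _.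
  by rewrite ImM Re_real Im_real mulr0 add0r mulrC !mxE -[in LHS]M_sym mxE.
- have /(congr1 Re) := Mq; rewrite ReD ReN Re_real Re_quad => /eqP.
  by rewrite subr_eq0 => /eqP.
- by have /(congr1 Im) := Mq; rewrite ImD ImN Im_real Im_quad subr0.
Qed.

Let dPQ := riccati_flow_parts ric.

Let D_sym t : (D t)^T = D t. Proof. exact: hessxx_Ham_sym. Qed.
Let X_sym t : (X t)^T = X t. Proof. exact: hesspp_Ham_sym. Qed.

Let gap_t t u v : 0 <= t <= tg -> dot u u + dot v v = 1 ->
  0 < gap gap_min (P t) (Q t) u v.
Proof.
move=> tt uv; have /andP[t0 ttg] := tt; have /andP[_ tgle] := tgT.
have := @riccati_gap_gt0 _ _ P Q D B X (fun t i l => (dPQ t i l).1)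
  (fun t i l => (dPQ t i l).2) D_sym X_sym k k0
  (fun t y => enorm_mulmx y (D_le t)) (fun t y => enorm_mulmx y (B_le t))
  (fun t y => enorm_mulmx y (entries_le_tr (B_le t)))
  (fun t y => enorm_mulmx y (X_le t)) 0 tg _ (initial_gap_gt0 _ _ pi2) initial
  t u v tt uv.
(* The time-dependent gap is lowered to [gap_min], using tg - t <= T. *)
move=> /lt_le_trans; apply; rewrite lerD2l lerN2 ler_wpM2r//.
  by rewrite !addr_ge0 ?dot_ge0.
rewrite ler_pM2l ?initial_gap_gt0// ler_expR -mulrN ler_wpM2l//; last by lra.
by rewrite addr_ge0// mulr_ge0.
Qed.

Lemma beam_matrix_bounds t : 0 <= t <= tg ->
  [/\ entries_le (P t) gap_min^-1, entries_le (Q t) gap_min^-1 &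
      forall v, gap_min * dot v v <= dot (v *m Q t) v].
Proof. by move=> tt; apply: gap_bounds gap_min_gt0 _ => u v; exact: gap_t. Qed.

Lemma beam_matrix_sym : (M 0)^T = M 0.
Proof.
have /andP[tg0 _] := tgT; have tt : 0 <= (0 : R) <= tg by rewrite lexx tg0.
have g1 : 0 <= gap_min^-1 by rewrite invr_ge0 ltW// gap_min_gt0.
pose K : R := hess_bound + gap_min^-1.
have wide (S : 'M[R]_m.+1) (a : R) : entries_le S a -> a <= K -> entries_le S K.
  by move=> Sa aK i l; exact: le_trans (Sa i l) aK.
have hK : hess_bound <= K by rewrite lerDl.
have gK : gap_min^-1 <= K by rewrite lerDr.
have B_K t := wide _ _ (B_le t) hK.
have X_K t := wide _ _ (X_le t) hK.
have P_K t : 0 <= t <= tg -> entries_le (P t) K.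
  by case/beam_matrix_bounds => + _ _ => /wide; apply.
have Q_K t : 0 <= t <= tg -> entries_le (Q t) K.
  by case/beam_matrix_bounds => _ + _ => /wide; apply.
have [P0 Q0] := riccati_symmetric (fun t i l => (dPQ t i l).1)
  (fun t i l => (dPQ t i l).2) D_sym X_sym B_K X_K P_K Q_K trP trQ tt.
exact: trmx_parts.
Qed.

(** Uses |H| >= c0 r0 in the denominator and, in the bracket, 1 / [gap_min] for the entries of Re M,
    cC for the p-gradient and r1 n cC for the x-gradient. *)
Definition amplitude_rate : R := (2 * (c0 * r0))^-1 *
  (cC ^+ 2 * (nn * gap_min^-1) + cC * (r1 * (nn * cC))
   + nn * (nn * gap_min^-1) * cC ^+ 2).

Let H t := Ham c pm (x t) (p t).
Let gp t := gradp (Ham c pm) (x t) (p t).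
Let gx t := gradx (Ham c pm) (x t) (p t).
Let kappa t : C := (2 * H t)%:C^-1 *
  ((c (x t) ^+ 2)%:C * \tr (M t) - (dot (gp t) (gx t))%:C - quad (M t) (gp t)).

Let gp_le t : enorm (gp t) <= cC.
Proof.
rewrite /gp gradp_Ham// enormZ !normrM norm_sgn mul1r normfV.
by rewrite [`|enorm _|]ger0_norm ?enorm_ge0// divfK// enorm_eq0.
Qed.

Let gx_le t : enorm (gx t) <= r1 * (nn * cC).
Proof.
rewrite /gx gradx_Ham// enormZ !normrM norm_sgn mul1r ger0_norm ?enorm_ge0//.
have [_ /(_ t)/andP[_ pr]] := xp.
by apply: ler_pM; rewrite ?enorm_ge0//; exact: (grad_le cb).
Qed.

Let kappa_le t : 0 <= t <= tg -> `|Re (kappa t)| <= amplitude_rate.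
Proof.
move=> /beam_matrix_bounds[Pt _ _].
have g1 : 0 <= gap_min^-1 by rewrite invr_ge0 ltW// gap_min_gt0.
have Hge : c0 * r0 <= `|H t|.
  rewrite /H /Ham !normrM -/(sgn pm : R) norm_sgn mul1r [`|enorm _|]ger0_norm ?enorm_ge0//.
  have [_ c0c _ _ _] := cb; have [_ /(_ t)/andP[pr _]] := xp.
  apply: ler_pM; rewrite ?(ltW c00) ?(ltW r00)//.
  by rewrite (le_trans (c0c (x t)))// ler_norm.
have cr0 : 0 < c0 * r0 by rewrite mulr_gt0.
rewrite /kappa -fmorphV ReM Re_real Im_real mul0r subr0 normrM.
apply: ler_pM => //.
  rewrite normfV normrM [`|2|]ger0_norm// lef_pV2 ?posrE ?mulr_gt0 ?ler_pM2l//.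
  exact: lt_le_trans Hge.
rewrite !(ReD, ReN, ReM, Re_real, Im_real, Re_quad) mul0r subr0.
apply: (le_trans (ler_normB _ _)); apply: lerD.
  apply: (le_trans (ler_normB _ _)); apply: lerD.
    rewrite normrM [`|_ ^+ 2|]ger0_norm ?sqr_ge0//; apply: ler_pM; rewrite ?sqr_ge0//.
      rewrite -[X in X <= _]real_normK ?num_real// ler_pXn2r ?nnegrE//.
      exact: ltW.
    rewrite /mxtrace Re_sum (le_trans (ler_norm_sum _ _ _))//.
    rewrite mulr_natl -[m.+1 in leRHS]card_ord -sumr_const; apply: ler_sum => i _.
    by have := Pt i i; rewrite mxE.
  apply: (le_trans (ler_norm_dot _ _)); apply: ler_pM; rewrite ?enorm_ge0//.
apply: (le_trans (ler_norm_dot _ _)).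
rewrite expr2 mulrA; apply: ler_pM; rewrite ?enorm_ge0//.
apply: (le_trans (enorm_mulmx _ Pt)); apply: ler_wpM2l; last exact: gp_le.
by rewrite !mulr_ge0.
Qed.

Lemma beam_amplitude_le :
  Normc.normc (A 0) <= expR (amplitude_rate * T) * Normc.normc (A tg) /\
  Normc.normc (A tg) <= expR (amplitude_rate * T) * Normc.normc (A 0).
Proof.
have /andP[tg0 tgle] := tgT.
have dA t : is_deriveC A t (- (A t * kappa t)).
  by have := amp t; rewrite -mulrA.
have t00 : 0 <= (0 : R) <= tg by rewrite lexx.
have tgg : 0 <= tg <= tg by rewrite lexx andbT.
have rate0 : 0 <= amplitude_rate by exact: le_trans (kappa_le t00).
have up s t : 0 <= s <= tg -> 0 <= t <= tg -> `|t - s| <= T ->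
    Normc.normc (A t) <= expR (amplitude_rate * T) * Normc.normc (A s).
  move=> ss tt ts.
  rewrite -(@ler_pXn2r _ 2) ?nnegrE ?normc_ge0 ?mulr_ge0 ?expR_ge0 ?normc_ge0//.
  rewrite (le_trans (amplitude_gronwall dA kappa_le ss tt))// exprMn.
  rewrite ler_wpM2r ?sqr_ge0// -expRM_natl ler_expR.
  by rewrite mulrA ler_wpM2l// mulr_ge0.
by split; apply: up; rewrite ?subr0 ?sub0r ?normrN ?ger0_norm.
Qed.

End BeamMatrix.

(** * Well-spreadness *)

Lemma mxReZ {R : realType} n (r : R) (N : 'M[R[i]]_n) :
  map_mx (@complex.Re R) (r%:C *: N) = r *: map_mx (@complex.Re R) N.
Proof.
by apply/matrixP => i l; rewrite !mxE ReM Re_real Im_real mul0r subr0.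
Qed.

Lemma mxImZ {R : realType} n (r : R) (N : 'M[R[i]]_n) :
  map_mx (@complex.Im R) (r%:C *: N) = r *: map_mx (@complex.Im R) N.
Proof.
by apply/matrixP => i l; rewrite !mxE ImM Re_real Im_real mul0r addr0.
Qed.

Lemma phase_distC {R : realType} n (x xi x' xi' : 'rV[R]_n) :
  phase_dist x xi x' xi' = phase_dist x' xi' x xi.
Proof.
by rewrite /phase_dist (enorm_distC x') (enorm_distC xi') (mulrC (enorm xi')).
Qed.

Lemma phase_dist_ge0 {R : realType} n (x xi x' xi' : 'rV[R]_n) :
  0 <= phase_dist x xi x' xi'.
Proof.
by apply: addr_ge0; [apply: mulr_ge0; first apply: mulr_ge0|];
  rewrite ?sqr_ge0 ?enorm_ge0.
Qed.

(** The powers depending on j cancel, so the rescaled amplitude at the hitting time is the same for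
    every beam. *)
Lemma amplitude_scale {R : realType} (j d : nat) :
  4 `^ (- (j%:R * d%:R / 4)) * 2 `^ ((j%:R + 1 / 2) * d%:R / 2)
  = 2 `^ (d%:R / 4) :> R.
Proof.
have e4 : 4 = 2 `^ 2 :> R by rewrite powR_mulrn// -natrX.
rewrite {1}e4 -powRrM -powRD; last by rewrite pnatr_eq0 implybT.
by congr (_ `^ _); field.
Qed.

Theorem theorem6p5 (R : realType) (m : nat) (hd : (2 <= m.+1)%N)
  (T : R) (hT : 0 < T)
  (c : 'rV[R]_m.+1 -> R) (hc : velocity c)
  (N : nat -> nat) (xi : nat -> nat -> 'rV[R]_m.+1) (hxi : frame_points N xi)
  (Lam : set 'rV[R]_m.+1) (hLam : full_rank_lattice Lam)
  (hframe : forall s : R, -1 <= s <= 1 ->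
     frame_op_invertible N xi Lam s /\ frame_norm_equiv N xi Lam s)
  (h : 'rV[R]_m.+1 -> R[i]) (hh : H1_trace0 h)
  (L U kappa : R) (hL : 0 < L < T) (hU : 0 < U < T) (hkappa : 0 < kappa)
  (a : 'rV[R]_m.+1 -> R[i]) (b : 'rV[R]_m.+1 -> 'rV[R]_m.+1 -> R[i])
  (hab : cutoff c L U kappa a b)
  (hcone : cone_condition c T L U)
  (x p : bool -> frame_index -> R -> 'rV[R]_m.+1)
  (M : bool -> frame_index -> R -> 'M[R[i]]_m.+1)
  (A : bool -> frame_index -> R -> R[i])
  (hbeam : forall (pm : bool) (g : frame_index),
     Gamma_h_pm xi N Lam (fun y zeta => a y * b y zeta) h pm g ->
     back_propagated xi c pm g (x pm g) (p pm g) (M pm g) (A pm g)) :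
  forall pm : bool,
    well_spread xi N Lam
      (Gamma_h_pm xi N Lam (fun y zeta => a y * b y zeta) h pm)
      (fun g => 4 ^+ lev g)
      (fun g => x pm g 0)
      (fun g => (4 ^+ lev g / (2 * pi)) *: p pm g 0)
      (fun g => (4 `^ (- ((lev g)%:R * m.+1%:R / 4)))%:C * A pm g 0)
      (fun g => ((2 * pi)^-1)%:C *: M pm g 0).
Proof.
have [hs _ _] := hc.
have dc z : differentiable c z := hs [::] z.
have ddc (w : 'rV[R]_m.+1) z : differentiable ('D_w c) z := hs [:: w] z.
have dddc (w w' : 'rV[R]_m.+1) z : differentiable ('D_w ('D_w' c)) z :=
  hs [:: w; w'] z.
have [c0 [cC cb]] := velocity_bounds hc.
have [Ka Ka0 aKa] := cutoff_support_bounded hab.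
have c00 : 0 < c0 by case: cb.
pose r0 := p_min c0 cC kappa; pose r1 := p_max c0.
have r00 : 0 < r0 := p_min_gt0 cb hkappa.
have r10 : 0 < r1 by rewrite divr_gt0// mulr_gt0// pi_gt0.
have pi20 : 0 < 2 * pi :> R by rewrite mulr_gt0// pi_gt0.
(* kappa c0 is the transversality of [beam_transversal]; the cone condition admits only delta <=
   1. *)
pose delta := Num.min 1 (kappa * c0).
have delta0 : 0 < delta by rewrite lt_min ltr01 mulr_gt0.
have delta1 : 0 < delta <= 1 by rewrite delta0 ge_min lexx.
have [mu mu0 cone] := hcone delta delta1.
move=> pm.
set G0 := Gamma_h_pm xi N Lam _ h pm.
have flow g : G0 g -> is_flow c r0 r1 pm (x pm g) (p pm g).
  by move=> Gg; exact: (beam_is_flow dc cb hxi hkappa hab Gg (hbeam _ _ Gg)).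
have time g : G0 g -> 0 <= t_hit g <= T.
  move=> /(beam_time hab) /andP[Lt tU].
  have /andP[L0 _] := hL; have /andP[_ UT] := hU.
  by rewrite (le_trans (ltW L0) Lt) (le_trans tU (ltW UT)).
have trans g : G0 g ->
    delta * enorm (p pm g (t_hit g)) <= `|p pm g (t_hit g) 0 ord0|.
  move=> Gg; apply: le_trans (beam_transversal cb hxi hkappa hab Gg (hbeam _ _ Gg)).
  by rewrite ler_wpM2r ?enorm_ge0// ge_min lexx orbT.
have hit g : G0 g -> beam_hit c r0 r1 T Ka mu pm (4 ^+ lev g) (x pm g) (p pm g)
    (a_st g) (xi_st xi g).
  move=> Gg; have bp := hbeam _ _ Gg; have [hf _ _ [xhit [phit _] _ _ _]] := bp.
  have x0 : x pm g (t_hit g) 0 ord0 = 0 by rewrite xhit mxE eqxx.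
  apply: BeamHit.
  - exact: flow.
  - exact: exprn_gt0.
  - exact: time.
  - exact/aKa/(beam_neq0 Gg).1.
  - exact: xhit.
  - by rewrite {1}xi_tildeE tailZ -phit.
  - rewrite {1}xi_tildeE rowZE.
    by rewrite (beam_speed_xi dc cb hxi hkappa hab Gg bp 0); ring.
  - by have /andP[] := beam_xi_st hxi Gg.
  - move=> t /andP[t0 tT]; apply: (cone _ _ _ hf _ (beam_time hab Gg) x0 (trans g Gg)).
    by rewrite tT andbT (le_trans _ t0)// oppr_le0 ltW.
pose eps := gap_min (m := m) c0 cC r0 r1 T delta.
have eps0 : 0 < eps := gap_min_gt0 _ _ _ _ _ _.
have bounds g (Gg : G0 g) : entries_le (map_mx (@complex.Re R) (M pm g 0)) eps^-1 /\
    entries_le (map_mx (@complex.Im R) (M pm g 0)) eps^-1 /\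
    forall v, eps * dot v v <= dot (v *m map_mx (@complex.Im R) (M pm g 0)) v.
  have [_ ric _ dat] := hbeam _ _ Gg; have /andP[t0 _] := time g Gg.
  have tt : 0 <= (0 : R) <= t_hit g by rewrite lexx t0.
  by have [] := beam_matrix_bounds dc ddc dddc cb r00 delta0 (flow g Gg) ric dat
    (time g Gg) (trans g Gg) tt.
pose rate : R := amplitude_rate (m := m) c0 cC r0 r1 T delta.
pose E := expR (rate * T); pose aa : R := 2 `^ (m.+1%:R / 4).
have E0 : 0 < E := expR_gt0 _.
have aa0 : 0 < aa by rewrite powR_gt0.
have ampl g (Gg : G0 g) (z := (4 `^ (- ((lev g)%:R * m.+1%:R / 4)))%:C * A pm g 0) :
    Normc.normc z <= E * aa /\ aa <= E * Normc.normc z.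
  have [_ ric amp dat] := hbeam _ _ Gg.
  have := beam_amplitude_le dc ddc dddc cb r00 delta0 (flow g Gg) ric amp dat
    (time g Gg) (trans g Gg); rewrite -/rate -/E.
  have [_ _ -> _ _] := dat.
  rewrite normc_real [`|2 `^ _|]ger0_norm ?powR_ge0// => -[up dn].
  rewrite /z Normc.normcM normc_real ger0_norm ?powR_ge0//.
  rewrite /aa -(amplitude_scale (lev g)) !(mulrCA E).
  by split; rewrite ler_wpM2l ?powR_ge0.
split.
- by move=> g [[]].
- move=> g Gg; split.
  + exact: exprn_gt0.
  + by rewrite scaler_eq0 negb_or gt_eqF ?divr_gt0 ?exprn_gt0//=
      (is_flow_neq0 r00 (flow g Gg)).
  + have [_ lo] := ampl g Gg; apply: contraTneq lo => ->.
    by rewrite normc_real normr0 mulr0 -ltNge.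
(* The points [a_st] lie in the support of a, so their mutual distances are at most 2 Ka and the
   added 1 suffices. *)
- exists (Ka + Ka) => [|g g' Gg Gg']; first by rewrite addr_gt0.
  apply: (@le_trans _ _ (Ka + Ka)).
    by rewrite (le_trans (enormB _ _))// lerD// (hit_bound (hit _ _)).
  by rewrite ler_peMr ?addr_ge0 ?(ltW Ka0)// lerDr enorm_ge0.
- pose K := pair_bound (m := m) cC r0 r1 T Ka mu.
  exists (`|K| + 1) => [|g g' Gg Gg']; first by rewrite ltr_wpDl.
  have KK f f' : f <= K * f' -> 0 <= f' -> f <= (`|K| + 1) * f'.
    move=> /le_trans + f'0; apply; rewrite ler_wpM2r// (le_trans (ler_norm K))//.
    by rewrite lerDl.
  (* [phase_dist_back] expects the larger frequency first; the phase distance is symmetric. *)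
  have [le|/ltW le] := leP (4 ^+ lev g' : R) (4 ^+ lev g).
    apply: KK (phase_dist_ge0 _ _ _ _).
    exact: (phase_dist_back dc ddc cb r00 hT mu0 (hit g Gg) (hit g' Gg') le).
  rewrite phase_distC [X in _ <= _ * X]phase_distC.
  apply: KK (phase_dist_ge0 _ _ _ _).
  exact: (phase_dist_back dc ddc cb r00 hT mu0 (hit g' Gg') (hit g Gg) le).
have pi2V : 0 < (2 * pi)^-1 :> R by rewrite invr_gt0.
have pi2V1 : (2 * pi)^-1 <= 1 :> R.
  by rewrite invf_le1//; have := @pi_ge2 R; lra.
have epsV : 0 < eps^-1 by rewrite invr_gt0.
split.
- move=> g Gg; have [_ ric _ dat] := hbeam _ _ Gg.
  rewrite linearZ/=; congr (_ *: _).
  exact: (beam_matrix_sym dc ddc dddc cb r00 delta0 (flow g Gg) ric dat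
    (time g Gg) (trans g Gg)).
- exists (2 * m.+1%:R * eps^-1) => [|g Gg]; first by rewrite !mulr_gt0.
  have [Pe [Qe _]] := bounds g Gg.
  have sc (r : R) : `|r| <= eps^-1 -> `|(2 * pi)^-1 * r| <= eps^-1.
    move=> re; rewrite normrM gtr0_norm// (le_trans _ re)//.
    by rewrite ler_piMl.
  apply: cmxnorm_le; [rewrite mxReZ|rewrite mxImZ] => i l; rewrite mxE; apply: sc;
    [exact: Pe|exact: Qe].
- exists ((2 * pi)^-1 * eps) => [|g Gg v]; first by rewrite mulr_gt0.
  have [_ [_ Qge]] := bounds g Gg.
  by rewrite mxImZ -scalemxAr dotZl enorm_sqr -mulrA ler_pM2l.
(* The summand 1 serves omega = 4^j, r1 bounds |xi| / omega from above, and 2 pi / r0 bounds omega /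
   |xi|. *)
- exists (1 + r1 + 2 * pi / r0) => [|g Gg].
    by apply: addr_gt0; [exact: addr_gt0|exact: divr_gt0].
  have w0 : 0 < 4 ^+ lev g :> R by exact: exprn_gt0.
  have q0 : 0 < 2 * pi / r0 by rewrite divr_gt0.
  have [_ /(_ 0)/andP[pr0 pr1]] := flow g Gg.
  have w2 : 0 < 4 ^+ lev g / (2 * pi) :> R by exact: divr_gt0.
  have K1 : 1 <= 1 + r1 + 2 * pi / r0 by lra.
  split.
  + by rewrite ler_peMl// ltW.
  + by rewrite ler_peMl// ltW.
  + rewrite enormZ gtr0_norm ?divr_gt0// [leRHS]mulrC -(mulrA (4 ^+ _)) ler_pM2l//.
    apply: (@le_trans _ _ (1 * enorm (p pm g 0))); last by lra.
    by rewrite ler_wpM2r ?enorm_ge0.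
  + rewrite enormZ gtr0_norm ?divr_gt0//.
    apply: (@le_trans _ _ (2 * pi / r0 * (4 ^+ lev g / (2 * pi) * r0))).
      rewrite (_ : _ * _ = 4 ^+ lev g)//.
      by move: (2 * pi) pi20 => s s0; field; rewrite !gt_eqF.
    apply: ler_pM; rewrite ?(ltW q0)//.
    * by apply: mulr_ge0; exact: ltW.
    * by lra.
    * by apply: ler_wpM2l => //; exact: ltW.
- exists (E * aa + E / aa) => [|g Gg]; first by rewrite addr_gt0 ?divr_gt0 ?mulr_gt0.
  have [up lo] := ampl g Gg; split.
    by rewrite (le_trans up)// lerDl divr_ge0 ?ltW.
  apply: (@le_trans _ _ (E / aa * Normc.normc
      ((4 `^ (- ((lev g)%:R * m.+1%:R / 4)))%:C * A pm g 0))).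
    by rewrite mulrAC ler_pdivlMr// mul1r.
  by rewrite ler_wpM2r ?normc_ge0// lerDr mulr_ge0 ?ltW.
Qed.
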